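(* Let $u$ and $v$ be unitary $d$-tuples, each acting on a separable Hilbert space. Then $$\mathrm d_{\mathrm{HR}}(u,v)\le 10\,\mathrm d_{\mathrm{rD}}(u,v)^{1/2}.$$
   Context: For $d$-tuples $A,B$ of operators on the same Hilbert space, $\|A-B\|=\max_i\|A_i-B_i\|$; maps are applied to tuples entrywise. $C^*(A)$ is the unital C*-algebra generated by $A_1,\dots,A_d$, and $S_A=\mathrm{span}\{1,A_i,A_i^*: i=1,\dots,d\}$ is the operator system generated by $A$. Write $A\sim A'$ if there is a $*$-isomorphism $C^*(A)\to C^*(A')$ mapping $A_i$ to $A'_i$ for all $i$. The Haagerup–Rørdam distance is $\mathrm d_{\mathrm{HR}}(u,v)=\inf\{\|u'-v'\|\}$, the infimum over all Hilbert spaces $\mathcal H$ and all $u',v'\in B(\mathcal H)^d$ with $u'\sim u$, $v'\sim v$. The one-sided relaxed dilation distance is $\mathrm d_{\mathrm{rD}}(A\to B)=\inf\|\pi(A)-\Psi(B)\|$, the infimum over all Hilbert spaces $\mathcal L$, all unital faithful $*$-representations $\pi\colon C^*(A)\to B(\mathcal L)$ and all unital completely positive maps $\Psi\colon S_B\to B(\mathcal L)$. The relaxed dilation distance is $\mathrm d_{\mathrm{rD}}(A,B)=\max\{\mathrm d_{\mathrm{rD}}(A\to B),\mathrm d_{\mathrm{rD}}(B\to A)\}$. *)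

(* Defs.v *)
From HB Require Import structures.
From mathcomp Require Import all_boot all_order all_algebra.
From mathcomp Require Import sesquilinear.
From mathcomp Require Import complex.
From mathcomp Require Import all_classical all_reals all_analysis.

Set Implicit Arguments.
Unset Strict Implicit.
Unset Printing Implicit Defensive.

Import Order.TTheory GRing.Theory Num.Theory.
Import numFieldNormedType.Exports.

Local Open Scope classical_set_scope.
Local Open Scope ring_scope.
Local Open Scope complex_scope.

(* R[i] as a numFieldType.  Naming the instance avoids the reverse coercion that
   a bare R[i] would insert and that prevents rewriting with norms. *)
Notation complexF R := (complex_complex__canonical__Num_NumField R).

(* Complex Hilbert spaces; the inner product is linear in its first argument. *)
HB.mixin Record CompleteNormedModule_isHilbert (R : realType) H
    & CompleteNormedModule (complexF R) H := {
  hdot : {dot H for Num.conj};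
  hdot_norm : forall x : H, `|x| ^+ 2 = hdot x x
}.

#[short(type="hilbertType")]
HB.structure Definition Hilbert (R : realType) :=
  {H of CompleteNormedModule_isHilbert R H
      & CompleteNormedModule (complexF R) H}.

Notation "''[' x , y ]" := (hdot x y)
  (at level 0, format "''[' x ,  y ]") : ring_scope.

Section BoundedOperators.
Context {R : realType} {H : hilbertType R}.

Definition bounded_op : {pred H -> H} :=
  fun T => `[< linear T /\ continuous T >].

Lemma bounded_op_submod_closed : submod_closed bounded_op.
Proof.
split.
  apply/asboolP; split; last exact: cst_continuous.
  by move=> a u v; rewrite -[RHS]/(a *: (0 : H) + 0) scaler0 addr0.
move=> a S T /asboolP[lS cS] /asboolP[lT cT]; apply/asboolP; split.
  move=> b u v; rewrite !addrfctE !scalrfctE lS lT.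
  rewrite !scalerDr !scalerA (mulrC a b) -!addrA.
  by congr (_ + _); rewrite addrCA.
move=> x; apply: cvgD; last exact: cT.
by apply: cvgZr; exact: cS.
Qed.

HB.instance Definition _ :=
  GRing.isSubmodClosed.Build (complexF R) (H -> H) bounded_op
    bounded_op_submod_closed.

Record bop := Bop { bop_fun :> H -> H; _ : bop_fun \in bounded_op }.

End BoundedOperators.
Arguments bop {R} H.
Notation "''B(' H )" := (bop H) (at level 0, format "''B(' H )") : type_scope.

HB.instance Definition _ (R : realType) (H : hilbertType R) :=
  [isSub for @bop_fun R H].
HB.instance Definition _ (R : realType) (H : hilbertType R) :=
  [Choice of 'B(H) by <:].
HB.instance Definition _ (R : realType) (H : hilbertType R) :=
  [SubChoice_isSubLmodule of 'B(H) by <:].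

Section BoundedOperatorsTheory.
Context {R : realType} {H : hilbertType R}.
Implicit Types S T : 'B(H).

Lemma bopP T : linear T /\ continuous T.
Proof. by case: T => T /= /asboolP. Qed.

Lemma bop_ext S T : (forall x, S x = T x) -> S = T.
Proof. by move=> ST; apply/val_inj/funext. Qed.

HB.instance Definition _ T :=
  GRing.isLinear.Build (complexF R) H H *:%R (T : H -> H) (bopP T).1.

Lemma bopD S T x : (S + T) x = S x + T x. Proof. by []. Qed.
Lemma bopZ a T x : (a *: T) x = a *: T x. Proof. by []. Qed.

Lemma bop_one_subproof : (idfun : H -> H) \in bounded_op.
Proof. by apply/asboolP; split => // x; exact: cvg_id. Qed.

Lemma bop_mul_subproof S T : S \o T \in bounded_op.
Proof.
apply/asboolP; split; first by move=> a u v /=; rewrite !linearP.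
by move=> x; apply: continuous_comp; [exact: (bopP T).2|exact: (bopP S).2].
Qed.

Definition bop_one : 'B(H) := Bop bop_one_subproof.
Definition bop_mul S T : 'B(H) := Bop (bop_mul_subproof S T).

Let mulA : associative bop_mul. Proof. by move=> ? ? ?; exact: bop_ext. Qed.
Let mul1 : left_id bop_one bop_mul. Proof. by move=> ?; exact: bop_ext. Qed.
Let mulr1 : right_id bop_one bop_mul. Proof. by move=> ?; exact: bop_ext. Qed.
Let mulDl : left_distributive bop_mul +%R.
Proof. by move=> ? ? ?; exact: bop_ext. Qed.
Let mulDr : right_distributive bop_mul +%R.
Proof. by move=> S ? ? ; apply: bop_ext => x /=; rewrite linearD. Qed.

HB.instance Definition _ :=
  GRing.Zmodule_isPzRing.Build 'B(H) mulA mul1 mulr1 mulDl mulDr.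

Definition hnorm (x : H) : R := complex.Re `|x|.

Lemma hnormE x : (hnorm x)%:C = `|x|.
Proof. by rewrite /hnorm RRe_real// ger0_real. Qed.

Lemma hnormZ a x : hnorm (a *: x) = complex.Re `|a| * hnorm x.
Proof.
rewrite /hnorm normrZ.
rewrite -[in LHS](RRe_real (ger0_real (normr_ge0 a))).
by rewrite -[in LHS](RRe_real (ger0_real (normr_ge0 x))) -rmorphM.
Qed.

Lemma hnorm_ge0 x : 0 <= hnorm x.
Proof. by rewrite -ler0c hnormE. Qed.

Lemma Re_norm (a : R[i]) : (complex.Re `|a|)%:C = `|a|.
Proof. by rewrite RRe_real// ger0_real. Qed.

Lemma Re_norm_ge0 (a : R[i]) : 0 <= complex.Re `|a|.
Proof. by rewrite -ler0c Re_norm. Qed.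

Definition opnorm T : R := sup [set hnorm (T x) | x in [set x | `|x| <= 1]].

Lemma opnorm_has_sup T :
  has_sup [set hnorm (T x) | x in [set x | `|x| <= 1]].
Proof.
split; first by exists (hnorm (T 0)), 0 => //=; rewrite normr0.
have /linear_boundedP/pinfty_ex_gt0[r r0 Tr] :
    bounded_near (T : {linear H -> H}) (nbhs 0).
  by apply/linear_bounded_continuous; exact: (bopP T).2.
exists (complex.Re r) => _ [x /= x1 <-].
rewrite -lecR hnormE RRe_real ?gtr0_real// (le_trans (Tr x))//.
by rewrite ler_piMr// ltW.
Qed.

Lemma opnorm_ub T x : `|x| <= 1 -> hnorm (T x) <= opnorm T.
Proof.
by move=> x1; apply: (ub_le_sup (opnorm_has_sup T).2); exists x.
Qed.

Lemma opnorm_le T (M : R) :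
  (forall x, `|x| <= 1 -> hnorm (T x) <= M) -> opnorm T <= M.
Proof.
move=> TM; apply: ge_sup; first exact: (opnorm_has_sup T).1.
by move=> _ [x /= x1 <-]; exact: TM.
Qed.

Lemma opnorm_ge0 T : 0 <= opnorm T.
Proof.
apply: le_trans (opnorm_ub T (x := 0) _); first exact: hnorm_ge0.
by rewrite normr0.
Qed.

Let bop_norm T : R[i] := (opnorm T)%:C.

Let bop_normD S T : bop_norm (S + T) <= bop_norm S + bop_norm T.
Proof.
rewrite /bop_norm -rmorphD lecR; apply: opnorm_le => x x1.
apply: le_trans (lerD (opnorm_ub S x1) (opnorm_ub T x1)).
by rewrite bopD -lecR rmorphD /= !hnormE ler_normD.
Qed.

Let opnormZ_le a T : opnorm (a *: T) <= complex.Re `|a| * opnorm T.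
Proof.
apply: opnorm_le => x x1; rewrite bopZ hnormZ ler_wpM2l ?opnorm_ub//.
exact: Re_norm_ge0.
Qed.

Let bop_normZ (a : R[i]) T : bop_norm (a *: T) = `|a| * bop_norm T.
Proof.
rewrite /bop_norm -[`|a|]Re_norm -rmorphM.
apply: (congr1 (real_complex R)).
have [->|a0] := eqVneq a 0.
  rewrite scale0r normr0 mul0r; apply/eqP; rewrite eq_le opnorm_ge0 andbT.
  by apply: opnorm_le => x _; rewrite /hnorm /= normr0.
apply/eqP; rewrite eq_le opnormZ_le /=.
have ra : 0 < complex.Re `|a| by rewrite -ltcR Re_norm normr_gt0.
rewrite -ler_pdivlMl//; have := opnormZ_le a^-1 (a *: T).
rewrite scalerA mulVf// scale1r => /le_trans; apply.
rewrite ler_wpM2r ?opnorm_ge0// -lecR Re_norm normfV.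
by rewrite fmorphV /= Re_norm.
Qed.

Let bop_norm0_eq0 T : bop_norm T = 0 -> T = 0.
Proof.
move=> /(@complexI R) T0; apply: bop_ext => x; apply/normr0_eq0.
have [->|x0] := eqVneq x 0; first by rewrite linear0 normr0.
have x1 : `| `|x|^-1 *: x| <= 1.
  by rewrite normrZ normfV normr_id mulVf ?normr_eq0.
have := opnorm_ub T x1; rewrite T0 -lecR hnormE linearZ /= normrZ.
rewrite normfV normr_id pmulr_rle0 ?invr_gt0 ?normr_gt0//.
by rewrite normr_le0 => /eqP ->; rewrite normr0.
Qed.

HB.instance Definition _ :=
  Lmodule_isNormed.Build (complexF R) 'B(H) bop_normD bop_normZ bop_norm0_eq0.

Lemma bop_normE T : `|T| = (opnorm T)%:C.
Proof. by []. Qed.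

Definition is_adjoint T S := forall x y, '[T x, y] = '[x, S y].

(* The adjoint is unique, and it exists for every T by the Riesz
   representation theorem, so the default value is never used. *)
Definition adj T : 'B(H) := xget 0 [set S | is_adjoint T S].

Definition unitary T := adj T * T = 1 /\ T * adj T = 1.

Definition unital_cstar_subalgebra (M : set 'B(H)) :=
  [/\ M 1,
      forall (a : R[i]) S T, M S -> M T -> M (a *: S + T),
      forall S T, M S -> M T -> M (S * T),
      forall T, M T -> M (adj T)
    & closed M].

Definition cstar (d : nat) (A : 'I_d -> 'B(H)) : set 'B(H) :=
  smallest unital_cstar_subalgebra (range A).

Definition opsys (d : nat) (A : 'I_d -> 'B(H)) : set 'B(H) :=
  [set T : 'B(H) | exists (a : R[i]) (b c : 'I_d -> R[i]),
    T = a *: (1 : 'B(H)) + \sum_i b i *: A i + \sum_i c i *: adj (A i)].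

Definition tdist (d : nat) (A B : 'I_d -> 'B(H)) : R :=
  \big[Num.max/0]_(i < d) opnorm (A i - B i).

(* Positivity in M_n(B(H)), identified with B(H^n). *)
Definition mx_positive (n : nat) (T : 'M['B(H)]_n) :=
  forall x : 'I_n -> H, 0 <= \sum_i '[\sum_j T i j (x j), x i].

End BoundedOperatorsTheory.

(* Maps defined on a subset M of B(H), such as C*(A) or S_A, are represented by
   total functions on B(H); only their values on M matter. *)
Section Maps.
Context {R : realType} {H K : hilbertType R}.
Implicit Types (M : set 'B(H)) (f : 'B(H) -> 'B(K)).

Definition linear_on M f :=
  forall (a : R[i]) S T, M S -> M T -> f (a *: S + T) = a *: f S + f T.

Definition star_hom M f :=
  [/\ linear_on M f,
      forall S T, M S -> M T -> f (S * T) = f S * f T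
    & forall T, M T -> f (adj T) = adj (f T)].

Definition faithful_unital_rep M f :=
  [/\ star_hom M f, f 1 = 1 & set_inj M f].

Definition ucp M f :=
  [/\ linear_on M f, f 1 = 1
    & forall (n : nat) (T : 'M['B(H)]_n), (forall i j, M (T i j)) ->
        mx_positive T -> mx_positive (map_mx f T)].

Definition tuple_equiv (d : nat) (A : 'I_d -> 'B(H)) (B : 'I_d -> 'B(K)) :=
  exists f, [/\ star_hom (cstar A) f, set_bij (cstar A) (cstar B) f
              & forall i, f (A i) = B i].

End Maps.

(* The infima are taken in the extended reals, where the infimum of the empty
   set is +oo. *)
Section Distances.
Context {R : realType} {d : nat}.
Local Open Scope ereal_scope.

Definition dHR (H K : hilbertType R)
    (u : 'I_d -> 'B(H)) (v : 'I_d -> 'B(K)) : \bar R :=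
  ereal_inf [set r | exists (L : hilbertType R) (u' v' : 'I_d -> 'B(L)),
    [/\ tuple_equiv u' u, tuple_equiv v' v & r = (tdist u' v')%:E]].

Definition drD_to (H K : hilbertType R)
    (A : 'I_d -> 'B(H)) (B : 'I_d -> 'B(K)) : \bar R :=
  ereal_inf [set r | exists (L : hilbertType R)
      (pi : 'B(H) -> 'B(L)) (Psi : 'B(K) -> 'B(L)),
    [/\ faithful_unital_rep (cstar A) pi, ucp (opsys B) Psi
      & r = (tdist (pi \o A) (Psi \o B))%:E]].

Definition drD (H K : hilbertType R)
    (A : 'I_d -> 'B(H)) (B : 'I_d -> 'B(K)) : \bar R :=
  Order.max (drD_to A B) (drD_to B A).

End Distances.

Definition separable (T : topologicalType) :=
  exists D : set T, countable D /\ dense D.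

(* Main.v *)
(* Let [r] bound both one-sided distances.  By Arveson and Stinespring, the ucp
   map S_v -> B(L) extends and dilates, and a faithful representation of C*(u)
   is a complete order embedding; hence every representation of u on a space X
   is, up to [r], the compression of a representation of v on some Y
   containing X.  As u and v are unitary, the off-diagonal corners have norm at
   most sqrt (2 r), so X almost reduces the representation of v.

   Alternating this step with the symmetric one, starting from the identity
   representations, gives towers of representations U_m of u and V_m of v with
   U_m inside V_(m+1) and V_m inside U_(m+1).  Let U and V be the sums of all
   U_m and all V_m, each repeated countably often.  Then V is U (+) e and U is
   V (+) e' up to [delta = r + sqrt (2 r)], and U (+) U = U, V (+) V = V.
   Therefore U is close to V (+) U, hence to V: an explicit unitary moves U to
   within [4 delta <= 10 sqrt r] of V, when [r <= 1]; otherwise the distance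
   of unitaries is trivially at most 2.  U and V contain the identity
   representations, so they represent C*(u) and C*(v) faithfully.

   Arveson and Stinespring are obtained together.  The ucp map [Phi] is a
   positive functional on the functions [w |-> sum_k Re <T_k w(x_k), w(y_k)>]
   of [w : L -> H]; it extends, by M. Riesz, to all dominated functions of [w],
   and the GNS space of the extension carries the dilation. *)
From HB Require Import structures.
From mathcomp Require Import all_boot all_order all_algebra.
From mathcomp Require Import sesquilinear complex.
From mathcomp Require Import all_classical all_reals all_analysis.
From mathcomp Require Import lra ring.
Require Import Defs.

Set Implicit Arguments.
Unset Strict Implicit.
Unset Printing Implicit Defensive.

Import Order.TTheory GRing.Theory Num.Theory.
Import numFieldNormedType.Exports.

Local Open Scope classical_set_scope.
Local Open Scope ring_scope.
Local Open Scope complex_scope.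

(** All representations in the tower are defined on the whole of ['B(H)] or ['B(K)], since the ucp
    maps are extended when they are dilated; they compose without any care for domains, and C*(u)
    matters only where a given [pi] has to be inverted. The obstacle is that [Psi] acts on the space
    of one particular [pi], whereas the tower needs a dilation above an arbitrary representation
    [sigma]. The map [sigma] after the inverse of [pi] is ucp, but the values of [Psi] are only near
    the range of [pi]; [dilation] corrects this defect in the dilation space of [Psi], before the
    second ucp map is applied. The square root comes from Pythagoras: if the compression of a
    unitary shortens a vector by at most the factor [1 - r], then at most the share
    [1 - (1 - r)^2 <= 2 r] of the squared length is left for the corner. The constant 10 is 4 times
    5/2: two exchanges of summands cost [2 delta] each, and [delta <= (1 + 3/2) sqrt r] when
    [r <= 1]. Direct sums are completions of spaces of finitely supported families, so identities
    between bounded maps are checked there. *)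

Notation cabs z := (complex.Re `|z|).

(** * Complex numbers through their real and imaginary parts *)

Section ComplexAux.
Context {R : realType}.
Implicit Types z w : R[i].

Lemma cabsM z w : cabs (z * w) = cabs z * cabs w.
Proof. by apply: (@complexI R); rewrite rmorphM /= !Re_norm normrM. Qed.

Lemma cabsD z w : cabs (z + w) <= cabs z + cabs w.
Proof. by rewrite -lecR rmorphD /= !Re_norm ler_normD. Qed.

Lemma cabsN z : cabs (- z) = cabs z.
Proof. by rewrite normrN. Qed.

Lemma cabs_conj z : cabs (z^*%R : R[i]) = cabs z.
Proof. by rewrite norm_conjC. Qed.

Lemma cabs_eq0 z : cabs z = 0 -> z = 0.
Proof. by move=> z0; apply/normr0_eq0; rewrite -Re_norm z0. Qed.

Lemma cabs0 : cabs (0 : R[i]) = 0.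
Proof. by rewrite normr0. Qed.

Lemma cabsR (r : R) : cabs (r%:C) = `|r|.
Proof. by rewrite normc_def /= expr0n addr0 sqrtr_sqr. Qed.

Lemma cabs_sqr z : cabs z ^+ 2 = complex.Re z ^+ 2 + complex.Im z ^+ 2.
Proof. by apply: (@complexI R); rewrite rmorphXn /= Re_norm add_Re2_Im2. Qed.

Lemma Re_le_cabs z : `|complex.Re z| <= cabs z.
Proof. by rewrite -lecR Re_norm normc_ge_Re. Qed.

Lemma ReD z w : complex.Re (z + w) = complex.Re z + complex.Re w.
Proof. by case: z => ? ?; case: w. Qed.

Lemma ReN z : complex.Re (- z) = - complex.Re z.
Proof. by case: z. Qed.

Lemma ReB z w : complex.Re (z - w) = complex.Re z - complex.Re w.
Proof. by rewrite ReD ReN. Qed.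

Lemma ImD z w : complex.Im (z + w) = complex.Im z + complex.Im w.
Proof. by case: z => ? ?; case: w. Qed.

Lemma ImN z : complex.Im (- z) = - complex.Im z.
Proof. by case: z. Qed.

Lemma Re_sum I (s : seq I) (P : pred I) (F : I -> R[i]) :
  complex.Re (\sum_(i <- s | P i) F i) = \sum_(i <- s | P i) complex.Re (F i).
Proof. by apply: (big_morph _ ReD). Qed.

Lemma cRe_conj z : complex.Re (z^*%R : R[i]) = complex.Re z.
Proof. by case: z. Qed.

Lemma cIm_conj z : complex.Im (z^*%R : R[i]) = - complex.Im z.
Proof. by case: z. Qed.

Lemma conjCR (r : R) : (r%:C)^*%R = r%:C :> complexF R.
Proof. exact: conjc_real. Qed.

Lemma cReM z w : complex.Re (z * w) =
  complex.Re z * complex.Re w - complex.Im z * complex.Im w.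
Proof. by case: z => ? ?; case: w. Qed.

Lemma cImM z w : complex.Im (z * w) =
  complex.Re z * complex.Im w + complex.Im z * complex.Re w.
Proof. by case: z => ? ?; case: w. Qed.

Lemma Re_mulR (r : R) z : complex.Re (r%:C * z) = r * complex.Re z.
Proof. by rewrite cReM /= mul0r subr0. Qed.

Lemma complex_ext z w :
  complex.Re z = complex.Re w -> complex.Im z = complex.Im w -> z = w.
Proof. by case: z => ? ?; case: w => ? ? /= -> ->. Qed.

Lemma complex_ge0 z : 0 <= z <-> complex.Im z = 0 /\ 0 <= complex.Re z.
Proof.
rewrite lecE /=; split; first by case/andP => /eqP.
by case=> -> ->; rewrite eqxx.
Qed.

(** Reduces imaginary to real parts: an identity between complex-linear expressions follows from its
    real part, taken also at [-i] times the argument. *)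
Lemma Im_Re z : complex.Im z = complex.Re (- 'i%C * z).
Proof. by case: z => a b; rewrite cReM /=; ring. Qed.

End ComplexAux.

(** * Hilbert spaces and bounded operators *)

Section HilbertBasics.
Context {R : realType} {H : hilbertType R}.
Implicit Types x y z : H.

Lemma dotDl x y z : '[x + y, z] = '[x, z] + '[y, z].
Proof. exact: linearDl. Qed.
Lemma dotDr x y z : '[x, y + z] = '[x, y] + '[x, z].
Proof. exact: linearDr. Qed.
Lemma dotNl x y : '[- x, y] = - '[x, y].
Proof. exact: linearNl. Qed.
Lemma dotNr x y : '[x, - y] = - '[x, y].
Proof. exact: linearNr. Qed.
Lemma dotBl x y z : '[x - y, z] = '[x, z] - '[y, z].
Proof. exact: linearBl. Qed.
Lemma dotBr x y z : '[x, y - z] = '[x, y] - '[x, z].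
Proof. exact: linearBr. Qed.
Lemma dot0l x : '[0, x] = 0.
Proof. exact: linear0l. Qed.
Lemma dot0r x : '[x, 0] = 0.
Proof. exact: linear0r. Qed.
Lemma dotZl (a : R[i]) x y : '[a *: x, y] = a * '[x, y].
Proof. exact: linearZl_LR. Qed.
Lemma dotZr (a : R[i]) x y : '[x, a *: y] = (a^*%R : R[i]) * '[x, y].
Proof. exact: linearZr_LR. Qed.
Lemma dotC x y : '[x, y] = ('[y, x]^*%R : R[i]).
Proof. by rewrite (hermC hdot) expr0 mul1r. Qed.
Lemma dot_suml I (s : seq I) (P : pred I) (F : I -> H) y :
  '[\sum_(i <- s | P i) F i, y] = \sum_(i <- s | P i) '[F i, y].
Proof. exact: linear_sumlz. Qed.
Lemma dot_sumr I (s : seq I) (P : pred I) (F : I -> H) y :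
  '[y, \sum_(i <- s | P i) F i] = \sum_(i <- s | P i) '[y, F i].
Proof. exact: linear_sumr. Qed.

Lemma dot_xx x : '[x, x] = (hnorm x ^+ 2)%:C.
Proof. by rewrite rmorphXn /= hnormE hdot_norm. Qed.

(** The underlying real inner product. Estimates are made with it in [R]; imaginary parts are
    recovered through [Im_Re]. *)
Definition rdot x y : R := complex.Re '[x, y].

Lemma rdot_xx x : rdot x x = hnorm x ^+ 2.
Proof. by rewrite /rdot dot_xx. Qed.

Lemma rdotC x y : rdot x y = rdot y x.
Proof. by rewrite /rdot dotC cRe_conj. Qed.

Lemma Im_dotC x y : complex.Im '[x, y] = - complex.Im '[y, x].
Proof. by rewrite dotC cIm_conj. Qed.

Lemma rdotDl x y z : rdot (x + y) z = rdot x z + rdot y z.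
Proof. by rewrite /rdot dotDl ReD. Qed.
Lemma rdotDr x y z : rdot x (y + z) = rdot x y + rdot x z.
Proof. by rewrite /rdot dotDr ReD. Qed.
Lemma rdotNl x y : rdot (- x) y = - rdot x y.
Proof. by rewrite /rdot dotNl ReN. Qed.
Lemma rdotNr x y : rdot x (- y) = - rdot x y.
Proof. by rewrite /rdot dotNr ReN. Qed.

Lemma hnorm0 : hnorm (0 : H) = 0.
Proof. by rewrite /hnorm normr0. Qed.

Lemma hnorm_eq0 x : hnorm x = 0 -> x = 0.
Proof. by move=> x0; apply/normr0_eq0; rewrite -hnormE x0. Qed.

Lemma hnormD x y : hnorm (x + y) <= hnorm x + hnorm y.
Proof. by rewrite -lecR rmorphD /= !hnormE ler_normD. Qed.

Lemma hnormN x : hnorm (- x) = hnorm x.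
Proof. by rewrite /hnorm normrN. Qed.

Lemma hnormB x y : hnorm (x - y) <= hnorm x + hnorm y.
Proof. by rewrite -(hnormN y) hnormD. Qed.

Lemma hnormBC x y : hnorm (x - y) = hnorm (y - x).
Proof. by rewrite -hnormN opprB. Qed.

Lemma hnormZr (r : R) x : hnorm (r%:C *: x) = `|r| * hnorm x.
Proof. by rewrite hnormZ cabsR. Qed.

Lemma hnormD_sqr x y :
  hnorm (x + y) ^+ 2 = hnorm x ^+ 2 + hnorm y ^+ 2 + rdot x y *+ 2.
Proof.
rewrite -!rdot_xx !rdotDl !rdotDr (rdotC y x); ring.
Qed.

Lemma hnormB_sqr x y :
  hnorm (x - y) ^+ 2 = hnorm x ^+ 2 + hnorm y ^+ 2 - rdot x y *+ 2.
Proof. by rewrite hnormD_sqr hnormN rdotNr mulNrn. Qed.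

Lemma parallelogram x y :
  hnorm (x + y) ^+ 2 + hnorm (x - y) ^+ 2 =
  (hnorm x ^+ 2 + hnorm y ^+ 2) *+ 2.
Proof. by rewrite hnormB_sqr hnormD_sqr; ring. Qed.

Lemma rdot_ZRl (r : R) x y : rdot (r%:C *: x) y = r * rdot x y.
Proof. by rewrite /rdot dotZl Re_mulR. Qed.
Lemma rdot_ZRr (r : R) x y : rdot x (r%:C *: y) = r * rdot x y.
Proof. by rewrite rdotC rdot_ZRl rdotC. Qed.

Lemma rdot_le x y : rdot x y <= hnorm x * hnorm y.
Proof.
have [->|x0] := eqVneq x 0; first by rewrite /rdot dot0l hnorm0 mul0r.
have [->|y0] := eqVneq y 0; first by rewrite /rdot dot0r hnorm0 mulr0.
have gt0 (z : H) : z != 0 -> 0 < hnorm z.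
  move=> z0; rewrite lt_neqAle hnorm_ge0 andbT eq_sym.
  by apply: contra z0 => /eqP/hnorm_eq0/eqP.
(* With [a = |x|], [b = |y|] and [c] the real inner product, this square expands to
   [2 a b (a b - c)]. *)
have := sqr_ge0 (hnorm ((hnorm y)%:C *: x - (hnorm x)%:C *: y)).
rewrite hnormB_sqr !hnormZr rdot_ZRl rdot_ZRr !ger0_norm ?hnorm_ge0//.
have := gt0 _ x0; have := gt0 _ y0.
set a := hnorm x; set b := hnorm y; set c := rdot x y => b0 a0 h.
have : 0 <= (a * b) * (a * b - c) by nra.
by rewrite pmulr_rge0 ?mulr_gt0// subr_ge0.
Qed.

(* Rotating [x] by the phase of ['[x, y]] makes the inner product real. *)
Lemma cauchy_schwarz x y : cabs '[x, y] <= hnorm x * hnorm y.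
Proof.
have [->|d0] := eqVneq '[x, y] 0; first by rewrite cabs0 mulr_ge0// hnorm_ge0.
have := rdot_le (('[x, y]^*%R / `|'[x, y]|) *: x) y.
rewrite /rdot dotZl mulrAC -normCKC expr2 mulfK ?normr_eq0//.
rewrite hnormZ normrM norm_conjC normfV normr_id divff ?normr_eq0//.
by rewrite mul1r.
Qed.

Lemma dot_ext x y : (forall z, '[x, z] = '[y, z]) -> x = y.
Proof.
move=> xy; apply/eqP; rewrite -subr_eq0; apply/eqP/hnorm_eq0/eqP.
by rewrite -sqrf_eq0 -rdot_xx /rdot dotBl xy subrr.
Qed.

Lemma hnorm_le_dot x (M : R) : 0 <= M ->
  (forall y, cabs '[x, y] <= M * hnorm y) -> hnorm x <= M.
Proof.
move=> M0 /(_ x); rewrite dot_xx cabsR ger0_norm ?sqr_ge0// expr2.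
have [->|x0] := eqVneq (hnorm x) 0; first by [].
by rewrite ler_pM2r// lt_neqAle eq_sym x0 hnorm_ge0.
Qed.

Lemma hnorm_triangle x y z : hnorm (x - z) <= hnorm (x - y) + hnorm (y - z).
Proof. by have := hnormD (x - y) (y - z); rewrite addrA subrK. Qed.

End HilbertBasics.

Section Polarization.
Context {R : realType} {H : hilbertType R}.

(** The diagonal value at [x + y] gives [b x y + b y x = 0], the one at [x + i y] gives
    [b x y - b y x = 0]. *)
Lemma polarization (b : H -> H -> complexF R) :
  (forall x y z, b (x + y) z = b x z + b y z) ->
  (forall x y z, b x (y + z) = b x y + b x z) ->
  (forall a x y, b (a *: x) y = a * b x y) ->
  (forall a x y, b x (a *: y) = (a^*%R : complexF R) * b x y) ->
  (forall x, b x x = 0) -> forall x y, b x y = 0.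
Proof.
move=> bDl bDr bZl bZr b0 x y.
have h1 : b x y + b y x = 0.
  by have := b0 (x + y); rewrite bDl !bDr !b0 add0r addr0.
have h2 : b x y - b y x = 0.
  have [w [wx wy]] : exists w, b x w = - 'i%C * b x y /\ b w x = 'i%C * b y x.
    exists ('i%C *: y); rewrite bZr bZl; split=> //; congr (_ * _).
    by apply/eqP; rewrite eq_complex /= oppr0 !eqxx.
  have := b0 (x + w).
  rewrite bDl !bDr wx wy !b0 addr0 add0r => e.
  have : 'i%C * (b y x - b x y) = 0 by rewrite mulrBr addrC -mulNr.
  move/eqP; rewrite mulf_eq0 => /orP[|/eqP e2].
    by rewrite eq_complex /= oner_eq0 andbF.
  by rewrite -opprB e2 oppr0.
have : b x y *+ 2 = 0 by rewrite -[RHS](addr0 0) -{1}h1 -h2; ring.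
by move=> /eqP; rewrite mulrn_eq0 => /eqP.
Qed.

End Polarization.

Lemma invn_small {R : realType} (e : R) : 0 < e ->
  exists N, forall n, (N <= n)%N -> n.+1%:R^-1 <= e.
Proof.
move=> e0; exists (Num.bound e^-1) => n Nn.
rewrite -[leRHS]invrK lef_pV2 ?posrE ?invr_gt0 ?ltr0n//.
apply: (le_trans (ltW (archi_boundP _))); first by rewrite invr_ge0 ltW.
by rewrite ler_nat leqW.
Qed.

Lemma ler_of_sqr {R : realDomainType} (a b : R) :
  0 <= b -> a ^+ 2 <= b ^+ 2 -> a <= b.
Proof. by move=> b0 ab; have [//|ba] := leP a b; nra. Qed.

(** The slack may carry a fixed factor [c], so limit arguments collect their error terms without
    normalizing epsilon first. *)
Lemma le_eps {R : realType} (a b c : R) : 0 <= c ->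
  (forall e, 0 < e -> a <= b + e * c) -> a <= b.
Proof.
move=> c0 h; have [//|ba] := leP a b.
have c1 : 0 < c + 1 by lra.
have := h ((a - b) / (c + 1) / 2) _; rewrite !divr_gt0 ?subr_gt0//= => /(_ isT).
set d := _ / (c + 1); have dE : d * (c + 1) = a - b by rewrite divfK// gt_eqF.
have d0 : 0 < d by rewrite divr_gt0 ?subr_gt0.
by nra.
Qed.

Section Sequences.
Context {R : realType} {H : hilbertType R}.

Definition htends (x : nat -> H) (l : H) :=
  forall e, 0 < e -> exists N, forall n, (N <= n)%N -> hnorm (x n - l) <= e.

Lemma hcauchy_cvg (x : nat -> H) :
  (forall e, 0 < e -> exists N, forall m n, (N <= m)%N -> (N <= n)%N ->
    hnorm (x m - x n) <= e) -> exists l, htends x l.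
Proof.
move=> xC; have : cvg (x @ \oo).
  apply: cauchy_cvg; apply/cauchy_ballP => e e0.
  have e0' : 0 < complex.Re e by rewrite -ltcR RRe_real ?gtr0_real.
  have [N xN] := xC _ (divr_gt0 e0' (ltr0n _ 2)).
  exists ([set x n | n in [set n | (N <= n)%N]], [set x n | n in [set n | (N <= n)%N]]).
    by split => /=; exists N => // n /= Nn; exists n.
  move=> [_ _] /= [[m Nm <-] [n Nn <-]].
  rewrite -ball_normE /= -hnormE -[ltRHS]RRe_real ?gtr0_real// ltcR.
  by rewrite (le_lt_trans (xN _ _ Nm Nn))// ltr_pdivrMr// mulr_natr mulr2n; lra.
move/cvgrPdist_le => h; exists (lim (x @ \oo)) => e e0.
have [|N _ hN] := h e%:C; first by rewrite ltcR.
by exists N => n Nn; have := hN n Nn; rewrite /= -hnormE lecR hnormBC.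
Qed.

End Sequences.

(** * Bounded linear maps between two spaces, Riesz representation and adjoints *)

Section Blin.
Context {R : realType}.

(** [bop] covers endomorphisms only; a map between two spaces is a plain function with this
    predicate and an explicit bound. *)
Definition blin (H K : hilbertType R) (T : H -> K) (M : R) :=
  (forall (a : R[i]) x y, T (a *: x + y) = a *: T x + T y) /\
  (forall x, hnorm (T x) <= M * hnorm x).

Section OneMap.
Context {H K : hilbertType R} {T : H -> K} {M : R}.
Hypothesis bT : blin T M.

Lemma blinD x y : T (x + y) = T x + T y.
Proof. by have := bT.1 1 x y; rewrite !scale1r. Qed.
Lemma blin0 : T 0 = 0.
Proof. by apply: (@addrI _ (T 0)); rewrite -blinD !addr0. Qed.
Lemma blinZ (a : R[i]) x : T (a *: x) = a *: T x.
Proof. by have := bT.1 a x 0; rewrite !addr0 blin0 addr0. Qed.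
Lemma blinN x : T (- x) = - T x.
Proof. by rewrite -scaleN1r blinZ scaleN1r. Qed.
Lemma blinB x y : T (x - y) = T x - T y.
Proof. by rewrite blinD blinN. Qed.
Lemma blin_sum I (s : seq I) (P : pred I) (F : I -> H) :
  T (\sum_(i <- s | P i) F i) = \sum_(i <- s | P i) T (F i).
Proof. by apply: (big_morph T blinD blin0). Qed.
End OneMap.

Lemma blin_comp (H K L : hilbertType R) (T : H -> K) (S : K -> L) M N :
  0 <= N -> blin T M -> blin S N -> blin (S \o T) (N * M).
Proof.
move=> N0 bT bS; split=> [a x y|x] /=; first by rewrite bT.1 bS.1.
by rewrite (le_trans (bS.2 _))// -mulrA ler_wpM2l// bT.2.
Qed.

Lemma blin_id (H : hilbertType R) : blin (@id H) 1.
Proof. by split=> // x; rewrite mul1r. Qed.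

(** A valid bound can be negative when [H] is the zero space. *)
Lemma blin_ge0 (H K : hilbertType R) (T : H -> K) M :
  blin T M -> blin T `|M|.
Proof.
case=> lT bT; split=> // x; rewrite (le_trans (bT x))// ler_wpM2r ?hnorm_ge0//.
exact: ler_norm.
Qed.

End Blin.

Section Riesz.
Context {R : realType} {H : hilbertType R}.
Variables (f : H -> R[i]) (M : R).
Hypothesis fl : forall (a : complexF R) x y, f (a *: x + y) = a * f x + f y.
Hypothesis fM : forall x, cabs (f x) <= M * hnorm x.

Let fD x y : f (x + y) = f x + f y.
Proof. by have := fl 1 x y; rewrite scale1r mul1r. Qed.
Let f0 : f 0 = 0.
Proof. by apply: (@addrI _ (f 0)); rewrite -fD !addr0. Qed.
Let fZ (a : complexF R) x : f (a *: x) = a * f x.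
Proof. by have := fl a x 0; rewrite !addr0 f0 addr0. Qed.

(* An almost minimizer [x] of [|x|^2 - 2 Re (f x)] almost represents [f]:
   test minimality along [x + t z] with [t] the optimal step. *)
Let riesz_approx e : 0 < e ->
  exists x, forall z, `|rdot x z - complex.Re (f z)| <= e * hnorm z.
Proof.
move=> e0; pose J x := hnorm x ^+ 2 - 2 * complex.Re (f x).
pose A := [set J x | x in setT].
have Jge x : - M ^+ 2 <= J x.
  have := le_trans (Re_le_cabs (f x)) (fM x).
  by rewrite ler_norml /J => /andP[_]; have := sqr_ge0 (hnorm x - M); nra.
have Ai : has_inf A.
  by split; [exists (J 0), 0|exists (- M ^+ 2) => _ [x _ <-]].
have [_ [x _ <-] Jx] : exists2 r, A r & r < inf A + e ^+ 2.
  by apply: inf_adherent Ai; rewrite exprn_gt0.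
exists x => z; have [/hnorm_eq0 ->|z0] := eqVneq (hnorm z) 0.
  by rewrite /rdot dot0r f0 subrr normr0 hnorm0 mulr0.
have z_gt0 : 0 < hnorm z by rewrite lt_neqAle eq_sym z0 hnorm_ge0.
set d := rdot x z - _; pose t := - d / hnorm z ^+ 2.
have : inf A <= J (x + t%:C *: z) by apply: ge_inf; [exact: Ai.2|exists (x + t%:C *: z)].
rewrite /J hnormD_sqr hnormZr rdot_ZRr fD fZ ReD Re_mulR exprMn real_normK ?num_real//.
have -> : t * rdot x z = t * d + t * complex.Re (f z) by rewrite /d; ring.
move: Jx; rewrite /J; move: (hnorm x ^+ 2) (complex.Re (f x)) (complex.Re (f z)) => a b c.
move=> h1 h2.
have tE : t * hnorm z ^+ 2 = - d by rewrite /t divfK// expf_neq0.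
have h3 : d ^+ 2 <= e ^+ 2 * hnorm z ^+ 2.
  have : - (t * d) <= e ^+ 2 by nra.
  have -> : - (t * d) = d ^+ 2 / hnorm z ^+ 2 by rewrite /t; field.
  by rewrite ler_pdivrMr// exprn_gt0.
apply: ler_of_sqr; first by rewrite mulr_ge0// ltW.
by rewrite real_normK ?num_real// exprMn.
Qed.

(** The approximate representers with errors [1/(n+1)] form a Cauchy sequence. Its limit represents
    the real part of [f], and complex linearity gives the imaginary part. *)
Lemma riesz : exists y, forall x, f x = '[x, y].
Proof.
have pn n : 0 < n.+1%:R^-1 :> R by rewrite invr_gt0 ltr0n.
pose x n := projT1 (cid (riesz_approx (pn n))).
have xP n z : `|rdot (x n) z - complex.Re (f z)| <= n.+1%:R^-1 * hnorm z.
  by rewrite /x; case: cid.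
have xC m n : hnorm (x m - x n) <= m.+1%:R^-1 + n.+1%:R^-1.
  set z := x m - x n.
  have [->|z0] := eqVneq (hnorm z) 0; first by rewrite addr_ge0// ltW.
  have z_gt0 : 0 < hnorm z by rewrite lt_neqAle eq_sym z0 hnorm_ge0.
  (* Both approximants nearly agree with [f] at their own difference [z], where their values differ
     by [|z|^2]. *)
  rewrite -(ler_pM2r z_gt0) -expr2 -rdot_xx {1}/z rdotDl rdotNl.
  have := xP m z; have := xP n z; rewrite !ler_norml.
  move: (m.+1%:R^-1) (n.+1%:R^-1) => a b /andP[? ?] /andP[? ?].
  by rewrite mulrDl; lra.
have [y xy] : exists y, htends x y.
  apply: hcauchy_cvg => e e0.
  have [N hN] := invn_small (divr_gt0 e0 (ltr0n _ 2)).
  exists N => m n /hN hm /hN hn; apply: le_trans (xC m n) _.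
  by have := lerD hm hn; rewrite -splitr.
have yE z : rdot y z = complex.Re (f z).
  apply/eqP; rewrite -subr_eq0 -normr_le0.
  apply: (@le_eps _ _ _ (2 * hnorm z)); first by rewrite mulr_ge0// hnorm_ge0.
  move=> e e0; rewrite add0r.
  have [N hN] := xy _ e0; have [N' hN'] := invn_small e0.
  have := hN (maxn N N') (leq_maxl _ _); have := hN' _ (leq_maxr N N').
  move: (maxn N N') => n n1 n2; have := xP n z.
  have := rdot_le (x n - y) z; have := rdot_le (- (x n - y)) z.
  rewrite rdotNl hnormN !rdotDl !rdotNl.
  have := hnorm_ge0 z => z0 c1 c2 c3.
  have c4 : n.+1%:R^-1 * hnorm z <= e * hnorm z by rewrite ler_wpM2r.
  have c5 : hnorm (x n - y) * hnorm z <= e * hnorm z by rewrite ler_wpM2r.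
  move: c3; rewrite !ler_norml => /andP[c6 c7].
  by move: (n.+1%:R^-1 * hnorm z) c4 c6 c7 => t *; apply/andP; split; lra.
exists y => z; apply: complex_ext; first by rewrite -yE rdotC.
by rewrite [LHS]Im_Re [RHS]Im_Re -dotZl -fZ -yE rdotC.
Qed.
End Riesz.

Section Adjoint.
Context {R : realType} {H K : hilbertType R}.

(** [adj] is confined to one space; this is the adjoint between two. For bounded linear [T], Riesz
    representation excludes the default 0. *)
Definition hadj (T : H -> K) (y : K) : H :=
  xget 0 [set z | forall x, '[T x, y] = '[x, z]].

Variables (T : H -> K) (M : R).
Hypothesis bT : blin T M.

Lemma hadjP x y : '[T x, y] = '[x, hadj T y].
Proof.
rewrite /hadj; case: xgetP => [z -> //|none].
have [z zP] : exists z, forall x, '[T x, y] = '[x, z].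
  apply: (@riesz _ _ (fun x => '[T x, y]) (M * hnorm y)).
    by move=> a u v; rewrite bT.1 dotDl dotZl.
  move=> u; apply: le_trans (cauchy_schwarz _ _) _.
  by rewrite mulrAC ler_wpM2r ?hnorm_ge0// bT.2.
by have := none z zP.
Qed.

Lemma hadjC x y : '[hadj T y, x] = '[y, T x].
Proof. by rewrite dotC -hadjP -dotC. Qed.

Lemma hadj_uniq S : (forall x y, '[T x, y] = '[x, S y]) -> hadj T =1 S.
Proof. by move=> TS y; apply: dot_ext => x; rewrite hadjC dotC TS -dotC. Qed.

Lemma blin_hadj : 0 <= M -> blin (hadj T) M.
Proof.
move=> M0; split=> [a x y|y].
  by apply: dot_ext => z; rewrite hadjC !dotDl !dotZl !hadjC.
apply: hnorm_le_dot => [|x]; first by rewrite mulr_ge0// hnorm_ge0.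
rewrite hadjC; apply: le_trans (cauchy_schwarz _ _) _.
by rewrite (mulrC M) -mulrA ler_wpM2l ?hnorm_ge0// bT.2.
Qed.

End Adjoint.

Section Bop.
Context {R : realType}.

Lemma bop_blin (H : hilbertType R) (T : 'B(H)) : blin T (opnorm T).
Proof.
split=> [a x y|x]; first by rewrite linearP.
have [->|x0] := eqVneq x 0; first by rewrite linear0 hnorm0 mulr0.
have n0 : 0 < hnorm x.
  by rewrite lt_neqAle hnorm_ge0 andbT eq_sym; apply: contra x0 => /eqP/hnorm_eq0/eqP.
have := @opnorm_ub _ _ T ((hnorm x)^-1%:C *: x).
rewrite linearZ /= hnormZr -hnormE hnormZr ger0_norm ?invr_ge0 ?hnorm_ge0//.
by rewrite mulVf ?gt_eqF// lexx => /(_ isT); rewrite ler_pdivrMl// mulrC.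
Qed.

Lemma blin_in_bounded (H : hilbertType R) (T : H -> H) M :
  blin T M -> T \in @bounded_op R H.
Proof.
move=> bT; apply/asboolP; split; first exact: bT.1.
have M'0 : 0 < `|M| + 1 by rewrite ltr_wpDl.
move=> x; apply/cvgrPdist_le => e e0.
have e0' : 0 < complex.Re e by rewrite -ltcR RRe_real ?gtr0_real.
have d0 : 0 < (complex.Re e / (`|M| + 1))%:C by rewrite ltcR divr_gt0.
have /cvgrPdist_le/(_ _ d0) := @cvg_id _ (nbhs x).
apply: filterS => y /=; rewrite -!hnormE lecR => xy.
rewrite -[leRHS]RRe_real ?gtr0_real// lecR -(blinB bT).
rewrite (le_trans (bT.2 _))//.
have M1 : M <= `|M| + 1 by rewrite (le_trans (ler_norm _))// lerDl.
rewrite (le_trans (ler_wpM2r (hnorm_ge0 _) M1))//.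
by rewrite -ler_pdivlMl// mulrC.
Qed.

Definition mkbop (H : hilbertType R) (T : H -> H) M (bT : blin T M) : 'B(H) :=
  Bop (blin_in_bounded bT).

Lemma opnorm_le_blin (H : hilbertType R) (T : 'B(H)) M :
  0 <= M -> (forall x, hnorm (T x) <= M * hnorm x) -> opnorm T <= M.
Proof.
move=> M0 TM; apply: opnorm_le => x x1; rewrite (le_trans (TM x))//.
by rewrite ler_piMr// -lecR hnormE.
Qed.

Section BopTheory.
Context {H : hilbertType R}.
Implicit Types S T : 'B(H).

Lemma bop_le T x : hnorm (T x) <= opnorm T * hnorm x.
Proof. exact: (bop_blin T).2. Qed.

Lemma bopM S T x : (S * T) x = S (T x). Proof. by []. Qed.
Lemma bop1 x : (1 : 'B(H)) x = x. Proof. by []. Qed.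
Lemma bop0 x : (0 : 'B(H)) x = 0. Proof. by []. Qed.
Lemma bopN T x : (- T) x = - T x. Proof. by []. Qed.
Lemma bopB S T x : (S - T) x = S x - T x. Proof. by []. Qed.
Lemma bop_sum I (s : seq I) (P : pred I) (F : I -> 'B(H)) x :
  (\sum_(i <- s | P i) F i) x = \sum_(i <- s | P i) F i x.
Proof. by apply: (big_morph (fun T : 'B(H) => T x)). Qed.

Lemma adj_of_adjoint T S : is_adjoint T S -> adj T = S.
Proof.
move=> TS; rewrite /adj; case: xgetP => [S' -> TS'|none].
  by apply: bop_ext => y; apply: dot_ext => x; rewrite dotC -TS' TS -dotC.
by have := none S TS.
Qed.

Lemma adjP T x y : '[T x, y] = '[x, adj T y].
Proof.
suff [S TS] : exists S, is_adjoint T S by rewrite (adj_of_adjoint TS).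
have bT := bop_blin T; exists (mkbop (blin_hadj bT (opnorm_ge0 T))) => u v.
exact: hadjP bT u v.
Qed.

Lemma adjPl T x y : '[adj T x, y] = '[x, T y].
Proof. by rewrite dotC -adjP -dotC. Qed.

Lemma adjK T : adj (adj T) = T.
Proof. by apply: adj_of_adjoint => x y; rewrite adjPl. Qed.
Lemma adjM S T : adj (S * T) = adj T * adj S.
Proof. by apply: adj_of_adjoint => x y; rewrite !bopM !adjP. Qed.
Lemma adj1 : adj (1 : 'B(H)) = 1.
Proof. by apply: adj_of_adjoint => x y. Qed.
Lemma adjD S T : adj (S + T) = adj S + adj T.
Proof. by apply: adj_of_adjoint => x y; rewrite !bopD dotDl dotDr !adjP. Qed.
Lemma adjZ (a : R[i]) T : adj (a *: T) = (a^*%R : R[i]) *: adj T.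
Proof.
by apply: adj_of_adjoint => x y; rewrite !bopZ dotZl dotZr conjCK adjP.
Qed.
Lemma adjN T : adj (- T) = - adj T.
Proof. by apply: adj_of_adjoint => x y; rewrite !bopN dotNl dotNr adjP. Qed.
Lemma adjB S T : adj (S - T) = adj S - adj T.
Proof. by rewrite adjD adjN. Qed.
Lemma adj0 : adj (0 : 'B(H)) = 0.
Proof. by apply: adj_of_adjoint => x y; rewrite !bop0 dot0l dot0r. Qed.
Lemma adj_sum I (s : seq I) (P : pred I) (F : I -> 'B(H)) :
  adj (\sum_(i <- s | P i) F i) = \sum_(i <- s | P i) adj (F i).
Proof. exact: (big_morph _ adjD adj0). Qed.

Lemma opnormB_C S T : opnorm (S - T) = opnorm (T - S).
Proof. by apply: (@complexI R); rewrite -!bop_normE distrC. Qed.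
Lemma opnormD S T : opnorm (S + T) <= opnorm S + opnorm T.
Proof. by rewrite -lecR rmorphD /= -!bop_normE ler_normD. Qed.
Lemma opnormZ (a : R[i]) T : opnorm (a *: T) = cabs a * opnorm T.
Proof. by apply: (@complexI R); rewrite rmorphM /= Re_norm -!bop_normE normrZ. Qed.
Lemma opnorm_eq0 T : opnorm T = 0 -> T = 0.
Proof. by move=> T0; apply/normr0_eq0; rewrite bop_normE T0. Qed.
Lemma opnorm0 : opnorm (0 : 'B(H)) = 0.
Proof. by apply: (@complexI R); rewrite -bop_normE normr0. Qed.
Lemma opnorm_adj T : opnorm (adj T) <= opnorm T.
Proof.
apply: opnorm_le_blin => [|y]; first exact: opnorm_ge0.
apply: hnorm_le_dot => [|x]; first by rewrite mulr_ge0 ?hnorm_ge0 ?opnorm_ge0.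
rewrite adjPl; apply: le_trans (cauchy_schwarz _ _) _.
by rewrite (mulrC (opnorm T)) -mulrA ler_wpM2l ?hnorm_ge0// bop_le.
Qed.
Lemma opnormM S T : opnorm (S * T) <= opnorm S * opnorm T.
Proof.
apply: opnorm_le_blin => [|x]; first by rewrite mulr_ge0 ?opnorm_ge0.
rewrite bopM (le_trans (bop_le _ _))// -mulrA ler_wpM2l ?opnorm_ge0//.
exact: bop_le.
Qed.

(** The difference of the two forms is sesquilinear and vanishes on the diagonal, so complex
    polarization applies. *)
Lemma bop_dot_ext S T : (forall x, '[S x, x] = '[T x, x]) -> S = T.
Proof.
move=> ST; apply: bop_ext => x; apply: dot_ext => y.
apply/eqP; rewrite -subr_eq0 -dotBl; apply/eqP; move: x y.
apply: (@polarization _ _ (fun x y => '[S x - T x, y])).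
- move=> x y z; rewrite (blinD (bop_blin S)) (blinD (bop_blin T)) opprD.
  rewrite addrACA. exact: dotDl.
- by move=> x y z; rewrite dotDr.
- by move=> a x y; rewrite (blinZ (bop_blin S)) (blinZ (bop_blin T)) -scalerBr dotZl.
- by move=> a x y; rewrite dotZr.
- by move=> x; rewrite dotBl ST subrr.
Qed.

End BopTheory.

End Bop.

Section BopLimits.
Context {R : realType} {H : hilbertType R}.
Implicit Types (S T Y : 'B(H)) (M : set 'B(H)).

Definition op_tends (y : nat -> 'B(H)) Y :=
  forall e, 0 < e -> exists N, forall n, (N <= n)%N -> opnorm (y n - Y) <= e.

(** The limit is taken pointwise. The Cauchy estimate survives with the relative error
    [e * hnorm x], which yields linearity, boundedness and convergence in norm at once. *)
Lemma bop_cauchy_cvg (y : nat -> 'B(H)) :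
  (forall e, 0 < e -> exists N, forall m n, (N <= m)%N -> (N <= n)%N ->
    opnorm (y m - y n) <= e) -> exists Y, op_tends y Y.
Proof.
move=> yC.
have xC x : exists l, htends (fun n => y n x) l.
  apply: hcauchy_cvg => e e0.
  have d0 : 0 < hnorm x + 1 by rewrite ltr_wpDl// hnorm_ge0.
  have [N hN] := yC _ (divr_gt0 e0 d0); exists N => m n Nm Nn.
  rewrite -bopB (le_trans (bop_le _ _))//
    (le_trans (ler_wpM2r (hnorm_ge0 _) (hN _ _ Nm Nn)))//.
  by rewrite mulrAC ler_pdivrMr// ler_wpM2l ?lerDl// ltW.
pose f x := projT1 (cid (xC x)).
have fP x : htends (fun n => y n x) (f x) by rewrite /f; case: cid.
have fclose e : 0 < e -> exists N, forall n, (N <= n)%N ->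
    forall x, hnorm (y n x - f x) <= e * hnorm x.
  move=> e0; have [N hN] := yC _ e0; exists N => n Nn x.
  apply: (@le_eps _ _ _ 1) => // d d0; rewrite mulr1.
  have [N' hN'] := fP x _ d0.
  have := hN' _ (leq_maxr N N'); have := hN _ _ Nn (leq_maxl N N').
  move: (maxn N N') => m h1 h2.
  apply: le_trans (hnorm_triangle _ (y m x) _) _; apply: lerD => //.
  rewrite -bopB (le_trans (bop_le _ _))// ler_wpM2r ?hnorm_ge0//.
have [N0 hN0] := fclose 1 ltr01.
have bf : blin f (1 + opnorm (y N0)).
  split=> [a u v|x].
    apply/eqP; rewrite -subr_eq0; apply/eqP/hnorm_eq0/eqP.
    rewrite eq_le hnorm_ge0 andbT.
    apply: (@le_eps _ _ _ (hnorm (a *: u + v) + (cabs a * hnorm u + hnorm v))).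
      by rewrite !addr_ge0 ?mulr_ge0 ?hnorm_ge0 ?Re_norm_ge0.
    move=> e e0; rewrite add0r; have [N hN] := fclose e e0.
    apply: le_trans (hnorm_triangle _ (y N (a *: u + v)) _) _.
    have -> : y N (a *: u + v) - (a *: f u + f v) =
        a *: (y N u - f u) + (y N v - f v).
      by rewrite (bop_blin (y N)).1 scalerBr opprD addrACA.
    rewrite mulrDr; apply: lerD; first by rewrite hnormBC hN.
    rewrite mulrDr; apply: le_trans (hnormD _ _) _; apply: lerD; last exact: hN.
    by rewrite hnormZ mulrCA ler_wpM2l ?Re_norm_ge0// hN.
  have := hN0 N0 (leqnn _) x; have := bop_le (y N0) x; rewrite mul1r mulrDl mul1r.
  have := hnorm_triangle (f x) (y N0 x) 0; rewrite !subr0 (hnormBC (f x)); lra.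
exists (mkbop bf) => e e0; have [N hN] := fclose e e0; exists N => n Nn.
by apply: opnorm_le_blin; [exact: ltW|move=> x; exact: hN].
Qed.

Lemma closed_seqP M : closed M <->
  forall X, (forall e, 0 < e -> exists2 T, M T & opnorm (T - X) <= e) -> M X.
Proof.
split=> [cM X MX|h].
  apply: cM; move=> B /nbhs_ballP[e /= e0 eB].
  have e0' : 0 < complex.Re e by rewrite -ltcR RRe_real ?gtr0_real.
  have [|T MT TX] := MX (complex.Re e / 2); first by rewrite divr_gt0.
  exists T; split=> //; apply: eB; rewrite -ball_normE /= distrC bop_normE.
  rewrite -[ltRHS]RRe_real ?gtr0_real// ltcR (le_lt_trans TX)//.
  by rewrite ltr_pdivrMr// mulr_natr mulr2n; lra.
move=> X cX; apply: h => e e0.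
have [|T [MT]] := cX (ball X e%:C).
  by apply: nbhsx_ballx; rewrite ltcR.
by rewrite -ball_normE /= distrC bop_normE ltcR => /ltW; exists T.
Qed.

Lemma op_tends_closed M (y : nat -> 'B(H)) Y :
  closed M -> (forall n, M (y n)) -> op_tends y Y -> M Y.
Proof.
move=> /closed_seqP cM My yY; apply: cM => e e0.
by have [N /(_ N (leqnn _))] := yY e e0; exists (y N).
Qed.

Lemma op_tends_eq S T : (forall e, 0 < e -> opnorm (S - T) <= e) -> S = T.
Proof.
move=> h; apply/eqP; rewrite -subr_eq0; apply/eqP/opnorm_eq0/eqP.
rewrite eq_le opnorm_ge0 andbT; apply: (@le_eps _ _ _ 1) => // e e0.
by rewrite add0r mulr1 h.
Qed.

Lemma opnorm_triangle S T Y : opnorm (S - Y) <= opnorm (S - T) + opnorm (T - Y).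
Proof. by have := opnormD (S - T) (T - Y); rewrite addrA subrK. Qed.

End BopLimits.

(** * Square roots and faithful representations *)

Section SquareRoot.
Context {R : realType}.

(* The iteration for [1 - sqrt (1 - x)] at [x = 1] majorizes the operator
   iteration below. *)
Fixpoint sqrt_maj (n : nat) : R :=
  if n is m.+1 then (1 + sqrt_maj m ^+ 2) / 2 else 0.

Lemma sqrt_maj_bounds n : 0 <= sqrt_maj n <= 1.
Proof.
by elim: n => [|n /andP[? ?]] /=; [rewrite lexx ler01|apply/andP; split; nra].
Qed.

Lemma sqrt_maj_incr n : sqrt_maj n <= sqrt_maj n.+1.
Proof.
elim: n => [|n IH]; first by have /andP[] := sqrt_maj_bounds 1.
have /andP[? ?] := sqrt_maj_bounds n; have /andP[? ?] := sqrt_maj_bounds n.+1.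
by rewrite [leRHS]/= [leLHS]/=; rewrite -/(sqrt_maj n.+1) in IH *; nra.
Qed.

Lemma sqrt_maj_cauchy e : 0 < e -> exists N, forall m n,
  (N <= m)%N -> (m <= n)%N -> sqrt_maj n - sqrt_maj m <= e.
Proof.
move=> e0; pose A := [set sqrt_maj n | n in setT].
have As : has_sup A.
  split; first by exists 0, 0%N.
  by exists 1 => _ [n _ <-]; have /andP[] := sqrt_maj_bounds n.
have [_ [N _ <-] hN] := sup_adherent e0 As.
have mono : {homo sqrt_maj : m n / (m <= n)%N >-> m <= n}.
  by apply: homo_leq => //; [exact: le_trans|exact: sqrt_maj_incr].
exists N => m n /mono h1 mn.
have : sqrt_maj n <= sup A by apply: ub_le_sup; [exact: As.2|exists n].
by lra.
Qed.

Context {H : hilbertType R}.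
Implicit Types (S T Y a : 'B(H)) (M : set 'B(H)).

Definition bpos T := forall x, 0 <= '[T x, x].

Lemma bpos_adj T : bpos T -> adj T = T.
Proof.
move=> T0; apply: bop_dot_ext => x; rewrite adjPl.
have /complex_ge0[i0 _] := T0 x.
by apply: complex_ext; [exact: rdotC|rewrite Im_dotC i0 oppr0].
Qed.

Lemma bpos_rdot T : adj T = T -> (forall x, 0 <= rdot (T x) x) -> bpos T.
Proof.
move=> aT T0 x; apply/complex_ge0; split; last exact: T0.
by have := Im_dotC (T x) x; rewrite -{2}aT -adjP => e; lra.
Qed.

Lemma rdot_adj T x y : adj T = T -> rdot (T x) y = rdot x (T y).
Proof. by move=> aT; rewrite /rdot adjP aT. Qed.

(** Positivity of [T] at the vector [x - T x] reads [<T x, x> - 2 |T x|^2 + <T T x, T x> >= 0]; the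
    outer terms are at most [|x|^2] and [|T x|^2]. *)
Lemma contraction_of_pos T : bpos T ->
  (forall x, rdot (T x) x <= hnorm x ^+ 2) -> opnorm T <= 1.
Proof.
move=> T0 T1; apply: opnorm_le_blin => // x; rewrite mul1r.
have aT := bpos_adj T0; apply: ler_of_sqr; first exact: hnorm_ge0.
have /complex_ge0[_] := T0 (x - T x); rewrite -/(rdot _ _).
have := T1 x; have := T1 (T x); rewrite linearB /= !rdotDl !rdotDr !rdotNl !rdotNr.
rewrite (rdot_adj (T x) x aT) rdot_xx => h1 h2.
by rewrite opprK; have := rdot_xx (T x); lra.
Qed.

Lemma cstar_adj_scale M (r : R) T : unital_cstar_subalgebra M -> M T -> M (r%:C *: T).
Proof.
case=> M1 Ml _ _ _ MT; rewrite -[_ *: T]addr0.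
have M0 : M 0 by have := Ml (-1) 1 1 M1 M1; rewrite scaleN1r addNr.
exact: Ml.
Qed.

Section Sqrt.
Variables (M : set 'B(H)) (a : 'B(H)).
Hypotheses (uM : unital_cstar_subalgebra M) (Ma : M a) (a0 : bpos a).
Hypothesis a1 : forall x, rdot (a x) x <= hnorm x ^+ 2.

Let x := 1 - a.
Let half := (2^-1 : R)%:C.

(** A fixed point satisfies [Y = (1 - a + Y Y) / 2], that is, [(1 - Y) (1 - Y) = a]. *)
Fixpoint sqrt_iter (n : nat) : 'B(H) :=
  if n is m.+1 then half *: (x + sqrt_iter m * sqrt_iter m) else 0.

Let half_ge0 : cabs half = 2^-1.
Proof. by rewrite cabsR ger0_norm. Qed.

Let x1 : opnorm x <= 1.
Proof.
have ax : adj x = x by rewrite adjB adj1 (bpos_adj a0).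
apply: contraction_of_pos => [|z].
  apply: bpos_rdot => // z.
  by rewrite bopB rdotDl rdotNl rdot_xx subr_ge0 a1.
rewrite bopB rdotDl rdotNl rdot_xx gerBl.
by have /complex_ge0[] := a0 z.
Qed.

Let iter_le n : opnorm (sqrt_iter n) <= sqrt_maj n.
Proof.
elim: n => [|n IH] /=; first by rewrite opnorm0.
rewrite opnormZ half_ge0 mulrC ler_pM2r ?invr_gt0//.
apply: le_trans (opnormD _ _) _; apply: lerD x1 _.
apply: le_trans (opnormM _ _) _; rewrite expr2.
by rewrite ler_pM ?opnorm_ge0.
Qed.

Let iter_diff n : opnorm (sqrt_iter n.+1 - sqrt_iter n) <= sqrt_maj n.+1 - sqrt_maj n.
Proof.
elim: n => [|n IH]; first by rewrite /= !subr0; exact: (iter_le 1).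
(* Difference of squares without commutativity. The majorant satisfies the same identity, so the
   bound propagates factor by factor. *)
have -> : sqrt_iter n.+2 - sqrt_iter n.+1 =
    half *: ((sqrt_iter n.+1 - sqrt_iter n) * sqrt_iter n.+1 +
             sqrt_iter n * (sqrt_iter n.+1 - sqrt_iter n)).
  rewrite mulrBl mulrBr addrA subrK.
  rewrite [sqrt_iter n.+2]/= -/(sqrt_iter n.+1) [X in _ - X = _]/= -scalerBr.
  by rewrite opprD addrACA subrr add0r.
have -> : sqrt_maj n.+2 - sqrt_maj n.+1 =
    2^-1 * ((sqrt_maj n.+1 - sqrt_maj n) * sqrt_maj n.+1 +
            sqrt_maj n * (sqrt_maj n.+1 - sqrt_maj n)).
  rewrite [sqrt_maj n.+2]/= -/(sqrt_maj n.+1).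
  have : sqrt_maj n.+1 = (1 + sqrt_maj n ^+ 2) / 2 by [].
  by move: (sqrt_maj n.+1) (sqrt_maj n) => u v ->; field.
rewrite opnormZ half_ge0 ler_pM2l ?invr_gt0//.
apply: le_trans (opnormD _ _) _; apply: lerD; apply: le_trans (opnormM _ _) _.
  by rewrite ler_pM ?opnorm_ge0.
by rewrite ler_pM ?opnorm_ge0.
Qed.

Let iter_dist m n : (m <= n)%N ->
  opnorm (sqrt_iter n - sqrt_iter m) <= sqrt_maj n - sqrt_maj m.
Proof.
move=> /subnK <-; elim: (n - m)%N => [|k IH]; first by rewrite !subrr opnorm0.
rewrite addSn; apply: le_trans (opnorm_triangle _ (sqrt_iter (k + m)) _) _.
by have := iter_diff (k + m); lra.
Qed.

Let iter_cvg : exists Y, op_tends sqrt_iter Y.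
Proof.
apply: bop_cauchy_cvg => e e0; have [N hN] := sqrt_maj_cauchy e0.
exists N => m n Nm Nn; have [mn|/ltnW nm] := leqP m n.
  by rewrite opnormB_C (le_trans (iter_dist mn))// hN.
by rewrite (le_trans (iter_dist nm))// hN.
Qed.

Let xM : M x.
Proof.
by case: uM => M1 Ml _ _ _; rewrite /x addrC -scaleN1r; exact: Ml.
Qed.

Let iterM n : M (sqrt_iter n).
Proof.
case: (uM) => M1 Ml MM _ _; elim: n => [|n IH] /=.
  by have := Ml (-1) 1 1 M1 M1; rewrite scaleN1r addNr.
apply: cstar_adj_scale => //; rewrite -[x]scale1r; apply: Ml => //; exact: MM.
Qed.

Let iter_adj n : adj (sqrt_iter n) = sqrt_iter n.
Proof.
elim: n => [|n IH] /=; first exact: adj0.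
rewrite adjZ adjD adjM IH adjB adj1 (bpos_adj a0).
by congr (_ *: _); exact: conjc_real.
Qed.

Let iter_comm c n : c * a = a * c -> c * sqrt_iter n = sqrt_iter n * c.
Proof.
move=> ca; elim: n => [|n IH] /=; first by rewrite mulr0 mul0r.
apply: bop_ext => z; rewrite !bopM !bopZ linearZ /=.
have /(congr1 (fun S : 'B(H) => S z)) : c * (x + sqrt_iter n * sqrt_iter n) =
    (x + sqrt_iter n * sqrt_iter n) * c; last by rewrite !bopM => ->.
rewrite mulrDl mulrDr mulrBl mulrBr mulr1 mul1r ca.
by rewrite mulrA IH -mulrA IH mulrA.
Qed.

(** The root is [1 - Y] for the limit [Y] of the iterates, positive because [|Y| <= 1]. The iterates
    are polynomials in [a], hence the root stays in [M] and commutes with whatever commutes with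
    [a]; the latter feeds the uniqueness of square roots. *)
Lemma bop_sqrt : exists s, [/\ M s, bpos s, s * s = a &
  forall c, c * a = a * c -> c * s = s * c].
Proof.
have [Y yY] := iter_cvg.
have Y1 : opnorm Y <= 1.
  apply: (@le_eps _ _ _ 1) => // e e0; have [N /(_ N (leqnn _)) hN] := yY e e0.
  have := opnormD (sqrt_iter N) (- (sqrt_iter N - Y)).
  rewrite opprB addrC subrK opnormB_C mulr1 => /le_trans; apply.
  by apply: lerD => //; rewrite (le_trans (iter_le N))//; case/andP: (sqrt_maj_bounds N).
have aY : adj Y = Y.
  apply: op_tends_eq => e e0; have [N /(_ N (leqnn _)) hN] := yY _ (divr_gt0 e0 (ltr0n _ 2)).
  apply: le_trans (opnorm_triangle _ (sqrt_iter N) _) _.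
  rewrite -{1}(iter_adj N) -adjB [leRHS]splitr; apply: lerD => //.
  by rewrite (le_trans (opnorm_adj _))// opnormB_C.
have eY : Y = half *: (x + Y * Y).
  apply: op_tends_eq => e e0; have [N hN] := yY _ (divr_gt0 e0 (ltr0n _ 2)).
  have h1 := hN N.+1 (leqnSn N); have h2 := hN N (leqnn N).
  apply: le_trans (opnorm_triangle _ (sqrt_iter N.+1) _) _.
  rewrite [leRHS]splitr; apply: lerD; first by rewrite opnormB_C.
  rewrite [sqrt_iter N.+1]/= -scalerBr opnormZ half_ge0 opprD addrACA subrr add0r.
  have -> : sqrt_iter N * sqrt_iter N - Y * Y =
    (sqrt_iter N - Y) * sqrt_iter N + Y * (sqrt_iter N - Y).
    by rewrite mulrBl mulrBr addrA subrK.
  rewrite mulrC ler_pM2r ?invr_gt0//; apply: le_trans (opnormD _ _) _.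
  rewrite [leRHS]splitr; apply: lerD; apply: le_trans (opnormM _ _) _.
    rewrite -[leRHS]mulr1 ler_pM ?opnorm_ge0//.
    by rewrite (le_trans (iter_le N))//; case/andP: (sqrt_maj_bounds N).
  by rewrite -[leRHS]mul1r ler_pM ?opnorm_ge0.
exists (1 - Y); split.
- case: (uM) => M1 Ml _ _ cM; rewrite addrC -scaleN1r; apply: Ml => //.
  exact: op_tends_closed yY.
- apply: bpos_rdot => [|z]; first by rewrite adjB adj1 aY.
  rewrite bopB rdotDl rdotNl subr_ge0 rdot_xx; apply: le_trans (rdot_le _ _) _.
  rewrite expr2 ler_wpM2r ?hnorm_ge0// (le_trans (bop_le _ _))//.
  by rewrite -[leRHS]mul1r ler_wpM2r ?hnorm_ge0.
- have e2 : Y + Y = x + Y * Y.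
    rewrite {1 2}eY -scalerDl; have -> : half + half = 1; last by rewrite scale1r.
    by rewrite /half -rmorphD /= -[RHS]/((1 : R)%:C); congr (_%:C); field.
  rewrite mulrBl mul1r mulrBr mulr1 opprB.
  have -> : Y * Y = Y + Y - x by rewrite e2 addrC addKr.
  have -> : Y + Y - x - Y = Y - x by rewrite addrAC addrK.
  by rewrite addrA subrK /x opprB addrC subrK.
- move=> c ca; rewrite mulrBl mulrBr mul1r mulr1; congr (_ - _).
  apply: op_tends_eq => e e0.
  have c0 : 0 < 2 * (opnorm c + 1) by rewrite mulr_gt0// ltr_wpDl// opnorm_ge0.
  have [N /(_ N (leqnn _)) hN] := yY _ (divr_gt0 e0 c0).
  have -> : c * Y - Y * c = - (c * (sqrt_iter N - Y)) + (sqrt_iter N - Y) * c.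
    by rewrite mulrBl mulrBr opprB (iter_comm _ ca) addrA subrK.
  apply: le_trans (opnormD _ _) _; rewrite -{1}[c * _]opprK opprK.
  have h1 := opnormM c (sqrt_iter N - Y); have h2 := opnormM (sqrt_iter N - Y) c.
  have -> : opnorm (- (c * (sqrt_iter N - Y))) = opnorm (c * (sqrt_iter N - Y)).
    by rewrite -scaleN1r opnormZ cabsN normr1 mul1r.
  have := opnorm_ge0 c; have := opnorm_ge0 (sqrt_iter N - Y).
  move: hN; rewrite ler_pdivlMr//.
  move: (opnorm c) (opnorm (sqrt_iter N - Y)) h1 h2 => u v h1 h2; nra.
Qed.
End Sqrt.

(** With [d = S - T] one has [(S + T) d = 0], so the nonnegative numbers [<S d z, d z>] and
    [<T d z, d z>] both vanish. Hence [d d d = 0], and the self-adjoint [d] is 0. *)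
Lemma bpos_sqrt_uniq (S T : 'B(H)) :
  bpos S -> bpos T -> S * T = T * S -> S * S = T * T -> S = T.
Proof.
move=> S0 T0 ST SS; pose d := S - T.
have ad : adj d = d by rewrite adjB !bpos_adj.
have e0 z : '[S (d z), d z] = 0 /\ '[T (d z), d z] = 0.
  have : '[S (d z), d z] + '[T (d z), d z] = 0.
    rewrite -dotDl -!bopM -bopD -mulrDl.
    have -> : (S + T) * d = 0; last by rewrite bop0 dot0l.
    by rewrite /d mulrDl !mulrBr SS ST addrA subrK subrr.
  by move/eqP; rewrite paddr_eq0 ?S0 ?T0// => /andP[/eqP -> /eqP ->].
have e1 z : '[d (d z), d z] = 0.
  by have [a b] := e0 z; rewrite {1}/d bopB dotBl a b subrr.
have d3 : d * (d * d) = 0.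
  apply: bop_dot_ext => z; rewrite bop0 dot0l !bopM adjP ad.
  exact: e1.
have d2 z : d (d z) = 0.
  apply/hnorm_eq0/eqP; rewrite -sqrf_eq0 -rdot_xx /rdot -adjPl ad.
  by have /(congr1 (fun S : 'B(H) => S z)) := d3; rewrite !bopM => ->; rewrite dot0l.
apply/eqP; rewrite -subr_eq0 -/d; apply/eqP/bop_ext => z.
by apply/hnorm_eq0/eqP; rewrite -sqrf_eq0 -rdot_xx /rdot -adjPl ad d2 dot0l.
Qed.

End SquareRoot.

Section FaithfulReps.
Context {R : realType} {H L : hilbertType R}.
Variables (M : set 'B(H)) (pi : 'B(H) -> 'B(L)).
Hypotheses (uM : unital_cstar_subalgebra M) (fpi : faithful_unital_rep M pi).

Let M0 : M 0.
Proof.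
by case: uM => M1 Ml _ _ _; have := Ml (-1) 1 1 M1 M1; rewrite scaleN1r addNr.
Qed.

Let piZ (c : R[i]) T : M T -> pi (c *: T) = c *: pi T.
Proof.
case: fpi => [[lin _ _] _ _] MT.
have pi0 : pi 0 = 0 by have := lin (-1) 0 0 M0 M0; rewrite !scaleN1r !addNr.
by have := lin c T 0 MT M0; rewrite !addr0 pi0 addr0.
Qed.

(** Rescale [a] to [a'] and let [q] be the root of [a' a'] inside [M]. Then [pi a'] and [pi q] are
    commuting positive roots of [pi (a' a')], hence equal, and injectivity gives [a' = q]. This
    replaces spectral theory by the algebraic properties of [pi]. *)
Lemma faithful_bpos a : M a -> bpos (pi a) -> bpos a.
Proof.
move=> Ma pa0; case: (uM) => M1 Ml MM Madj _.
case: (fpi) => [[lin mult star] pi1 inj].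
have injM S T : M S -> M T -> pi S = pi T -> S = T.
  by move=> MS MT; apply: inj; rewrite inE.
have aa : adj a = a.
  by apply: injM => //; [exact: Madj|rewrite star// bpos_adj].
(* Scaling to a contraction, as [bop_sqrt] requires; the added 1 keeps the denominator positive. *)
pose c := (1 + opnorm a)^-1; pose a' := c%:C *: a.
have c_gt0 : 0 < c by rewrite invr_gt0 ltr_pwDl// opnorm_ge0.
have Ma' : M a' by exact: cstar_adj_scale.
have a'1 z : hnorm (a' z) <= hnorm z.
  rewrite bopZ hnormZr gtr0_norm// ler_pdivrMl ?ltr_pwDl ?opnorm_ge0//.
  by rewrite (le_trans (bop_le _ _))// ler_wpM2r ?hnorm_ge0// lerDr.
have aa' : adj a' = a' by rewrite adjZ aa; congr (_ *: _); exact: conjc_real.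
have pa'0 : bpos (pi a').
  by move=> z; rewrite piZ// bopZ dotZl mulr_ge0// ler0c ltW.
have MS : M (a' * a') by exact: MM.
have [q [Mq q0 qq qC]] : exists s, [/\ M s, bpos s, s * s = a' * a' &
    forall c, c * (a' * a') = (a' * a') * c -> c * s = s * c].
  apply: bop_sqrt => //.
    by apply: bpos_rdot => [|z]; rewrite ?adjM ?aa'// bopM rdot_adj// rdot_xx sqr_ge0.
  move=> z; rewrite bopM rdot_adj// rdot_xx.
  by rewrite ler_pXn2r ?nnegrE ?hnorm_ge0.
(* A further root [p] of [q] in [M] exhibits [pi q] as [pi p * pi p], which is visibly positive. *)
have [p [Mp p0 pp _]] : exists s, [/\ M s, bpos s, s * s = q &
    forall c, c * q = q * c -> c * s = s * c].
  apply: bop_sqrt => // z; apply: le_trans (rdot_le _ _) _.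
  rewrite expr2 ler_wpM2r ?hnorm_ge0//; apply: ler_of_sqr; first exact: hnorm_ge0.
  rewrite -rdot_xx rdot_adj ?bpos_adj// -bopM qq bopM -rdot_adj// rdot_xx.
  by rewrite ler_pXn2r ?nnegrE ?hnorm_ge0.
suff aq : a' = q.
  move=> z; have := q0 z; rewrite -aq bopZ dotZl pmulr_rge0//.
  by rewrite ltcR.
apply: injM => //; apply: bpos_sqrt_uniq => //.
- have app : adj (pi p) = pi p by rewrite -star// bpos_adj.
  apply: bpos_rdot => [|z]; rewrite -pp mult//.
    by rewrite adjM app.
  by rewrite bopM rdot_adj// rdot_xx sqr_ge0.
- by rewrite -!mult// qC ?mulrA.
- by rewrite -!mult// qq.
Qed.

End FaithfulReps.

(** * Completion of a pre-Hilbert space *)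

Section SeqLimits.
Context {R : realType}.

Definition rtends (x : nat -> R) (l : R) :=
  forall e, 0 < e -> exists N, forall n, (N <= n)%N -> `|x n - l| <= e.

Lemma rcauchy_cvg (x : nat -> R) :
  (forall e, 0 < e -> exists N, forall m n, (N <= m)%N -> (N <= n)%N ->
    `|x m - x n| <= e) -> exists l, rtends x l.
Proof.
move=> xC; have : cvg (x @ \oo).
  apply: cauchy_cvg; apply/cauchy_ballP => e e0.
  have [N xN] := xC _ (divr_gt0 e0 (ltr0n _ 2)).
  exists ([set x n | n in [set n | (N <= n)%N]], [set x n | n in [set n | (N <= n)%N]]).
    by split => /=; exists N => // n /= Nn; exists n.
  move=> [_ _] /= [[m Nm <-] [n Nn <-]].
  rewrite -ball_normE /= (le_lt_trans (xN _ _ Nm Nn))//.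
  by rewrite ltr_pdivrMr// mulr_natr mulr2n; lra.
move/cvgrPdist_le => h; exists (lim (x @ \oo)) => e e0.
have [N _ hN] := h e e0.
by exists N => n Nn; have := hN n Nn; rewrite /= distrC.
Qed.

Definition ctends (z : nat -> R[i]) (l : R[i]) :=
  forall e, 0 < e -> exists N, forall n, (N <= n)%N -> cabs (z n - l) <= e.

Lemma cabs_triangle (a b c : R[i]) : cabs (a - c) <= cabs (a - b) + cabs (b - c).
Proof. by have := cabsD (a - b) (b - c); rewrite addrA subrK. Qed.

Lemma cabs_le_ReIm (z : R[i]) : cabs z <= `|complex.Re z| + `|complex.Im z|.
Proof.
apply: ler_of_sqr; first by rewrite addr_ge0.
rewrite cabs_sqr -(real_normK (num_real (complex.Re z))).
rewrite -(real_normK (num_real (complex.Im z))).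
by have := normr_ge0 (complex.Re z); have := normr_ge0 (complex.Im z); nra.
Qed.

Lemma Im_le_cabs (z : R[i]) : `|complex.Im z| <= cabs z.
Proof.
apply: ler_of_sqr; first exact: Re_norm_ge0.
by rewrite cabs_sqr real_normK ?num_real// lerDr sqr_ge0.
Qed.

Lemma ccauchy_cvg (z : nat -> R[i]) :
  (forall e, 0 < e -> exists N, forall m n, (N <= m)%N -> (N <= n)%N ->
    cabs (z m - z n) <= e) -> exists l, ctends z l.
Proof.
move=> zC.
have [a az] : exists a, rtends (fun n => complex.Re (z n)) a.
  apply: rcauchy_cvg => e /zC[N hN]; exists N => m n Nm Nn.
  by rewrite -ReB (le_trans (Re_le_cabs _))// hN.
have [b bz] : exists b, rtends (fun n => complex.Im (z n)) b.
  apply: rcauchy_cvg => e /zC[N hN]; exists N => m n Nm Nn.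
  by rewrite -ImN -ImD (le_trans (Im_le_cabs _))// hN.
exists (Complex a b) => e e0.
have [N hN] := az _ (divr_gt0 e0 (ltr0n _ 2)).
have [N' hN'] := bz _ (divr_gt0 e0 (ltr0n _ 2)).
exists (maxn N N') => n; rewrite geq_max => /andP[/hN h /hN' h'].
by rewrite (le_trans (cabs_le_ReIm _))// ReD ReN ImD ImN [leRHS]splitr lerD.
Qed.

Lemma ctends_close z w l : ctends z l -> ctends (fun n => z n - w n) 0 -> ctends w l.
Proof.
move=> zl zw e e0; have e20 := divr_gt0 e0 (ltr0n _ 2).
have [N hN] := zl _ e20; have [N' hN'] := zw _ e20.
exists (maxn N N') => n; rewrite geq_max => /andP[/hN h /hN' h'].
rewrite (le_trans (cabs_triangle _ (z n) _))// [leRHS]splitr lerD//.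
by move: h'; rewrite subr0 -cabsN opprB.
Qed.

Lemma ctends_uniq z l l' : ctends z l -> ctends z l' -> l = l'.
Proof.
move=> zl zl'; apply/eqP; rewrite -subr_eq0; apply/eqP/cabs_eq0/eqP.
rewrite eq_le Re_norm_ge0 andbT; apply: (@le_eps _ _ _ 2) => // e e0.
have [N hN] := zl _ e0; have [N' hN'] := zl' _ e0.
have := hN _ (leq_maxl N N'); have := hN' _ (leq_maxr N N').
move: (maxn _ _) => n h1 h2; rewrite (le_trans (cabs_triangle _ (z n) _))//.
by rewrite -cabsN opprB; lra.
Qed.

Lemma ctends_lin (a : R[i]) z w l l' : ctends z l -> ctends w l' ->
  ctends (fun n => a * z n + w n) (a * l + l').
Proof.
move=> zl wl e e0; have a0 : 0 < 1 + cabs a by rewrite ltr_pwDl// Re_norm_ge0.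
have [N hN] := zl _ (divr_gt0 (divr_gt0 e0 (ltr0n _ 2)) a0).
have [N' hN'] := wl _ (divr_gt0 e0 (ltr0n _ 2)).
exists (maxn N N') => n; rewrite geq_max => /andP[/hN h /hN' h'].
rewrite opprD addrACA -mulrBr (le_trans (cabsD _ _))// [leRHS]splitr lerD// cabsM.
move: h; rewrite ler_pdivlMr// => h; have := Re_norm_ge0 (z n - l); lra.
Qed.

Lemma ctends_conj z l : ctends z l -> ctends (fun n => (z n)^*%R) l^*%R.
Proof.
move=> zl e /zl[N hN]; exists N => n /hN.
by rewrite -rmorphB cabs_conj.
Qed.

Lemma ctends_Re z l : ctends z l -> rtends (fun n => complex.Re (z n)) (complex.Re l).
Proof.
move=> zl e /zl[N hN]; exists N => n /hN; apply: le_trans.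
by rewrite -ReB Re_le_cabs.
Qed.

End SeqLimits.

(** The form may be degenerate: null vectors become 0 in the completion, so no quotient has to be
    formed. *)
Record prehilb (R : realType) := PreHilb {
  pcar :> lmodType (complexF R);
  pform : pcar -> pcar -> R[i];
  pform_lin : forall (a : R[i]) x y z, pform (a *: x + y) z = a * pform x z + pform y z;
  pform_herm : forall x y, pform x y = (pform y x)^*%R;
  pform_ge0 : forall x, 0 <= pform x x }.

Section PreHilbTheory.
Context {R : realType} {P : prehilb R}.
Implicit Types x y z : P.

Lemma pformDl x y z : pform (x + y) z = pform x z + pform y z.
Proof. by have := pform_lin 1 x y z; rewrite scale1r mul1r. Qed.
Lemma pform0l z : pform (0 : P) z = 0.
Proof. by apply: (@addrI _ (pform 0 z)); rewrite -pformDl !addr0. Qed.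
Lemma pformZl (a : R[i]) x z : pform (a *: x) z = a * pform x z.
Proof. by have := pform_lin a x 0 z; rewrite !addr0 pform0l addr0. Qed.
Lemma pformNl x z : pform (- x) z = - pform x z.
Proof. by rewrite -scaleN1r pformZl mulN1r. Qed.
Lemma pformBl x y z : pform (x - y) z = pform x z - pform y z.
Proof. by rewrite pformDl pformNl. Qed.
Lemma pformDr x y z : pform z (x + y) = pform z x + pform z y.
Proof. by rewrite pform_herm pformDl rmorphD /= -!pform_herm. Qed.
Lemma pformZr (a : R[i]) x z : pform z (a *: x) = a^*%R * pform z x.
Proof. by rewrite pform_herm pformZl rmorphM /= -pform_herm. Qed.
Lemma pformNr x z : pform z (- x) = - pform z x.
Proof. by rewrite pform_herm pformNl rmorphN /= -pform_herm. Qed.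
Lemma pformBr x y z : pform z (x - y) = pform z x - pform z y.
Proof. by rewrite pformDr pformNr. Qed.

Definition pnorm x : R := Num.sqrt (complex.Re (pform x x)).

Lemma pnorm_ge0 x : 0 <= pnorm x. Proof. exact: sqrtr_ge0. Qed.

Lemma Re_pform_ge0 x : 0 <= complex.Re (pform x x).
Proof. by have /complex_ge0[] := pform_ge0 x. Qed.

Lemma pnorm_sqr x : pnorm x ^+ 2 = complex.Re (pform x x).
Proof. by rewrite sqr_sqrtr// Re_pform_ge0. Qed.

Lemma pform_xx x : pform x x = (pnorm x ^+ 2)%:C.
Proof.
have /complex_ge0[i0 _] := pform_ge0 x.
by apply: complex_ext; rewrite ?pnorm_sqr ?i0.
Qed.

Lemma Re_pformC x y : complex.Re (pform x y) = complex.Re (pform y x).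
Proof. by rewrite pform_herm cRe_conj. Qed.

Lemma pnormD_sqr x y :
  pnorm (x + y) ^+ 2 = pnorm x ^+ 2 + pnorm y ^+ 2 + 2 * complex.Re (pform x y).
Proof.
by rewrite !pnorm_sqr pformDl !pformDr !ReD (Re_pformC y x); ring.
Qed.

Lemma pnormZ (a : R[i]) x : pnorm (a *: x) = cabs a * pnorm x.
Proof.
apply/eqP; rewrite -(eqrXn2 (ltn0Sn 1)) ?mulr_ge0 ?pnorm_ge0 ?Re_norm_ge0//.
rewrite exprMn !pnorm_sqr pformZl pformZr mulrA -normCK.
by rewrite -(Re_norm a) -rmorphXn Re_mulR.
Qed.

Lemma Re_pform_le x y : complex.Re (pform x y) <= pnorm x * pnorm y.
Proof.
have disc (a b r : R) : 0 <= a -> 0 <= b ->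
    (forall t, 0 <= a ^+ 2 + t ^+ 2 * b ^+ 2 + 2 * (t * r)) -> r <= a * b.
  (* As the form may be degenerate, [b = 0] does not mean a zero vector; there a very negative [t r]
     excludes [r > 0]. Otherwise the minimizer [t = - r / b^2] is inserted. *)
  move=> a0 b0 h; have [b00|b1] := eqVneq b 0.
    rewrite b00 mulr0 leNgt; apply/negP => r0.
    have := h (- (a ^+ 2 + 1) / r); rewrite b00 expr0n /= mulr0 addr0 divfK ?gt_eqF//.
    by have := sqr_ge0 a; lra.
  have b2 : 0 < b by rewrite lt_neqAle eq_sym b1.
  have := h (- r / b ^+ 2).
  have -> : a ^+ 2 + (- r / b ^+ 2) ^+ 2 * b ^+ 2 + 2 * (- r / b ^+ 2 * r) =
    a ^+ 2 - (r / b) ^+ 2 by field.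
  rewrite subr_ge0 => /ler_of_sqr-/(_ a0); rewrite ler_pdivrMr//.
apply: disc; rewrite ?pnorm_ge0// => t.
have := sqr_ge0 (pnorm (x + t%:C *: y)).
by rewrite pnormD_sqr pnormZ pformZr cabsR exprMn real_normK ?num_real// conjCR Re_mulR.
Qed.

Lemma pform_cauchy_schwarz x y : cabs (pform x y) <= pnorm x * pnorm y.
Proof.
have [->|d0] := eqVneq (pform x y) 0.
  by rewrite cabs0 mulr_ge0// pnorm_ge0.
have := Re_pform_le (((pform x y)^*%R / `|pform x y|) *: x) y.
rewrite pformZl mulrAC -normCKC expr2 mulfK ?normr_eq0//.
rewrite pnormZ normrM norm_conjC normfV normr_id divff ?normr_eq0//.
by rewrite mul1r.
Qed.

Lemma pnormD x y : pnorm (x + y) <= pnorm x + pnorm y.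
Proof.
apply: ler_of_sqr; first by rewrite addr_ge0 ?pnorm_ge0.
by rewrite pnormD_sqr; have := Re_pform_le x y; lra.
Qed.

Lemma pnormN x : pnorm (- x) = pnorm x.
Proof. by rewrite -scaleN1r pnormZ cabsN normr1 mul1r. Qed.

Lemma pnorm_le_form x (c : R) : 0 <= c ->
  cabs (pform x x) <= c * pnorm x -> pnorm x <= c.
Proof.
move=> c0; rewrite pform_xx cabsR ger0_norm ?sqr_ge0// expr2.
have [->//|x0] := eqVneq (pnorm x) 0.
by rewrite ler_pM2r// lt_neqAle eq_sym x0 pnorm_ge0.
Qed.

End PreHilbTheory.

Section Completion.
Context {R : realType} {P : prehilb R}.
Local Notation C := (GRing.regular (complexF R)).

Definition approximable : {pred P -> C} := fun f =>
  `[< forall e : R, 0 < e ->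
      exists x : P, forall p : P, cabs ((f p : R[i]) - pform x p) <= e * pnorm p >].

Lemma approximable_submod_closed : submod_closed approximable.
Proof.
split.
  apply/asboolP => e e0; exists 0 => p.
  by rewrite pform0l subr0 cabs0 mulr_ge0 ?pnorm_ge0 ?ltW.
move=> a f g /asboolP hf /asboolP hg; apply/asboolP => e e0.
have a0 : 0 < 1 + cabs a by rewrite ltr_pwDl// Re_norm_ge0.
have [x hx] := hf _ (divr_gt0 (divr_gt0 e0 (ltr0n _ 2)) a0).
have [y hy] := hg _ (divr_gt0 e0 (ltr0n _ 2)).
exists (a *: x + y) => p; rewrite pform_lin.
have -> : (a *: f + g) p = a * (f p : R[i]) + g p by [].
rewrite opprD addrACA -mulrBr (le_trans (cabsD _ _))//.
rewrite (splitr e) mulrDl lerD// cabsM.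
have := hx p; rewrite mulrAC ler_pdivlMr// => h.
have := Re_norm_ge0 (f p - pform x p); lra.
Qed.

HB.instance Definition _ :=
  GRing.isSubmodClosed.Build (complexF R) (P -> C) approximable
    approximable_submod_closed.

(* The completion of [P], realized inside its antidual: the functionals that
   are norm limits of [p |-> <x, p>]. *)
Record compl := Compl { cfun :> P -> C; _ : cfun \in approximable }.

End Completion.
Arguments compl {R} P.

HB.instance Definition _ (R : realType) (P : prehilb R) :=
  [isSub for @cfun R P].
HB.instance Definition _ (R : realType) (P : prehilb R) :=
  [Choice of compl P by <:].
HB.instance Definition _ (R : realType) (P : prehilb R) :=
  [SubChoice_isSubLmodule of compl P by <:].

Section CompletionTheory.
Context {R : realType} {P : prehilb R}.
Implicit Types (f g h : compl P) (p q x y : P).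

Definition cval f p : R[i] := f p.

Lemma cval_ext f g : cval f =1 cval g -> f = g.
Proof. by move=> fg; apply/val_inj/funext. Qed.

Lemma cval_lin (a : R[i]) f g p : cval (a *: f + g) p = a * cval f p + cval g p.
Proof. by []. Qed.
Lemma cvalB f g p : cval (f - g) p = cval f p - cval g p.
Proof. by []. Qed.

Lemma cval_approx f e : 0 < e ->
  exists x : P, forall p, cabs (cval f p - pform x p) <= e * pnorm p.
Proof. by case: f => f /= /asboolP; apply. Qed.

Let invn_gt0 n : 0 < n.+1%:R^-1 :> R.
Proof. by rewrite invr_gt0 ltr0n. Qed.

Definition capp f n : P := projT1 (cid (cval_approx f (invn_gt0 n))).

Lemma cappP f n p : cabs (cval f p - pform (capp f n) p) <= n.+1%:R^-1 * pnorm p.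
Proof. by rewrite /capp; case: cid. Qed.

Lemma cval_bound f : exists2 M, 0 <= M & forall p, cabs (cval f p) <= M * pnorm p.
Proof.
have [x hx] := cval_approx f ltr01.
exists (1 + pnorm x) => [|p]; first by rewrite addr_ge0// pnorm_ge0.
have := cabsD (cval f p - pform x p) (pform x p); rewrite subrK.
by have := hx p; have := pform_cauchy_schwarz x p; lra.
Qed.

(** Additivity is not built into [approximable]; it is inherited from the approximating forms. *)
Lemma cval_sub f p q : cval f (p - q) = cval f p - cval f q.
Proof.
apply/eqP; rewrite -subr_eq0; apply/eqP/cabs_eq0/eqP.
rewrite eq_le Re_norm_ge0 andbT.
apply: (@le_eps _ _ _ (pnorm (p - q) + pnorm p + pnorm q)).
  by rewrite !addr_ge0 ?pnorm_ge0.
move=> e e0; have [x hx] := cval_approx f e0; rewrite add0r.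
have -> : cval f (p - q) - (cval f p - cval f q) =
    (cval f (p - q) - pform x (p - q)) - (cval f p - pform x p)
    + (cval f q - pform x q).
  by rewrite pformBr; ring.
have := hx (p - q); have := hx p; have := hx q.
move: (_ - pform x (p - q)) (cval f p - _) (cval f q - _) => a b c h1 h2 h3.
have := cabsD (a - b) c; have := cabsD a (- b); rewrite cabsN; lra.
Qed.

Lemma capp_bound f : exists2 B, 0 <= B & forall n, pnorm (capp f n) <= B.
Proof.
have [M M0 hM] := cval_bound f; exists (M + 1) => [|n]; first by rewrite addr_ge0.
apply: pnorm_le_form; first by rewrite addr_ge0.
have := cappP f n (capp f n); have := hM (capp f n).
have h1 : n.+1%:R^-1 <= 1 :> R by rewrite invf_le1 ?ltr0n// ler1n.
have := ler_wpM2r (pnorm_ge0 (capp f n)) h1.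
move: (pform _ _) => z; move: (n.+1%:R^-1 * _) => t h2 h3 h4.
have := cabsD (cval f (capp f n)) (- (cval f (capp f n) - z)).
by rewrite opprB addrC subrK -(cabsN (z - _)) opprB; lra.
Qed.

(** Tested on the difference itself, as for the approximants in [riesz]. *)
Lemma capp_cauchy f m n :
  pnorm (capp f m - capp f n) <= m.+1%:R^-1 + n.+1%:R^-1.
Proof.
apply: pnorm_le_form; first by rewrite addr_ge0// ltW.
set z := _ - _; have := cappP f m z; have := cappP f n z.
rewrite {5}/z pformBl.
move: (pform (capp f m) z) (pform (capp f n) z) (cval f z) => a b c h1 h2.
have := cabsD (c - b) (- (c - a)); rewrite cabsN.
have -> : c - b - (c - a) = a - b by ring.
rewrite mulrDl; move: (m.+1%:R^-1 * _) (n.+1%:R^-1 * _) h1 h2 => u v; lra.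
Qed.

Let cdot_ex f g : exists l, ctends (fun n => cval f (capp g n)) l.
Proof.
have [M M0 hM] := cval_bound f; apply: ccauchy_cvg => e e0.
have M1 : 0 < (M + 1) * 2 by rewrite mulr_gt0// ltr_wpDl.
have [N hN] := invn_small (divr_gt0 e0 M1).
exists N => m n /hN hm /hN hn; rewrite -cval_sub (le_trans (hM _))//.
have := capp_cauchy g m n; have := pnorm_ge0 (capp g m - capp g n).
move: (pnorm _) hm hn => t; rewrite !ler_pdivlMr//.
move: (m.+1%:R^-1) (n.+1%:R^-1) => u v hm hn t0 htu; nra.
Qed.

Definition cdot f g : R[i] := projT1 (cid (cdot_ex f g)).

Lemma cdotP f g : ctends (fun n => cval f (capp g n)) (cdot f g).
Proof. by rewrite /cdot; case: cid. Qed.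

Lemma cdot_lin (a : R[i]) f g h : cdot (a *: f + g) h = a * cdot f h + cdot g h.
Proof.
apply: ctends_uniq (cdotP (a *: f + g) h) _.
exact: (ctends_lin a (cdotP f h) (cdotP g h)).
Qed.

(** Turns [cdot f g] into a limit of forms of approximants, from which symmetry and positivity are
    inherited. *)
Lemma cdot_close f g :
  ctends (fun n => cval f (capp g n) - pform (capp f n) (capp g n)) 0.
Proof.
have [B B0 hB] := capp_bound g => e e0.
have B1 : 0 < B + 1 by rewrite ltr_wpDl.
have [N hN] := invn_small (divr_gt0 e0 B1); exists N => n /hN.
rewrite subr0 ler_pdivlMr//; have := cappP f n (capp g n); have := hB n.
have := pnorm_ge0 (capp g n); have := invn_gt0 n.
move: (pnorm _) (n.+1%:R^-1) => t u u0 t0 h1 h2 h3; nra.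
Qed.

Lemma cdot_herm f g : cdot f g = (cdot g f)^*%R.
Proof.
have h1 := ctends_close (cdotP f g) (cdot_close f g).
have h2 := ctends_conj (ctends_close (cdotP g f) (cdot_close g f)).
by apply: ctends_uniq h1 _ => e /h2[N hN]; exists N => n /hN; rewrite -pform_herm.
Qed.

Lemma cdot_ge0 f : 0 <= cdot f f.
Proof.
have h := ctends_close (cdotP f f) (cdot_close f f).
apply/complex_ge0; split.
  by have /(congr1 (@complex.Im R)) := cdot_herm f f; rewrite cIm_conj; lra.
apply: (@le_eps _ _ _ 1) => // e /(ctends_Re h)[N /(_ N (leqnn _))].
rewrite mulr1 ler_norml => /andP[h1 h2].
by have := Re_pform_ge0 (capp f N); lra.
Qed.

(** Makes Cauchy-Schwarz and the triangle inequality available on the completion before its norm is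
    declared. *)
Definition compl_prehilb := PreHilb cdot_lin cdot_herm cdot_ge0.
Definition cnorm f : R := @pnorm R compl_prehilb f.

Lemma capp_norm f : rtends (fun n => pnorm (capp f n) ^+ 2) (cnorm f ^+ 2).
Proof.
have h := ctends_Re (ctends_close (cdotP f f) (cdot_close f f)).
by move=> e /h[N hN]; exists N => n /hN; rewrite !pnorm_sqr.
Qed.

Lemma cval_le f p : cabs (cval f p) <= cnorm f * pnorm p.
Proof.
have h0 : 0 <= cnorm f * pnorm p by rewrite mulr_ge0 ?pnorm_ge0.
apply: ler_of_sqr => //; have [B B0 hB] := capp_bound f.
apply: (@le_eps _ _ _ ((2 + 2 * B) * pnorm p ^+ 2)).
  by rewrite mulr_ge0 ?sqr_ge0// addr_ge0// mulr_ge0.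
(* With [e <= 1] the term [e^2] is absorbed into [e] in the final estimate. *)
move=> e e0; wlog e1 : e e0 / e <= 1.
  move=> hw; have [/hw|e1] := leP e 1; first exact.
  apply: le_trans (hw 1 _ _) _ => //; rewrite lerD2l ler_wpM2r//; last exact: ltW.
  by rewrite mulr_ge0 ?sqr_ge0// addr_ge0// mulr_ge0.
have [N hN] := capp_norm f e0; have [N' hN'] := invn_small e0.
have := hN _ (leq_maxl N N'); have := hN' _ (leq_maxr N N').
move: (maxn N N') => n h1; rewrite ler_norml => /andP[_ h2].
have h3 := cappP f n p; have h4 := pform_cauchy_schwarz (capp f n) p.
have h5 : cabs (cval f p) <= (pnorm (capp f n) + e) * pnorm p.
  have := cabsD (cval f p - pform (capp f n) p) (pform (capp f n) p); rewrite subrK.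
  have := ler_wpM2r (pnorm_ge0 p) h1; move: (n.+1%:R^-1 * _) h3 => t.
  rewrite mulrDl; lra.
have h6 : cabs (cval f p) ^+ 2 <= (pnorm (capp f n) + e) ^+ 2 * pnorm p ^+ 2.
  rewrite -exprMn ler_pXn2r ?nnegrE ?Re_norm_ge0//.
  by rewrite mulr_ge0 ?addr_ge0 ?pnorm_ge0// ltW.
rewrite exprMn; apply: le_trans h6 _.
have h7 : (pnorm (capp f n) + e) ^+ 2 <= cnorm f ^+ 2 + e * (2 + 2 * B).
  by have := hB n; have := pnorm_ge0 (capp f n); nra.
have := ler_wpM2r (sqr_ge0 (pnorm p)) h7.
by rewrite mulrDl mulrA.
Qed.

(** Together with [cval_le] this identifies [cnorm] as the dual norm, so norms in the completion are
    tested against [P] only. *)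
Lemma cnorm_le f (M : R) : 0 <= M ->
  (forall p, cabs (cval f p) <= M * pnorm p) -> cnorm f <= M.
Proof.
move=> M0 hM; apply: ler_of_sqr => //.
apply: (@le_eps _ _ _ (1 + 2 * M + 1)); first by rewrite !addr_ge0// mulr_ge0.
move=> e e0; wlog e1 : e e0 / e <= 1.
  move=> hw; have [/hw|e1] := leP e 1; first exact.
  apply: le_trans (hw 1 _ _) _ => //; rewrite lerD2l ler_wpM2r//; last exact: ltW.
  by rewrite !addr_ge0// mulr_ge0.
have [N hN] := capp_norm f e0; have [N' hN'] := invn_small e0.
have := hN _ (leq_maxl N N'); have := hN' _ (leq_maxr N N').
move: (maxn N N') => n h1; rewrite ler_norml => /andP[h2 _].
have h3 : pnorm (capp f n) <= M + e.
  apply: pnorm_le_form; first by rewrite addr_ge0// ltW.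
  have := hM (capp f n); have := cappP f n (capp f n).
  have := ler_wpM2r (pnorm_ge0 (capp f n)) h1.
  move: (pform _ _) (n.+1%:R^-1 * _) => z t; rewrite mulrDl => h3 h4 h5.
  have := cabsD (cval f (capp f n)) (- (cval f (capp f n) - z)).
  by rewrite opprB addrC subrK -(cabsN (z - _)) opprB; lra.
by have := pnorm_ge0 (capp f n); nra.
Qed.

Lemma cnorm_eq0 f : cnorm f = 0 -> f = 0.
Proof.
move=> f0; apply: cval_ext => p; apply: cabs_eq0; apply/eqP.
by rewrite eq_le Re_norm_ge0 andbT; have := cval_le f p; rewrite f0 mul0r.
Qed.

Let cnorm_C f : R[i] := (cnorm f)%:C.

Let cnormD f g : cnorm_C (f + g) <= cnorm_C f + cnorm_C g.
Proof. by rewrite /cnorm_C -rmorphD lecR; exact: (@pnormD R compl_prehilb). Qed.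

Let cnormZ (a : R[i]) f : cnorm_C (a *: f) = `|a| * cnorm_C f.
Proof.
rewrite /cnorm_C -[`|a|]Re_norm -rmorphM; congr (_%:C).
exact: (@pnormZ R compl_prehilb).
Qed.

Let cnorm0_eq0 f : cnorm_C f = 0 -> f = 0.
Proof. by move=> /(@complexI R)/cnorm_eq0. Qed.

HB.instance Definition _ :=
  Lmodule_isNormed.Build (complexF R) (compl P) cnormD cnormZ cnorm0_eq0.

Lemma compl_normE f : `|f| = (cnorm f)%:C.
Proof. by []. Qed.

(** The pointwise limit inherits the rate uniformly in [p], and is therefore approximable through
    some [f N]. *)
Lemma compl_seq_complete (f : nat -> compl P) :
  (forall n m, (n <= m)%N -> cnorm (f m - f n) <= n.+1%:R^-1) ->
  exists g, forall n, cnorm (g - f n) <= n.+1%:R^-1.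
Proof.
move=> fC.
have pt p : exists l, ctends (fun n => cval (f n) p) l.
  apply: ccauchy_cvg => e e0; have p1 : 0 < pnorm p + 1 by rewrite ltr_wpDl ?pnorm_ge0.
  have [N hN] := invn_small (divr_gt0 e0 p1).
  have mono m n : (N <= m)%N -> (m <= n)%N -> cabs (cval (f n) p - cval (f m) p) <= e.
    move=> Nm mn; rewrite -cvalB (le_trans (cval_le _ _))//.
    have := le_trans (fC _ _ mn) (hN _ Nm); rewrite ler_pdivlMr//.
    have := pnorm_ge0 p; have := @pnorm_ge0 R compl_prehilb (f n - f m);
    rewrite -/(cnorm _); nra.
  exists N => m n Nm Nn; have [mn|/ltnW nm] := leqP m n; last exact: mono.
  by rewrite -cabsN opprB mono.
pose g0 (p : P) : GRing.regular (complexF R) := projT1 (cid (pt p)).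
have g0P p : ctends (fun n => cval (f n) p) (g0 p) by rewrite /g0; case: cid.
have gf n p : cabs ((g0 p : R[i]) - cval (f n) p) <= n.+1%:R^-1 * pnorm p.
  apply: (@le_eps _ _ _ 1) => // e e0; rewrite mulr1.
  have [N hN] := g0P p _ e0; have := hN _ (leq_maxr n N).
  have := le_trans (cval_le (f (maxn n N) - f n) p)
     (ler_wpM2r (pnorm_ge0 p) (fC _ _ (leq_maxl n N))).
  rewrite cvalB; move: (cval (f (maxn _ _)) _) => z h1 h2.
  apply: le_trans (cabs_triangle _ z _) _.
  by rewrite addrC lerD// -cabsN opprB.
have ga : g0 \in @approximable R P.
  apply/asboolP => e e0; have [N /(_ N (leqnn _)) hN] := invn_small (divr_gt0 e0 (ltr0n _ 2)).
  have [x hx] := cval_approx (f N) (divr_gt0 e0 (ltr0n _ 2)).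
  exists x => p; apply: le_trans (cabs_triangle _ (cval (f N) p) _) _.
  rewrite (splitr e) mulrDl lerD// (le_trans (gf N p))//.
  by rewrite ler_wpM2r ?pnorm_ge0.
exists (Compl ga) => n; apply: cnorm_le => [|p]; first by rewrite ltW.
exact: gf.
Qed.

End CompletionTheory.

Section CompletionHilbert.
Context {R : realType} {P : prehilb R}.

Lemma cnorm_triangle (f g h : compl P) : cnorm (f - h) <= cnorm (f - g) + cnorm (g - h).
Proof.
have := @pnormD R (@compl_prehilb R P) (f - g) (g - h).
by rewrite addrA subrK.
Qed.

Lemma cnormBC (f g : compl P) : cnorm (f - g) = cnorm (g - f).
Proof. by rewrite -opprB; exact: (@pnormN R (@compl_prehilb R P)). Qed.

Let compl_complete (F : set_system (compl P)) :
  ProperFilter F -> cauchy F -> cvg F.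
Proof.
move=> FF /cauchy_ballP F_cauchy.
(* Half of [1/(n+1)] as radius: two such balls meet, so their centres satisfy the rate assumed in
   [compl_seq_complete]. *)
have ex n : exists f : compl P, F (ball f (n.+1%:R^-1 / 2 : R)%:C).
  move/cauchy_ballP: F_cauchy => /cauchyP; apply.
  by rewrite ltcR divr_gt0// invr_gt0 ltr0n.
pose f n := projT1 (cid (ex n)).
have fP n : F (ball (f n) (n.+1%:R^-1 / 2 : R)%:C) by rewrite /f; case: cid.
have fC n m : (n <= m)%N -> cnorm (f m - f n) <= n.+1%:R^-1.
  move=> nm; have [h [h1 h2]] := filter_ex (filterI (fP n) (fP m)).
  move: h1; rewrite -ball_normE /= compl_normE ltcR => h1.
  move: h2; rewrite -ball_normE /= compl_normE ltcR => h2.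
  have h3 : m.+1%:R^-1 <= n.+1%:R^-1 :> R by rewrite lef_pV2 ?posrE ?ltr0n// ler_nat.
  apply: le_trans (cnorm_triangle _ h _) _.
  rewrite (cnormBC h); move: (n.+1%:R^-1) (m.+1%:R^-1) h1 h2 h3 => u v h1 h2 h3.
  move: (cnorm _) (cnorm _) h1 h2 => a b *; lra.
have [g hg] := compl_seq_complete fC.
apply/cvg_ex; exists g; apply/cvgrPdist_le => e e0.
have e0' : 0 < complex.Re e by rewrite -ltcR RRe_real ?gtr0_real.
rewrite /=; have [N /(_ N (leqnn _)) hN] := invn_small (divr_gt0 e0' (ltr0n _ 2)).
apply: filterS (fP N) => h; rewrite -ball_normE /= compl_normE ltcR => h1.
rewrite -[leRHS]RRe_real ?gtr0_real// lecR.
apply: le_trans (cnorm_triangle _ (f N) _) _.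
have := hg N; move: (N.+1%:R^-1) hN h1 => u *; lra.
Qed.

HB.instance Definition _ := Uniform_isComplete.Build (compl P) compl_complete.


Let cdot_bilinear : bilinear_for ( *%R : complexF R -> _ -> _)
  (Num.conj \; *%R) (@cdot R P : compl P -> compl P -> complexF R).
Proof.
split=> [x a u v|x a u v] /=.
  by rewrite -[RHS]/(a * _ + _) -cdot_lin.
rewrite -[RHS]/(a^*%R * _ + _) (cdot_herm x) cdot_lin rmorphD rmorphM /=.
by rewrite -!cdot_herm.
Qed.

HB.instance Definition _ :=
  bilinear_isBilinear.Build (complexF R) (compl P) (compl P) _ _ _ _ cdot_bilinear.

Let cdot_hermitian (f g : compl P) :
  cdot f g = (-1) ^+ false * Num.conj (cdot g f) :> complexF R.
Proof. by rewrite expr0 mul1r cdot_herm. Qed.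

HB.instance Definition _ := isHermitianSesquilinear.Build (complexF R) (compl P)
  false Num.conj (@cdot R P) cdot_hermitian.

Let cdot_gt0 (f : compl P) : f != 0 -> 0 < (cdot f f : complexF R).
Proof.
move=> f0; rewrite lt_neqAle cdot_ge0 andbT eq_sym; apply: contra f0 => /eqP ff.
by apply/eqP/cnorm_eq0; rewrite /cnorm /pnorm /= ff sqrtr0.
Qed.

HB.instance Definition _ := isDotProduct.Build (complexF R) (compl P)
  (@cdot R P) cdot_gt0.

Let compl_hdot_norm (f : compl P) :
  `|f| ^+ 2 = (@cdot R P : {dot (compl P) for Num.conj}) f f.
Proof.
rewrite compl_normE -rmorphXn /=; symmetry.
exact: (@pform_xx R (@compl_prehilb R P)).
Qed.

HB.instance Definition _ :=
  CompleteNormedModule_isHilbert.Build R (compl P) compl_hdot_norm.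

Definition complH : hilbertType R := compl P.

Lemma complH_dot (f g : compl P) : '[f : complH, g] = cdot f g.
Proof. by []. Qed.

End CompletionHilbert.
Arguments complH {R} P.

Section CompletionMaps.
Context {R : realType}.

Section Embedding.
Context {P : prehilb R}.

Lemma emb_subproof (x : P) :
  (pform x : P -> GRing.regular (complexF R)) \in @approximable R P.
Proof.
apply/asboolP => e e0; exists x => p.
by rewrite subrr cabs0 mulr_ge0 ?pnorm_ge0// ltW.
Qed.

Definition emb (x : P) : complH P := Compl (emb_subproof x).

Lemma cval_emb x p : cval (emb x) p = pform x p. Proof. by []. Qed.

Lemma emb_lin (a : R[i]) x y : emb (a *: x + y) = a *: emb x + emb y.
Proof. by apply: cval_ext => p; rewrite cval_lin !cval_emb pform_lin. Qed.

Lemma emb_dense (f : complH P) (e : R) : 0 < e -> exists x, hnorm (f - emb x) <= e.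
Proof.
move=> e0; have [x hx] := cval_approx f e0; exists x.
by apply: cnorm_le => [|p]; [exact: ltW|rewrite cvalB; exact: hx].
Qed.

(** Links the encoding by functionals with the inner product: testing a vector against embedded ones
    is evaluating it. *)
Lemma dot_embr (f : complH P) x : '[f, emb x] = cval f x.
Proof.
rewrite complH_dot; apply: ctends_uniq (cdotP f (emb x)) _ => e e0.
have [M M0 hM] := cval_bound f.
have M1 : 0 < M + 1 by rewrite ltr_wpDl.
have [N hN] := invn_small (divr_gt0 e0 M1); exists N => n /hN.
rewrite -cval_sub ler_pdivlMr// => h; apply: le_trans (hM _) _.
have : pnorm (capp (emb x) n - x) <= n.+1%:R^-1.
  apply: pnorm_le_form; first by rewrite invr_ge0.
  have := cappP (emb x) n (capp (emb x) n - x).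
  by rewrite cval_emb pformBl -cabsN opprB.
have := pnorm_ge0 (capp (emb x) n - x).
move: (pnorm _) (n.+1%:R^-1) h => t u *; nra.
Qed.

Lemma dot_emb x y : '[emb x, emb y] = pform x y.
Proof. by rewrite dot_embr. Qed.

Lemma hnorm_emb x : hnorm (emb x) = pnorm x.
Proof.
apply/eqP; rewrite -(eqrXn2 (ltn0Sn 1)) ?hnorm_ge0 ?pnorm_ge0//.
by rewrite -rdot_xx /rdot dot_emb pnorm_sqr.
Qed.

Lemma blin_dense_eq (K : hilbertType R) (S T : complH P -> K) M N :
  blin S M -> blin T N -> (forall x, S (emb x) = T (emb x)) -> S =1 T.
Proof.
move=> /blin_ge0 bS /blin_ge0 bT ST f.
apply/eqP; rewrite -subr_eq0; apply/eqP/hnorm_eq0/eqP.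
rewrite eq_le hnorm_ge0 andbT; apply: (@le_eps _ _ _ (`|M| + `|N|)).
  by rewrite addr_ge0.
move=> e e0; rewrite add0r; have [x hx] := emb_dense f e0.
have -> : S f - T f = S (f - emb x) - T (f - emb x).
  by rewrite (blinB bS) (blinB bT) ST opprB addrA subrK.
apply: le_trans (hnormB _ _) _; rewrite mulrDr mulrC (mulrC e).
apply: lerD; first by rewrite (le_trans (bS.2 _))// ler_wpM2l.
by rewrite (le_trans (bT.2 _))// ler_wpM2l.
Qed.

End Embedding.

Section Extension.
Context {P Q : prehilb R}.

(** Only [T'] carries a bound, because the extension of [T] acts on functionals by precomposition
    with [T'], and inherits the bound [M] from it. *)
Definition padj (T : P -> Q) (T' : Q -> P) (M : R) :=
  [/\ 0 <= M, forall p q, pform (T p) q = pform p (T' q)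
    & forall q, pnorm (T' q) <= M * pnorm q].

Variables (T : P -> Q) (T' : Q -> P) (M : R).
Hypothesis TT' : padj T T' M.

Lemma cext_subproof (f : complH P) :
  ((fun q => cval f (T' q)) : Q -> GRing.regular (complexF R)) \in @approximable R Q.
Proof.
case: TT' => M0 adjT bT; apply/asboolP => e e0.
have M1 : 0 < M + 1 by rewrite ltr_wpDl.
have [x hx] := cval_approx f (divr_gt0 e0 M1); exists (T x) => q.
rewrite adjT; apply: le_trans (hx _) _.
rewrite -mulrA (ler_wpM2l (ltW e0))// ler_pdivrMl//.
by apply: le_trans (bT q) _; rewrite ler_wpM2r ?pnorm_ge0// lerDl.
Qed.

(* The extension of [T] to the completions is dual to its formal adjoint. *)
Definition cext (f : complH P) : complH Q := Compl (cext_subproof f).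

Lemma cval_cext f q : cval (cext f) q = cval f (T' q). Proof. by []. Qed.

Lemma cext_emb p : cext (emb p) = emb (T p).
Proof.
by case: TT' => _ adjT _; apply: cval_ext => q; rewrite cval_cext !cval_emb adjT.
Qed.

Lemma blin_cext : blin cext M.
Proof.
case: TT' => M0 _ bT; split=> [a f g|f]; first exact: cval_ext.
apply: cnorm_le => [|q]; first by rewrite mulr_ge0 ?hnorm_ge0.
rewrite cval_cext; apply: le_trans (cval_le _ _) _.
rewrite (mulrC M) -mulrA; apply: ler_wpM2l; last exact: bT.
exact: (@pnorm_ge0 R (@compl_prehilb R P)).
Qed.

End Extension.

Lemma cext_adj (P Q : prehilb R) (T : P -> Q) (T' : Q -> P) M N
  (TT' : padj T T' M) (T'T : padj T' T N) (f : complH P) (g : complH Q) :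
  '[cext TT' f, g] = '[f, cext T'T g].
Proof.
have bT := blin_cext TT'; have [M0 _ _] := TT'.
rewrite (hadjP bT); congr ('[_, _]); move: g.
apply: blin_dense_eq (blin_hadj bT M0) (blin_cext T'T) _ => q.
apply: dot_ext => h; rewrite (hadjC bT) cext_emb [LHS]dotC [RHS]dotC.
by rewrite !dot_embr cval_cext.
Qed.

End CompletionMaps.

(** A Daniell-style integral without a measure. It has two instances: finite sums, which give
    Hilbert direct sums, and the Riesz extension, which gives the space of the dilation. Solidity of
    the domain puts inner products of square-integrable families into it. *)
Record posfun (R : realType) (Om : Type) := PosFun {
  pdom : set (Om -> R);
  pint : (Om -> R) -> R;
  pdom0 : pdom (fun=> 0);
  pdom_lin : forall a f g, pdom f -> pdom g -> pdom (fun w => a * f w + g w);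
  pdom_solid : forall f g, pdom f -> (forall w, `|g w| <= f w) -> pdom g;
  pint_lin : forall a f g, pdom f -> pdom g ->
    pint (fun w => a * f w + g w) = a * pint f + pint g;
  pint_ge0 : forall f, pdom f -> (forall w, 0 <= f w) -> 0 <= pint f }.

(** * Direct integrals of Hilbert spaces over a positive functional *)

Section L2.
Context {R : realType} {Om : Type} (mu : posfun R Om) (E : Om -> hilbertType R).

Lemma pdomD f g : pdom mu f -> pdom mu g -> pdom mu (fun w => f w + g w).
Proof.
move=> hf hg; have := pdom_lin 1 hf hg.
by congr pdom; apply/funext => w; rewrite mul1r.
Qed.

Lemma pdomZ a f : pdom mu f -> pdom mu (fun w => a * f w).
Proof.
move=> hf; have := pdom_lin a hf (pdom0 mu).
by congr pdom; apply/funext => w; rewrite addr0.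
Qed.

Lemma pint0 : pint mu (fun=> 0) = 0.
Proof.
have := pint_lin 1 (pdom0 mu) (pdom0 mu).
have -> : (fun=> 1 * 0 + 0) = (fun=> 0) :> (Om -> R).
  by apply/funext => w; rewrite mulr0 addr0.
by lra.
Qed.

Lemma pintZ a f : pdom mu f -> pint mu (fun w => a * f w) = a * pint mu f.
Proof.
move=> hf; have := pint_lin a hf (pdom0 mu); rewrite pint0 addr0 => <-.
by congr pint; apply/funext => w; rewrite addr0.
Qed.

Lemma pint_le f g : pdom mu f -> pdom mu g -> (forall w, f w <= g w) ->
  pint mu f <= pint mu g.
Proof.
move=> hf hg fg; have := pint_ge0 (pdom_lin (-1) hf hg).
rewrite pint_lin// mulN1r addrC subr_ge0; apply => w.
by rewrite mulN1r addrC subr_ge0.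
Qed.

Record l2 := L2 { l2f :> forall w, E w; l2P : pdom mu (fun w => hnorm (l2f w) ^+ 2) }.

Lemma l2_ext (F G : l2) : (forall w, F w = G w) -> F = G.
Proof.
case: F => f fP; case: G => g gP /= fg.
have {}fg : f = g by exact: functional_extensionality_dep.
by case: _ / fg gP => gP; rewrite (Prop_irrelevance fP gP).
Qed.

HB.instance Definition _ := gen_eqMixin l2.
HB.instance Definition _ := gen_choiceMixin l2.

Lemma l2_zero_subproof : pdom mu (fun w => hnorm (0 : E w) ^+ 2).
Proof.
have := pdom0 mu; congr pdom; apply/funext => w.
by rewrite hnorm0 expr0n.
Qed.
Definition l2_zero := L2 l2_zero_subproof.

Lemma l2_opp_subproof (F : l2) : pdom mu (fun w => hnorm (- F w) ^+ 2).
Proof.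
have := l2P F; congr pdom; apply/funext => w.
by rewrite hnormN.
Qed.
Definition l2_opp F := L2 (l2_opp_subproof F).

Lemma l2_add_subproof (F G : l2) : pdom mu (fun w => hnorm (F w + G w) ^+ 2).
Proof.
(* By the parallelogram law, [|F + G|^2 <= 2 |F|^2 + 2 |G|^2]. *)
apply: (pdom_solid (pdomZ 2 (pdomD (l2P F) (l2P G)))) => w /=.
rewrite ger0_norm ?sqr_ge0//; have := parallelogram (F w) (G w).
by have := sqr_ge0 (hnorm (F w - G w)); lra.
Qed.
Definition l2_add F G := L2 (l2_add_subproof F G).

Lemma l2_scale_subproof (a : R[i]) (F : l2) : pdom mu (fun w => hnorm (a *: F w) ^+ 2).
Proof.
have := pdomZ (cabs a ^+ 2) (l2P F); congr pdom; apply/funext => w.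
by rewrite hnormZ exprMn.
Qed.
Definition l2_scale a F := L2 (l2_scale_subproof a F).

Let addA : associative l2_add.
Proof. by move=> x y z; apply: l2_ext => w /=; rewrite addrA. Qed.
Let addC : commutative l2_add.
Proof. by move=> x y; apply: l2_ext => w /=; rewrite addrC. Qed.
Let add0 : left_id l2_zero l2_add.
Proof. by move=> x; apply: l2_ext => w /=; rewrite add0r. Qed.
Let addN : left_inverse l2_zero l2_opp l2_add.
Proof. by move=> x; apply: l2_ext => w /=; rewrite addNr. Qed.
HB.instance Definition _ := GRing.isZmodule.Build l2 addA addC add0 addN.

Let scaleA (a b : complexF R) v : l2_scale a (l2_scale b v) = l2_scale (a * b) v.
Proof. by apply: l2_ext => w /=; rewrite scalerA. Qed.
Let scale1 : left_id (1 : complexF R) l2_scale.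
Proof. by move=> x; apply: l2_ext => w /=; rewrite scale1r. Qed.
Let scaleDr : right_distributive l2_scale +%R.
Proof. by move=> a x y; apply: l2_ext => w /=; rewrite scalerDr. Qed.
Let scaleDl v : {morph (l2_scale^~ v : complexF R -> l2) : a b / a + b}.
Proof. by move=> a b; apply: l2_ext => w /=; rewrite scalerDl. Qed.
HB.instance Definition _ :=
  GRing.Zmodule_isLmodule.Build (complexF R) l2 scaleA scale1 scaleDr scaleDl.

Implicit Types F G : l2.
Lemma l2D F G w : (F + G) w = F w + G w. Proof. by []. Qed.
Lemma l2Z (a : complexF R) F w : (a *: F) w = a *: F w. Proof. by []. Qed.

Lemma pdom_dot F G (phi : R[i] -> R) : (forall z, `|phi z| <= cabs z) ->
  pdom mu (fun w => phi '[F w, G w]).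
Proof.
move=> phi_le; apply: (pdom_solid (pdomD (l2P F) (l2P G))) => w.
apply: le_trans (phi_le _) _; apply: le_trans (cauchy_schwarz _ _) _.
by have := sqr_ge0 (hnorm (F w) - hnorm (G w)); nra.
Qed.

Definition pint_dot (phi : R[i] -> R) F G : R := pint mu (fun w => phi '[F w, G w]).

Definition l2_form F G : R[i] :=
  Complex (pint_dot (@complex.Re R) F G) (pint_dot (@complex.Im R) F G).

Let pRe F G := pdom_dot F G (@Re_le_cabs R).
Let pIm F G := pdom_dot F G (@Im_le_cabs R).

Let l2_form_lin (a : R[i]) F G K :
  l2_form (a *: F + G) K = a * l2_form F K + l2_form G K.
Proof.
have comb (b c : R) (f g h : Om -> R) (e : Om -> R) :
    pdom mu f -> pdom mu g -> pdom mu h ->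
    (forall w, e w = b * f w + (c * g w + h w)) ->
    pint mu e = b * pint mu f + (c * pint mu g + pint mu h).
  move=> hf hg hh ee; rewrite -!pint_lin//; last exact: pdom_lin.
  by congr pint; apply/funext.
apply: complex_ext => /=.
  rewrite ReD cReM /= /pint_dot -addrA -mulNr.
  apply: comb => // w.
  by rewrite l2D l2Z dotDl dotZl ReD cReM; ring.
rewrite ImD cImM /= /pint_dot -addrA.
apply: comb => // w.
by rewrite l2D l2Z dotDl dotZl ImD cImM; ring.
Qed.

Let l2_form_herm F G : l2_form F G = (l2_form G F)^*%R.
Proof.
apply: complex_ext; rewrite ?cRe_conj ?cIm_conj /= /pint_dot.
  by congr pint; apply/funext => w; exact: rdotC.
rewrite -mulN1r -pintZ//; congr pint; apply/funext => w.
by rewrite Im_dotC mulN1r.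
Qed.

Let l2_form_ge0 F : 0 <= l2_form F F.
Proof.
apply/complex_ge0; split=> /=; rewrite /pint_dot.
  rewrite -[RHS]pint0; congr pint; apply/funext => w.
  by rewrite dot_xx.
apply: pint_ge0 => [|w]; first exact: pRe.
by rewrite dot_xx /= sqr_ge0.
Qed.

Definition l2pre : prehilb R := PreHilb l2_form_lin l2_form_herm l2_form_ge0.

Definition L2H : hilbertType R := complH l2pre.

Lemma l2pre_norm (F : l2pre) : pnorm F ^+ 2 = pint mu (fun w => hnorm (F w) ^+ 2).
Proof.
rewrite pnorm_sqr /= /pint_dot; congr pint; apply/funext => w.
by rewrite dot_xx.
Qed.

End L2.

(** * Hilbert direct sums from finitely supported families *)

Section FiniteSums.
Context {R : realType} {Om : choiceType}.

(** Finite supports give the algebraic direct sum; completing it gives the Hilbert sum, so no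
    infinite series is ever summed. *)
Definition fin_dom : set (Om -> R) := [set f | finite_set [set w | f w != 0]].
Definition fin_sum (f : Om -> R) : R := \sum_(w \in [set: Om]) f w.

Lemma fin_domP (f : Om -> R) : fin_dom f <->
  exists2 r : seq Om, uniq r & forall w, w \notin r -> f w = 0.
Proof.
split=> [ff|[r ur rf]].
  have /finite_seqP[r rE] := ff; exists (undup r) => [|w]; first exact: undup_uniq.
  rewrite mem_undup => wr; apply/eqP; apply: contraNT wr => fw.
  by have : [set w | f w != 0] w by []; rewrite rE.
apply: (@sub_finite_set _ _ [set` r]); last exact: finite_seq.
by move=> w /=; apply: contraR => /rf ->.
Qed.

Lemma fin_sumE (r : seq Om) f : uniq r -> (forall w, w \notin r -> f w = 0) ->
  fin_sum f = \sum_(w <- r) f w.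
Proof.
move=> ur rf; rewrite /fin_sum (fsbigE r)// => [|w _]; last exact: rf.
by apply: eq_bigl => w; rewrite in_setT.
Qed.

Let dom0 : fin_dom (fun=> 0).
Proof. by apply/fin_domP; exists [::]. Qed.

Lemma fin_dom2 f g : fin_dom f -> fin_dom g -> exists r, [/\ uniq r,
  forall w, w \notin r -> f w = 0 & forall w, w \notin r -> g w = 0].
Proof.
move=> /fin_domP[r ur rf] /fin_domP[s us sg].
exists (undup (r ++ s)); split=> [|w|w]; first exact: undup_uniq.
  by rewrite mem_undup mem_cat negb_or => /andP[/rf].
by rewrite mem_undup mem_cat negb_or => /andP[_ /sg].
Qed.

Let dom_lin a f g : fin_dom f -> fin_dom g -> fin_dom (fun w => a * f w + g w).
Proof.
move=> hf hg; have [r [ur rf rg]] := fin_dom2 hf hg.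
apply/fin_domP; exists r => // w wr.
by rewrite rf// rg// mulr0 addr0.
Qed.

Let dom_solid f g : fin_dom f -> (forall w, `|g w| <= f w) -> fin_dom g.
Proof.
move=> /fin_domP[r ur rf] fg; apply/fin_domP; exists r => // w wr.
by apply/eqP; rewrite -normr_le0 -(rf w wr).
Qed.

Let sum_lin a f g : fin_dom f -> fin_dom g ->
  fin_sum (fun w => a * f w + g w) = a * fin_sum f + fin_sum g.
Proof.
move=> hf hg; have [r [ur rf rg]] := fin_dom2 hf hg.
rewrite (fin_sumE ur rf) (fin_sumE ur rg) (fin_sumE ur) => [|w wr].
  by rewrite big_split /= mulr_sumr.
by rewrite rf// rg// mulr0 addr0.
Qed.

Let sum_ge0 f : fin_dom f -> (forall w, 0 <= f w) -> 0 <= fin_sum f.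
Proof.
move=> /fin_domP[r ur rf] f0; rewrite (fin_sumE ur rf).
by apply: sumr_ge0 => w _; exact: f0.
Qed.

Definition fin_posfun : posfun R Om :=
  PosFun dom0 dom_lin dom_solid sum_lin sum_ge0.

End FiniteSums.

(** * Maps of direct sums along an injection of index sets *)

Section PushForward.
Context {R : realType} {Om Om' : choiceType}.
Context {E : Om -> hilbertType R} {E' : Om' -> hilbertType R}.
Local Notation P := (l2pre (@fin_posfun R Om) E).
Local Notation P' := (l2pre (@fin_posfun R Om') E').

Variables (phi : Om -> Om') (M : R).
Variables (A : forall w, E w -> E' (phi w)) (A' : forall w, E' (phi w) -> E w).
(** Specified by [push_in] and [push_out] instead of defined, because a definition would transport
    vectors along an equality [phi w = w'] of indices. *)
Variable push : (forall w, E w) -> forall w', E' w'.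
Hypothesis phi_inj : injective phi.
Hypothesis M0 : 0 <= M.
Hypothesis AA' : forall w x y, '[A x, y] = '[x, A' y :> E w].
Hypothesis A_le : forall w (x : E w), hnorm (A x) <= M * hnorm x.
Hypothesis push_in : forall F w, push F (phi w) = A (F w).
Hypothesis push_out : forall F w', (forall w, phi w != w') -> push F w' = 0.

Let A0 w : A (0 : E w) = 0.
Proof.
apply: dot_ext => y.
by rewrite AA' !dot0l.
Qed.

Let A'0 w : A' (0 : E' (phi w)) = 0.
Proof. by apply: dot_ext => y; rewrite dotC -AA' dot0r dot0l conjC0. Qed.

Let supp (w0 : Om') (F : forall w, E w) r : (forall w, w \notin r -> F w = 0) ->
  forall w', w' \notin map phi r -> push F w' = 0.
Proof.
move=> rF w' w'r; have [[w ww']|nw] := pselect (exists w, phi w = w').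
  rewrite -ww' push_in rF ?A0//; apply: contra w'r => wr.
  by rewrite -ww' map_f.
by apply: push_out => w; apply/eqP => ww'; apply: nw; exists w.
Qed.

Let hsq0 (H : hilbertType R) (x : H) : (hnorm x ^+ 2 == 0) = (x == 0).
Proof.
rewrite sqrf_eq0; apply/eqP/eqP => [/hnorm_eq0//|->]; exact: hnorm0.
Qed.

Let l2_supp (T : choiceType) (G : T -> hilbertType R) (F : l2 (@fin_posfun R T) G) :
  exists2 r : seq T, uniq r & forall w, w \notin r -> F w = 0.
Proof.
have /fin_domP[r ur rF] := l2P F; exists r => // w /rF/eqP.
by rewrite hsq0 => /eqP.
Qed.

Let push_subproof (F : P) : pdom (@fin_posfun R Om') (fun w' => hnorm (push F w') ^+ 2).
Proof.
have [r ur rF] := l2_supp F; apply/fin_domP; exists (map phi r).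
  by rewrite map_inj_uniq.
by move=> w' w'r; apply/eqP; rewrite hsq0 (supp _ rF).
Qed.

Definition l2push (F : P) : P' := L2 (push_subproof F).

Let pull_subproof (G : P') :
  pdom (@fin_posfun R Om) (fun w => hnorm (A' (G (phi w))) ^+ 2).
Proof.
have := l2P G; rewrite /= /fin_dom /= => fG.
apply: (@sub_finite_set _ _ (phi @^-1` [set w' | hnorm (G w') ^+ 2 != 0])).
  by move=> w /=; apply: contra; rewrite !hsq0 => /eqP ->; rewrite A'0.
by apply: finite_preimage fG => w1 w2 _ _; exact: phi_inj.
Qed.

Definition l2pull (G : P') : P := L2 (pull_subproof G).

Let sum_push (F : P) (h : Om' -> R) (k : Om -> R) :
  (forall w', push F w' = 0 -> h w' = 0) -> (forall w, F w = 0 -> k w = 0) ->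
  (forall w, h (phi w) = k w) -> fin_sum h = fin_sum k.
Proof.
move=> h0 k0 hk; have [r ur rF] := l2_supp F.
rewrite (@fin_sumE _ _ (map phi r)) ?map_inj_uniq//; last first.
  by move=> w' w'r; apply: h0; rewrite (supp _ rF).
rewrite (@fin_sumE _ _ r)// => [|w wr]; last by rewrite k0// rF.
by rewrite big_map; apply: eq_bigr => w _.
Qed.

Let l2push_form F G : pform (l2push F) G = pform F (l2pull G).
Proof.
apply: complex_ext => /=; rewrite /pint_dot /=; apply: (@sum_push F).
- by move=> w' ->; rewrite dot0l.
- by move=> w ->; rewrite dot0l.
- by move=> w; rewrite push_in AA'.
- by move=> w' ->; rewrite dot0l.
- by move=> w ->; rewrite dot0l.
- by move=> w; rewrite push_in AA'.
Qed.

Let l2push_norm F : pnorm (l2push F) <= M * pnorm F.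
Proof.
apply: ler_of_sqr; first by rewrite mulr_ge0 ?pnorm_ge0.
rewrite exprMn !l2pre_norm /=.
rewrite (@sum_push F _ (fun w => hnorm (A (F w)) ^+ 2)) => [|w' ->|w ->|w].
- rewrite -(pintZ _ (l2P F)); have := l2P F => hF.
  apply: (@pint_le _ _ (@fin_posfun R Om)) => [||w].
  + apply: (pdom_solid (pdomZ (M ^+ 2) hF)) => w.
    by rewrite ger0_norm ?sqr_ge0// -exprMn ler_pXn2r ?nnegrE ?mulr_ge0 ?hnorm_ge0.
  + exact: pdomZ.
  + by rewrite -exprMn ler_pXn2r ?nnegrE ?mulr_ge0 ?hnorm_ge0.
- by rewrite hnorm0 expr0n.
- by rewrite A0 hnorm0 expr0n.
- by rewrite push_in.
Qed.

Lemma padj_push : padj l2pull l2push M.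
Proof.
split=> // p q.
by rewrite pform_herm -l2push_form -pform_herm.
Qed.

(** With [T] for the push and [T'] for the pull, the bound on [T'] comes from
    [|T' q|^2 = <T T' q, q> <= M |T' q| |q|]. *)
Lemma padj_pull : padj l2push l2pull M.
Proof.
split=> // q.
have h : pnorm (l2pull q) ^+ 2 <= M * pnorm (l2pull q) * pnorm q.
  rewrite pnorm_sqr -l2push_form; apply: le_trans (Re_pform_le _ _) _.
  by rewrite ler_wpM2r ?pnorm_ge0// l2push_norm.
have := pnorm_ge0 (l2pull q); move: h; rewrite expr2 mulrAC.
have [->|n0] := eqVneq (pnorm (l2pull q)) 0.
  by rewrite mulr_ge0 ?pnorm_ge0.
by move=> + n1; rewrite ler_pM2r// lt_neqAle eq_sym n0.
Qed.

End PushForward.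

Section Pointwise.
Context {R : realType} {Om : Type} (mu : posfun R Om).
Context {E E' : Om -> hilbertType R}.
Variables (A : forall w, E w -> E' w) (A' : forall w, E' w -> E w) (M N : R).
Hypothesis AA' : forall w x y, '[A x, y] = '[x, A' y :> E w].
Hypotheses (M0 : 0 <= M) (N0 : 0 <= N).
Hypothesis A_le : forall w (x : E w), hnorm (A x) <= M * hnorm x.
Hypothesis A'_le : forall w (x : E' w), hnorm (A' x) <= N * hnorm x.

Let pw_subproof (G G' : Om -> hilbertType R) (B : forall w, G w -> G' w) c (F : l2 mu G) :
  0 <= c -> (forall w (x : G w), hnorm (B w x) <= c * hnorm x) ->
  pdom mu (fun w => hnorm (B w (F w)) ^+ 2).
Proof.
move=> c0 Bc; apply: (pdom_solid (pdomZ (c ^+ 2) (l2P F))) => w.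
by rewrite ger0_norm ?sqr_ge0// -exprMn ler_pXn2r ?nnegrE ?mulr_ge0 ?hnorm_ge0.
Qed.

Definition l2map (F : l2pre mu E) : l2pre mu E' := L2 (pw_subproof F M0 A_le).
Definition l2map' (F : l2pre mu E') : l2pre mu E := L2 (pw_subproof F N0 A'_le).

Lemma padj_l2map : padj l2map l2map' N.
Proof.
split=> // [F G|F].
  apply: complex_ext => /=; rewrite /pint_dot; congr pint; apply/funext => w /=;
  by rewrite AA'.
apply: ler_of_sqr; first by rewrite mulr_ge0 ?pnorm_ge0.
rewrite exprMn !l2pre_norm /= -(pintZ _ (l2P F)).
apply: pint_le => [||w].
- exact: (pw_subproof F N0 A'_le).
- exact: pdomZ (l2P F).
- by rewrite -exprMn ler_pXn2r ?nnegrE ?mulr_ge0 ?hnorm_ge0.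
Qed.

End Pointwise.

(** * M. Riesz extension of positive functionals *)

Section PositiveExtension.
Context {R : realType} {X : Type}.
Local Notation graph := (set ((X -> R) * R)).

(** A positive functional on a subspace, given by its graph. Single-valuedness follows from
    positivity, and extension becomes inclusion, which suits Zorn's lemma. *)
Definition pos_graph (A : graph) :=
  [/\ A (fun=> 0, 0),
      forall a f g c d, A (f, c) -> A (g, d) ->
        A (fun w => a * f w + g w, a * c + d)
    & forall f c, A (f, c) -> (forall w, 0 <= f w) -> 0 <= c].

Lemma pos_graph_mono A f g c d : pos_graph A -> A (f, c) -> A (g, d) ->
  (forall w, f w <= g w) -> c <= d.
Proof.
move=> [A0 Al Ap] fc gd fg; rewrite -subr_ge0.
have -> : d - c = -1 * c + d by rewrite mulN1r addrC.
by apply: Ap (Al (-1) _ _ _ _ fc gd) _ => w; rewrite mulN1r addrC subr_ge0.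
Qed.

Lemma pos_graph_uniq A f c d : pos_graph A -> A (f, c) -> A (f, d) -> c = d.
Proof.
move=> gA fc fd; apply/eqP; rewrite eq_le.
by rewrite (pos_graph_mono gA fc fd)// (pos_graph_mono gA fd fc).
Qed.

Variable F : graph.
Hypothesis gF : pos_graph F.

Definition dominated : set (X -> R) :=
  [set f | exists g c, F (g, c) /\ forall w, `|f w| <= g w].

Lemma dominated0 : dominated (fun=> 0).
Proof.
have [F0 _ _] := gF.
by exists (fun=> 0), 0; split=> // w; rewrite normr0.
Qed.

Lemma dominated_lin a f g : dominated f -> dominated g ->
  dominated (fun w => a * f w + g w).
Proof.
have [_ Fl _] := gF; move=> [f' [c [Ff' ff']]] [g' [d [Fg' gg']]].
exists (fun w => `|a| * f' w + g' w), (`|a| * c + d); split; first exact: Fl.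
move=> w; rewrite (le_trans (ler_normD _ _))// lerD// normrM.
by rewrite ler_wpM2l.
Qed.

(** Extension by one dimension: [f] receives the largest value [c0] that its minorants in the graph
    force upon it. *)
Let step A f : pos_graph A -> F `<=` A -> dominated f ->
  (forall c, ~ A (f, c)) -> exists B, pos_graph B /\ A `<` B.
Proof.
move=> gA FA [g [c [Fg fg]]] nA; have [A0 Al Ap] := gA.
pose Lo := [set d | exists2 h, A (h, d) & forall w, h w <= f w].
(* The dominating [g] serves twice: [- g <= f] makes [Lo] nonempty, and [f <= g] bounds it above. *)
have Ln : Lo (-1 * c + 0).
  exists (fun w => -1 * g w + 0); first by apply: Al => //; exact: FA.
  by move=> w; rewrite mulN1r addr0; have := fg w; rewrite ler_norml => /andP[].
have Lu : has_ubound Lo.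
  exists c => d [h hd hf]; apply: pos_graph_mono gA hd (FA _ Fg) _ => w.
  by rewrite (le_trans (hf w))// (le_trans (ler_norm _)).
pose c0 := sup Lo.
have c0_ge h d : A (h, d) -> (forall w, h w <= f w) -> d <= c0.
  by move=> hd hf; apply: ub_le_sup => //; exists h.
have c0_le h d : A (h, d) -> (forall w, f w <= h w) -> c0 <= d.
  move=> hd hf; apply: ge_sup; first by exists (-1 * c + 0).
  move=> d' [h' hd' hf']; apply: pos_graph_mono gA hd' hd _ => w.
  exact: le_trans (hf' w) (hf w).
pose B : graph := [set p | exists h d t, A (h, d) /\
  p = (fun w => h w + t * f w, d + t * c0)].
exists B; split; last split.
- split.
  + exists (fun=> 0), 0, 0; split=> //; congr pair.
      by apply/funext => w; rewrite mul0r addr0.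
    by rewrite mul0r addr0.
  + move=> a _ _ _ _ [h [d [t [hd [-> ->]]]]] [h' [d' [t' [hd' [-> ->]]]]].
    exists (fun w => a * h w + h' w), (a * d + d'), (a * t + t'); split.
      exact: Al.
    by congr pair; [apply/funext => w|]; ring.
  + move=> _ _ [h [d [t [hd [-> ->]]]]] pos.
    have hs a : A (fun w => a * h w + 0, a * d + 0) by exact: Al.
    (* Divided by [t], the inequality [h + t f >= 0] compares [f] with [- h / t], from below when
       [t > 0] and from above when [t < 0]. *)
    have [t0|t0|t0] := ltgtP t 0.
    * have : c0 <= - t^-1 * d + 0.
        apply: c0_le (hs _) _ => w; have := pos w.
        rewrite addr0 mulNr -mulrN ler_ndivlMl//; lra.
      rewrite addr0 mulNr -mulrN ler_ndivlMl//; lra.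
    * have : - t^-1 * d + 0 <= c0.
        apply: c0_ge (hs _) _ => w; have := pos w.
        rewrite addr0 mulNr -mulrN ler_pdivrMl//; lra.
      rewrite addr0 mulNr -mulrN ler_pdivrMl//; lra.
    * rewrite t0 mul0r addr0; apply: Ap hd _ => w.
      by have := pos w; rewrite t0 mul0r addr0.
- move=> [h d] hd; exists h, d, 0; split=> //.
  by congr pair; [apply/funext => w|]; rewrite mul0r addr0.
- move=> BA; apply: (nA c0); apply: BA; exists (fun=> 0), 0, 1; split=> //.
  by congr pair; [apply/funext => w|]; rewrite mul1r add0r.
Qed.

Let maximal_graph : exists A, [/\ pos_graph A, F `<=` A &
  forall f, dominated f -> exists c, A (f, c)].
Proof.
pose Q : set graph := [set A | A = set0 \/ (pos_graph A /\ F `<=` A)].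
have chain (C : set graph) : C `<=` Q -> total_on C subset ->
    Q (\bigcup_(A in C) A).
  move=> CQ tC; have [[A CA An]|none] := pselect (exists2 A, C A & A !=set0); last first.
    left; apply/seteqP; split=> // p [A CA Ap]; apply: none; exists A => //.
    by exists p.
  have good B : C B -> B !=set0 -> pos_graph B /\ F `<=` B.
    by move=> /CQ [->|//] [].
  right; split; last by move=> p Fp; exists A => //; apply: (good A CA An).2.
  have common p q B1 B2 : C B1 -> C B2 -> B1 p -> B2 q ->
      exists B, [/\ C B, pos_graph B, B p & B q].
    move=> C1 C2 B1p B2q; have [B12|B21] := tC _ _ C1 C2.
      by exists B2; split=> //; [apply: (good B2 C2 _).1; exists q|exact: B12].
    by exists B1; split=> //; [apply: (good B1 C1 _).1; exists p|exact: B21].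
  split.
  - by exists A => //; have [[]] := good A CA An.
  - move=> a f g c d [B1 C1 fc] [B2 C2 gd].
    have [B [CB [_ Bl _] Bf Bg]] := common _ _ _ _ C1 C2 fc gd.
    by exists B => //; exact: Bl.
  - move=> f c [B CB fc]; have [|[_ _ Bp] _] := good B CB; first by exists (f, c).
    exact: Bp fc.
have [A [QA Amax]] := Zorn_bigcup chain.
have [gA FA] : pos_graph A /\ F `<=` A.
  case: QA => // A0; exfalso; apply: (Amax F); last by right; split.
  by rewrite A0; split=> // F0; have [/F0] := gF.
exists A; split=> // f df; apply: contrapT => nA.
have [|B [gB AB]] := step gA FA df; first by move=> c fc; apply: nA; exists c.
by apply: (Amax B AB); right; split=> //; exact: subset_trans (properW AB).
Qed.

Lemma riesz_extension : exists mu : posfun R X, pdom mu = dominated /\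
  forall f c, F (f, c) -> pint mu f = c.
Proof.
have [A [gA FA tot]] := maximal_graph; have [A0 Al Ap] := gA.
have [F0 Fl Fp] := gF.
pose I f := xget 0 [set c | A (f, c)].
have IP f : dominated f -> A (f, I f).
  by move=> /tot[c fc]; rewrite /I; case: xgetP => [d -> //|/(_ c)].
have IE f c : A (f, c) -> I f = c.
  move=> fc; rewrite /I; case: xgetP => [d -> /= fd|/(_ c)//].
  exact: pos_graph_uniq gA fd fc.
have ds f g : dominated f -> (forall w, `|g w| <= f w) -> dominated g.
  move=> [f' [c [Ff' ff']]] gf; exists f', c; split=> // w.
  by rewrite (le_trans (gf w))// (le_trans (ler_norm _)).
have il a f g : dominated f -> dominated g ->
    I (fun w => a * f w + g w) = a * I f + I g.
  by move=> /IP hf /IP hg; apply: IE; exact: Al.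
have ip f : dominated f -> (forall w, 0 <= f w) -> 0 <= I f.
  by move=> /IP; exact: Ap.
exists (PosFun dominated0 dominated_lin ds il ip); split=> // f c /FA; exact: IE.
Qed.

End PositiveExtension.

Lemma twice_inj {R : realType} {H : hilbertType R} (x y : 'B(H)) :
  x + x = y + y -> x = y.
Proof.
move=> /eqP; rewrite -subr_eq0 opprD addrACA -mulr2n -scaler_nat scaler_eq0.
by rewrite pnatr_eq0 /= subr_eq0 => /eqP.
Qed.

Definition operator_system {R : realType} {H : hilbertType R} (S : set 'B(H)) :=
  [/\ S 1, forall (a : R[i]) T U, S T -> S U -> S (a *: T + U)
    & forall T, S T -> S (adj T)].

Definition unital_rep {R : realType} {H K : hilbertType R} (f : 'B(H) -> 'B(K)) :=
  star_hom setT f /\ f 1 = 1.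

(** * Completely positive maps *)

Section LinearOn.
Context {R : realType} {H K : hilbertType R}.
Variables (S : set 'B(H)) (f : 'B(H) -> 'B(K)).
Hypotheses (S0 : operator_system S) (lf : linear_on S f).

Lemma opsys0 : S 0.
Proof. by case: S0 => S1 Sl _; have := Sl (-1) 1 1 S1 S1; rewrite scaleN1r addNr. Qed.

Lemma opsysD T U : S T -> S U -> S (T + U).
Proof. by case: S0 => _ Sl _ ST SU; have := Sl 1 T U ST SU; rewrite scale1r. Qed.

Lemma opsysZ (a : R[i]) T : S T -> S (a *: T).
Proof. by case: S0 => _ Sl _ ST; have := Sl a T 0 ST opsys0; rewrite addr0. Qed.

Lemma opsysB T U : S T -> S U -> S (T - U).
Proof. by move=> ST SU; rewrite -scaleN1r addrC; case: S0 => _ Sl _; exact: Sl. Qed.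

Lemma opsys_sum I (s : seq I) (P : pred I) (T : I -> 'B(H)) :
  (forall i, S (T i)) -> S (\sum_(i <- s | P i) T i).
Proof. by move=> ST; apply: big_ind => //; [exact: opsys0|exact: opsysD]. Qed.

Lemma linear_on0 : f 0 = 0.
Proof. by have := lf (-1) opsys0 opsys0; rewrite !scaleN1r !addNr. Qed.

Lemma linear_onD T U : S T -> S U -> f (T + U) = f T + f U.
Proof. by move=> ST SU; have := lf 1 ST SU; rewrite !scale1r. Qed.

Lemma linear_onZ (a : R[i]) T : S T -> f (a *: T) = a *: f T.
Proof. by move=> ST; have := lf a ST opsys0; rewrite !addr0 linear_on0 addr0. Qed.

Lemma linear_onB T U : S T -> S U -> f (T - U) = f T - f U.
Proof. by move=> ST SU; rewrite addrC -scaleN1r lf// scaleN1r addrC. Qed.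

Lemma linear_on_sum I (s : seq I) (P : pred I) (T : I -> 'B(H)) :
  (forall i, S (T i)) -> f (\sum_(i <- s | P i) T i) = \sum_(i <- s | P i) f (T i).
Proof.
move=> ST; elim: s => [|i s IH]; first by rewrite !big_nil linear_on0.
rewrite !big_cons; case: (P i) => //.
by rewrite linear_onD ?IH//; exact: opsys_sum.
Qed.

End LinearOn.

Section Ucp.
Context {R : realType} {H K : hilbertType R}.
Variables (S : set 'B(H)) (Phi : 'B(H) -> 'B(K)).
Hypotheses (S0 : operator_system S) (uPhi : ucp S Phi).

Let lPhi : linear_on S Phi. Proof. by case: uPhi. Qed.
Let SZ := opsysZ S0.
Let SD := opsysD S0.
Let SB := opsysB S0.

Lemma ucp_bpos T : S T -> bpos T -> bpos (Phi T).
Proof.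
move=> ST T0 x; case: uPhi => _ _ /(_ 1%N (\matrix_(i, j) T)) h.
have := h _ _ (fun=> x); rewrite !big_ord1 !mxE; apply.
  by move=> i j; rewrite mxE.
by move=> y; rewrite !big_ord1 mxE; exact: T0.
Qed.

(** [|T| 1 - T] is positive, so its image is positive and in particular self-adjoint. *)
Let ucp_herm T : S T -> adj T = T -> adj (Phi T) = Phi T.
Proof.
move=> ST aT; pose N : R[i] := (opnorm T)%:C.
have S1 : S 1 by case: S0.
have SN : S (N *: (1 : 'B(H)) - T) by apply: SB => //; exact: SZ.
have pN : bpos (N *: (1 : 'B(H)) - T).
  apply: bpos_rdot => [|x]; first by rewrite adjB adjZ adj1 aT conjCR.
  rewrite bopB bopZ bop1 rdotDl rdotNl rdot_ZRl rdot_xx subr_ge0.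
  apply: le_trans (rdot_le _ _) _; rewrite expr2 mulrA ler_wpM2r ?hnorm_ge0//.
  exact: bop_le.
have := bpos_adj (ucp_bpos SN pN).
have -> : Phi (N *: (1 : 'B(H)) - T) = N *: (1 : 'B(K)) - Phi T.
  rewrite (linear_onB lPhi)//; last exact: SZ.
  by rewrite (linear_onZ S0 lPhi)//; case: uPhi => _ ->.
rewrite adjB adjZ adj1 conjCR => /addrI/(congr1 -%R).
by rewrite !opprK.
Qed.

(** Apply [ucp_herm] to the sum of [T] and [adj T] and to [i] times their difference, both
    self-adjoint, and solve. *)
Lemma ucp_adj T : S T -> Phi (adj T) = adj (Phi T).
Proof.
move=> ST; have Sa : S (adj T) by case: S0 => _ _; apply.
have h1 : adj (Phi (T + adj T)) = Phi (T + adj T).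
  by apply: ucp_herm; [exact: SD|rewrite adjD adjK addrC].
have ci : ('i%C : R[i])^*%R = - 'i%C.
  by apply/eqP; rewrite eq_complex /= oppr0 !eqxx.
have h2 : adj (Phi ('i%C *: (T - adj T))) = Phi ('i%C *: (T - adj T)).
  apply: ucp_herm; first exact/SZ/SB.
  by rewrite adjZ ci adjB adjK scaleNr -scalerN opprB.
move: h2; rewrite (linear_onZ S0 lPhi) ?(linear_onB lPhi)//; last exact: SB.
rewrite adjZ ci adjB scaleNr -scalerN opprB => h2.
have {}h2 : adj (Phi (adj T)) - adj (Phi T) = Phi T - Phi (adj T).
  have i0 : ('i%C : R[i]) != 0 by rewrite eq_complex /= oner_eq0 andbF.
  by rewrite -[LHS]scale1r -[RHS]scale1r -(mulVf i0) -!scalerA h2.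
move: h1; rewrite (linear_onD lPhi)// adjD => h1.
symmetry; move: h1 h2.
move: (Phi T) (Phi (adj T)) (adj (Phi T)) (adj (Phi (adj T))) => a b a' b' h1 h2.
have e : a' + a' = b + b; last exact: twice_inj.
have -> : a' + a' = (a' + b') - (b' - a') by rewrite opprB addrACA subrr addr0.
by rewrite h1 h2 opprB (addrC a) addrACA subrr addr0.
Qed.

End Ucp.

Section MatrixPositivity.
Context {R : realType}.

Lemma rdot_suml (K : hilbertType R) I (s : seq I) (P : pred I) (F : I -> K) y :
  rdot (\sum_(i <- s | P i) F i) y = \sum_(i <- s | P i) rdot (F i) y.
Proof. by rewrite /rdot dot_suml Re_sum. Qed.

Lemma Im_sum I (s : seq I) (P : pred I) (F : I -> R[i]) :
  complex.Im (\sum_(i <- s | P i) F i) = \sum_(i <- s | P i) complex.Im (F i).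
Proof. by apply: (big_morph _ ImD). Qed.

Lemma hermitian_matrix_form (K : hilbertType R) n (T : 'I_n -> 'I_n -> 'B(K))
    (h : 'I_n -> K) :
  \sum_i '[\sum_j (T i j + adj (T j i)) (h j), h i] =
  (2 * \sum_i \sum_j rdot (T i j (h j)) (h i))%:C.
Proof.
have -> : \sum_i '[\sum_j (T i j + adj (T j i)) (h j), h i] =
    \sum_i \sum_j ('[T i j (h j), h i] + '[h j, T j i (h i)]).
  apply: eq_bigr => i _; rewrite dot_suml; apply: eq_bigr => j _.
  by rewrite bopD dotDl adjPl.
apply: complex_ext.
  rewrite Re_sum /=; under eq_bigr => i _ do rewrite Re_sum.
  under eq_bigr => i _ do under eq_bigr => j _ do
    rewrite ReD -/(rdot _ _) -/(rdot _ _) (rdotC (h j)).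
  under eq_bigr => i _ do rewrite big_split /=.
  by rewrite big_split /= [X in _ + X]exchange_big /= mulr_natl mulr2n.
rewrite Im_sum /=; under eq_bigr => i _ do rewrite Im_sum.
under eq_bigr => i _ do under eq_bigr => j _ do rewrite ImD (Im_dotC (h j)).
under eq_bigr => i _ do rewrite big_split /=.
rewrite big_split /= [X in _ + X]exchange_big /= -big_split /=.
apply: big1 => i _; rewrite -big_split /=; apply: big1 => j _.
by rewrite subrr.
Qed.

(** [mx_positive] demands real values of the form, whereas only real parts are known to be
    nonnegative. Adding to [T] its adjoint matrix makes the form real and doubles its real part. *)
Lemma ucp_rdot (H K : hilbertType R) (S : set 'B(H)) (Phi : 'B(H) -> 'B(K)) n
    (T : 'M['B(H)]_n) (x : 'I_n -> K) :
  operator_system S -> ucp S Phi -> (forall i j, S (T i j)) ->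
  (forall h, 0 <= \sum_i \sum_j rdot (T i j (h j)) (h i)) ->
  0 <= \sum_i \sum_j rdot (Phi (T i j) (x j)) (x i).
Proof.
move=> S0 uPhi ST T0; have [lPhi _ cp] := uPhi.
have Sa U : S U -> S (adj U) by case: S0 => _ _; apply.
pose T' : 'M['B(H)]_n := \matrix_(i, j) (T i j + adj (T j i)).
have ST' i j : S (T' i j).
  by rewrite mxE; apply: (opsysD S0) => //; exact: Sa.
have T'0 : mx_positive T'.
  move=> h; under eq_bigr => i _ do under eq_bigr => j _ do rewrite mxE.
  by rewrite (hermitian_matrix_form (fun i j => T i j)) lecR mulr_ge0.
have PhiT' i j : Phi (T' i j) = Phi (T i j) + adj (Phi (T j i)).
  rewrite mxE -(ucp_adj S0 uPhi)//; apply: (linear_onD lPhi) => //; exact: Sa.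
have := cp n T' ST' T'0 x; under eq_bigr => i _ do under eq_bigr => j _ do
  rewrite mxE PhiT'.
rewrite (hermitian_matrix_form (fun i j => Phi (T i j)) x).
by rewrite lecR pmulr_rge0.
Qed.

End MatrixPositivity.

(** * Isometries and block operators *)

Section BoundedMaps.
Context {R : realType}.

Definition isblin (H K : hilbertType R) (T : H -> K) := exists2 M, 0 <= M & blin T M.

Lemma isblin_bop (H : hilbertType R) (T : 'B(H)) : isblin T.
Proof. by exists (opnorm T); [exact: opnorm_ge0|exact: bop_blin]. Qed.

Lemma isblin_comp (H K L : hilbertType R) (S : K -> L) (T : H -> K) :
  isblin S -> isblin T -> isblin (S \o T).
Proof.
by move=> [N N0 bS] [M M0 bT]; exists (N * M); [exact: mulr_ge0|exact: blin_comp].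
Qed.

Lemma isblin_hadj (H K : hilbertType R) (T : H -> K) : isblin T -> isblin (hadj T).
Proof. by move=> [M M0 bT]; exists M => //; exact: blin_hadj. Qed.

Lemma isblinD (H K : hilbertType R) (S T : H -> K) :
  isblin S -> isblin T -> isblin (fun x => S x + T x).
Proof.
move=> [N N0 bS] [M M0 bT]; exists (N + M); first exact: addr_ge0.
split=> [a x y|x]; first by rewrite bS.1 bT.1 scalerDr addrACA.
by rewrite (le_trans (hnormD _ _))// mulrDl lerD// ?bS.2 ?bT.2.
Qed.

Lemma isblinN (H K : hilbertType R) (T : H -> K) :
  isblin T -> isblin (fun x => - T x).
Proof.
move=> [M M0 bT]; exists M => //; split=> [a x y|x].
  by rewrite bT.1 opprD scalerN.
by rewrite hnormN bT.2.
Qed.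

Lemma isblin_sum (H K : hilbertType R) (J : Type) (s : seq J) (T : J -> H -> K) :
  (forall i, isblin (T i)) -> isblin (fun x => \sum_(i <- s) T i x).
Proof.
move=> bT; elim: s => [|i s IH].
  exists 0 => //; split=> [a x y|x]; rewrite !big_nil ?scaler0 ?addr0//.
  by rewrite hnorm0 mul0r.
have [M M0 bM] := isblinD (bT i) IH; exists M => //.
have e x : \sum_(j <- i :: s) T j x = T i x + \sum_(j <- s) T j x by rewrite big_cons.
by split=> [a x y|x]; rewrite !e; [exact: bM.1|exact: bM.2].
Qed.

Lemma isblin_mkbop (H : hilbertType R) (T : H -> H) : isblin T ->
  exists B : 'B(H), forall x, B x = T x.
Proof. by move=> [M _ bT]; exists (mkbop bT). Qed.

Definition isometric (H K : hilbertType R) (J : H -> K) :=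
  forall x y, '[J x, J y] = '[x, y].

Section Isometric.
Context {H K : hilbertType R} {J : H -> K}.
Hypothesis isoJ : isometric J.

Lemma isometric_hnorm x : hnorm (J x) = hnorm x.
Proof.
by apply/eqP; rewrite -(eqrXn2 (ltn0Sn 1)) ?hnorm_ge0// -!rdot_xx /rdot isoJ.
Qed.

(** Linearity is automatic: the squared norm of [J (a x + y) - a J x - J y] expands into inner
    products, which [J] preserves, and these cancel. *)
Lemma isometric_blin : blin J 1.
Proof.
split=> [a x y|x]; last by rewrite isometric_hnorm mul1r.
apply/eqP; rewrite -subr_eq0; apply/eqP/hnorm_eq0/eqP.
rewrite -sqrf_eq0 -rdot_xx /rdot.
rewrite !(dotBl, dotBr, dotDl, dotDr, dotZl, dotZr, isoJ).
apply/eqP; rewrite -[RHS]/(complex.Re (0 : R[i])); congr complex.Re; ring.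
Qed.

Lemma isometricP : isblin J. Proof. by exists 1 => //; exact: isometric_blin. Qed.

Lemma hadjJ x : hadj J (J x) = x.
Proof. by apply: dot_ext => y; rewrite (hadjC isometric_blin) isoJ. Qed.

Lemma hadjJ_blin : blin (hadj J) 1.
Proof. exact: blin_hadj isometric_blin ler01. Qed.

Lemma hadjJ_le y : hnorm (hadj J y) <= hnorm y.
Proof. by have := hadjJ_blin.2 y; rewrite mul1r. Qed.

End Isometric.
End BoundedMaps.

Section PowerSpaceExists.
Context {R : realType} (H : hilbertType R) (n : nat).
Let mu := @fin_posfun R 'I_n.
Let E (i : 'I_n) := H.
Let P := l2pre mu E.

Let fin_dom_ord (f : 'I_n -> R) : fin_dom f.
Proof.
apply/fin_domP; exists (enum 'I_n) => [|w]; first exact: enum_uniq.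
by rewrite mem_enum.
Qed.

Let fin_sum_ord (f : 'I_n -> R) : fin_sum f = \sum_i f i.
Proof.
rewrite (@fin_sumE _ _ (enum 'I_n)) ?enum_uniq ?big_enum// => w.
by rewrite mem_enum.
Qed.

Let mk (F : 'I_n -> H) : P := @L2 _ _ mu E F (fin_dom_ord _).

Let mk_form F G : pform (mk F) (mk G) = \sum_i '[F i, G i].
Proof.
by apply: complex_ext; rewrite /= /pint_dot /= fin_sum_ord ?Re_sum ?Im_sum.
Qed.

(** The power [H^n], presented by its coordinate isometries, so that operator matrices depend on
    their relations alone. *)
Lemma power_space : exists (K : hilbertType R) (I : 'I_n -> H -> K),
  (forall i j x y, '[I i x, I j y] = if i == j then '[x, y] else 0) /\
  (forall f : K, f = \sum_i I i (hadj (I i) f)).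
Proof.
pose I (i : 'I_n) (x : H) : complH P := emb (mk (fun j => if j == i then x else 0)).
have IE i x G : '[I i x, emb (mk G)] = '[x, G i].
  rewrite dot_emb mk_form (bigD1 i)//= eqxx big1 ?addr0// => j /negPf ->.
  by rewrite dot0l.
have II i j x y : '[I i x, I j y] = if i == j then '[x, y] else 0.
  by rewrite IE; case: ifP => //; rewrite dot0r.
exists (complH P), I; split=> // f.
have iso i : isometric (I i) by move=> x y; rewrite II eqxx.
have [M _ bM] : isblin (fun f => \sum_i I i (hadj (I i) f)).
  by apply: isblin_sum => i; apply: isblin_comp; [|apply: isblin_hadj]; exact: isometricP.
apply: (blin_dense_eq (@blin_id _ (complH P)) bM) => G.
have hE i : hadj (I i) (emb G) = G i.
  apply: dot_ext => x; rewrite (hadjC (isometric_blin (iso i))) dotC.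
  have {1}-> : G = mk (fun j => G j) by exact: l2_ext.
  by rewrite IE -dotC.
under eq_bigr => i _ do rewrite hE.
have embD x y : emb (x + y : P) = emb x + emb y.
  by have := emb_lin 1 x y; rewrite !scale1r.
have emb0 : emb (0 : P) = 0.
  by apply: (@addrI _ (emb (0 : P))); rewrite -embD !addr0.
rewrite /I -(big_morph _ embD emb0); congr emb; apply: l2_ext => k.
have evD x y : (x + y : P) k = (x : P) k + (y : P) k by [].
rewrite (big_morph (fun x : P => x k) evD (erefl _)) (bigD1 k)//= eqxx big1 ?addr0//.
by move=> j /negPf jk; rewrite eq_sym jk.
Qed.

End PowerSpaceExists.

(** * Operators on a power of [H] as matrices of operators *)

Section BlockOperators.
Context {R : realType} {H K : hilbertType R} {n : nat}.
Variable I : 'I_n -> H -> K.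
Hypothesis II : forall i j x y, '[I i x, I j y] = if i == j then '[x, y] else 0.
Hypothesis Icomplete : forall f : K, f = \sum_i I i (hadj (I i) f).

Let iso i : isometric (I i). Proof. by move=> x y; rewrite II eqxx. Qed.
Let bI i := isometric_blin (iso i).

Lemma hadj_coord i j x : hadj (I i) (I j x) = if i == j then x else 0.
Proof.
apply: dot_ext => y; rewrite (hadjC (bI i)) II eq_sym.
by case: ifP => // _; rewrite dot0l.
Qed.

Let entry_ex (X : 'B(K)) i j : exists B : 'B(H), forall x, B x = hadj (I i) (X (I j x)).
Proof.
apply: isblin_mkbop; apply: (@isblin_comp _ _ _ _ (hadj (I i)) (X \o I j)).
  exact/isblin_hadj/isometricP.
by apply: isblin_comp; [exact: isblin_bop|exact: isometricP].
Qed.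

Definition entry X i j : 'B(H) := projT1 (cid (entry_ex X i j)).

Lemma entryE X i j x : entry X i j x = hadj (I i) (X (I j x)).
Proof. by rewrite /entry; case: cid. Qed.

Let block_ex (T : 'I_n -> 'I_n -> 'B(H)) : exists B : 'B(K),
  forall f, B f = \sum_i \sum_j I i (T i j (hadj (I j) f)).
Proof.
apply: isblin_mkbop; apply: isblin_sum => i; apply: isblin_sum => j.
apply: (@isblin_comp _ _ _ _ (I i)); first exact: isometricP.
apply: (@isblin_comp _ _ _ _ (T i j)); first exact: isblin_bop.
exact/isblin_hadj/isometricP.
Qed.

Definition block T : 'B(K) := projT1 (cid (block_ex T)).

Lemma blockE T f : block T f = \sum_i \sum_j I i (T i j (hadj (I j) f)).
Proof. by rewrite /block; case: cid. Qed.

Lemma entry_block T i j : entry (block T) i j = T i j.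
Proof.
apply: bop_ext => x; rewrite entryE blockE (blin_sum (hadjJ_blin (iso i))).
under eq_bigr => k _ do rewrite -(blin_sum (bI k)) hadj_coord.
rewrite (bigD1 i)//= eqxx [X in _ + X]big1 ?addr0 => [|k ki]; last first.
  by rewrite eq_sym (negPf ki).
under eq_bigr => k _ do rewrite hadj_coord.
rewrite (bigD1 j)//= eqxx big1 ?addr0// => k kj.
by rewrite (negPf kj) linear0.
Qed.

Lemma entry_ext X Y : (forall i j, entry X i j = entry Y i j) -> X = Y.
Proof.
move=> XY; apply: bop_ext => f.
rewrite (Icomplete f) (blin_sum (bop_blin X)) (blin_sum (bop_blin Y)).
apply: eq_bigr => j _; rewrite (Icomplete (X _)) [RHS](Icomplete (Y _)).
by apply: eq_bigr => i _; rewrite -!entryE XY.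
Qed.

Lemma entry_lin (a : R[i]) X Y i j :
  entry (a *: X + Y) i j = a *: entry X i j + entry Y i j.
Proof.
apply: bop_ext => x; rewrite bopD bopZ !entryE bopD bopZ.
exact: (hadjJ_blin (iso i)).1.
Qed.

Lemma entry0 i j : entry 0 i j = 0.
Proof.
by apply: bop_ext => x; rewrite entryE bop0; exact: blin0 (hadjJ_blin (iso i)).
Qed.

Lemma entry1 i j : entry 1 i j = if i == j then 1 else 0.
Proof.
by apply: bop_ext => x; rewrite entryE bop1 hadj_coord; case: ifP.
Qed.

Lemma entry_adj X i j : entry (adj X) i j = adj (entry X j i).
Proof.
apply: bop_ext => x; apply: dot_ext => y.
by rewrite adjPl !entryE (hadjC (bI i)) adjPl -(hadjP (bI j)).
Qed.

Lemma entryM X Y i j : entry (X * Y) i j = \sum_k entry X i k * entry Y k j.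
Proof.
apply: bop_ext => x; rewrite bop_sum entryE bopM.
rewrite {1}(Icomplete (Y (I j x))) (blin_sum (bop_blin X)) (blin_sum (hadjJ_blin (iso i))).
by apply: eq_bigr => k _; rewrite bopM !entryE.
Qed.

Lemma entry_opnorm X Y i j : opnorm (entry X i j - entry Y i j) <= opnorm (X - Y).
Proof.
apply: opnorm_le_blin => [|x]; first exact: opnorm_ge0.
rewrite bopB !entryE -(blinB (hadjJ_blin (iso i))) (le_trans (hadjJ_le (iso i) _))//.
by rewrite -bopB (le_trans (bop_le _ _))// isometric_hnorm.
Qed.

Lemma dot_entry (X : 'B(K)) f : '[X f, f] =
  \sum_i '[\sum_j entry X i j (hadj (I j) f), hadj (I i) f].
Proof.
rewrite {2}(Icomplete f) dot_sumr; apply: eq_bigr => i _.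
rewrite -(hadjC (bI i)); congr ('[_, _]).
rewrite {1}(Icomplete f) (blin_sum (bop_blin X)) (blin_sum (hadjJ_blin (iso i))).
by apply: eq_bigr => j _; rewrite entryE.
Qed.

(** Turns a positive matrix into one positive operator, to which square roots apply. *)
Lemma bpos_entry X : bpos X <-> mx_positive (\matrix_(i, j) entry X i j).
Proof.
split=> [X0 x|X0 f]; last first.
  rewrite dot_entry; have := X0 (fun i => hadj (I i) f).
  by under eq_bigr => i _ do under eq_bigr => j _ do rewrite mxE.
have := X0 (\sum_i I i (x i)); rewrite dot_entry.
have e i : hadj (I i) (\sum_i I i (x i)) = x i.
  rewrite (blin_sum (hadjJ_blin (iso i))) (bigD1 i)//= hadj_coord eqxx big1 ?addr0//.
  by move=> j ji; rewrite hadj_coord eq_sym (negPf ji).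
under eq_bigr => i _ do rewrite e.
under eq_bigr => i _ do under eq_bigr => j _ do rewrite e.
by under [X in _ -> 0 <= X]eq_bigr => i _ do under eq_bigr => j _ do rewrite mxE.
Qed.

End BlockOperators.

Section FaithfulMatrices.
Context {R : realType} {H L : hilbertType R}.
Variables (M : set 'B(H)) (pi : 'B(H) -> 'B(L)).
Hypotheses (uM : unital_cstar_subalgebra M) (fpi : faithful_unital_rep M pi).

Lemma cstar_opsys : operator_system M.
Proof. by case: uM => M1 Ml _ Ma _; split. Qed.

(** The matrices over [M] form a C*-algebra on [H^n], and applying [pi] entrywise is a faithful
    representation of it; [faithful_bpos] does the rest. *)
Lemma faithful_mx_positive n (T : 'M['B(H)]_n) : (forall i j, M (T i j)) ->
  mx_positive (map_mx pi T) -> mx_positive T.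
Proof.
move=> MT pT; have [M1 Ml MM Ma cM] := uM; have [[lin mult star] pi1 inj] := fpi.
have sysM := cstar_opsys.
have [K [I [II Ic]]] := power_space H n; have [K' [I' [I'I I'c]]] := power_space L n.
pose N : set 'B(K) := [set X | forall i j, M (entry II X i j)].
pose pin (X : 'B(K)) : 'B(K') := block I'I (fun i j => pi (entry II X i j)).
have pinE X i j : entry I'I (pin X) i j = pi (entry II X i j) by rewrite entry_block.
have uN : unital_cstar_subalgebra N.
  split.
  - move=> i j; rewrite entry1; case: ifP => // _; exact: opsys0.
  - by move=> a X Y NX NY i j; rewrite entry_lin; exact: Ml.
  - move=> X Y NX NY i j; rewrite entryM//; apply: (opsys_sum sysM) => k; exact: MM.
  - by move=> X NX i j; rewrite entry_adj; exact: Ma.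
  - apply/closed_seqP => X hX i j; move/closed_seqP: cM; apply => e /hX[Y NY YX].
    by exists (entry II Y i j) => //; exact: le_trans (entry_opnorm _ _ _ _ _) YX.
have fN : faithful_unital_rep N pin.
  split; first split.
  - move=> a X Y NX NY; apply: (entry_ext I'c) => i j.
    by rewrite entry_lin !pinE entry_lin lin.
  - move=> X Y NX NY; apply: (entry_ext I'c) => i j.
    rewrite entryM// !pinE entryM// (linear_on_sum sysM lin) => [|k]; last exact: MM.
    by apply: eq_bigr => k _; rewrite !pinE mult.
  - move=> X NX; apply: (entry_ext I'c) => i j.
    by rewrite entry_adj !pinE entry_adj star.
  - apply: (entry_ext I'c) => i j; rewrite pinE !entry1; case: ifP => // _.
    exact: linear_on0 sysM lin.
  - move=> X Y; rewrite !inE => NX NY XY; apply: (entry_ext Ic) => i j.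
    by apply: inj; rewrite ?inE// -!pinE XY.
pose X := block II (fun i j => T i j).
have XE i j : entry II X i j = T i j by rewrite entry_block.
have -> : T = \matrix_(i, j) entry II X i j by apply/matrixP => i j; rewrite mxE XE.
apply/(bpos_entry _ Ic); apply: (faithful_bpos uN fN).
  by move=> i j; rewrite XE.
apply/(bpos_entry _ I'c); move: pT; congr mx_positive.
by apply/matrixP => i j; rewrite !mxE pinE XE.
Qed.

End FaithfulMatrices.

(** * Representations are completely positive and contractive *)

Section UnitalReps.
Context {R : realType} {H L : hilbertType R}.
Variable f : 'B(H) -> 'B(L).
Hypothesis rf : unital_rep f.

Lemma unital_repD S T : f (S + T) = f S + f T.
Proof. by case: rf => [[lin _ _] _]; have := lin 1 S T Logic.I Logic.I; rewrite !scale1r. Qed.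
Lemma unital_rep0 : f 0 = 0.
Proof. by apply: (@addrI _ (f 0)); rewrite -unital_repD !addr0. Qed.
Lemma unital_repZ (a : R[i]) T : f (a *: T) = a *: f T.
Proof.
by case: rf => [[lin _ _] _]; have := lin a T 0 Logic.I Logic.I; rewrite unital_rep0 !addr0.
Qed.
Lemma unital_repN T : f (- T) = - f T.
Proof. by rewrite -scaleN1r unital_repZ scaleN1r. Qed.
Lemma unital_repB S T : f (S - T) = f S - f T.
Proof. by rewrite unital_repD unital_repN. Qed.
Lemma unital_repM S T : f (S * T) = f S * f T.
Proof. by case: rf => [[_ mult _] _]; exact: mult. Qed.
Lemma unital_rep_adj T : f (adj T) = adj (f T).
Proof. by case: rf => [[_ _ star] _]; exact: star. Qed.
Lemma unital_rep1 : f 1 = 1.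
Proof. by case: rf. Qed.
Lemma unital_rep_sum J (s : seq J) (P : pred J) (T : J -> 'B(H)) :
  f (\sum_(i <- s | P i) T i) = \sum_(i <- s | P i) f (T i).
Proof. exact: (big_morph f unital_repD unital_rep0). Qed.

Let uT (K : hilbertType R) : unital_cstar_subalgebra [set: 'B(K)].
Proof. by split=> //; exact: closedT. Qed.

Let scaled_sqrt (K : hilbertType R) (X : 'B(K)) : bpos X ->
  exists c s, [/\ 0 < c, adj s = s & s * s = (c%:C : R[i]) *: X].
Proof.
move=> X0; pose c := (1 + opnorm X)^-1.
have c0 : 0 < c by rewrite invr_gt0 ltr_pwDl// opnorm_ge0.
have cX0 : bpos ((c%:C : R[i]) *: X).
  by move=> x; rewrite bopZ dotZl mulr_ge0// ler0c ltW.
have cX1 x : rdot (((c%:C : R[i]) *: X) x) x <= hnorm x ^+ 2.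
  rewrite bopZ rdot_ZRl ler_pdivrMl ?ltr_pwDl ?opnorm_ge0//.
  apply: le_trans (rdot_le _ _) _; rewrite expr2 mulrA ler_wpM2r ?hnorm_ge0//.
  by rewrite (le_trans (bop_le _ _))// ler_wpM2r ?hnorm_ge0// lerDr.
have [s [_ s0 ss _]] := bop_sqrt (uT K) Logic.I cX0 cX1.
by exists c, s; split=> //; exact: bpos_adj.
Qed.

(** A multiple [c T] equals [s s] for a self-adjoint operator matrix [s]; hence [c] times the form
    of the image of [T] is the sum over [k] of the squared norms of [sum_j f (s k j) (x j)]. *)
Lemma unital_rep_cp n (T : 'M['B(H)]_n) : mx_positive T -> mx_positive (map_mx f T).
Proof.
move=> T0; have [K [I [II Ic]]] := power_space H n.
pose X := block II (fun i j => T i j).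
have XE i j : entry II X i j = T i j by rewrite entry_block.
have X0 : bpos X.
  apply/(bpos_entry _ Ic); move: T0; congr mx_positive.
  by apply/matrixP => i j; rewrite mxE XE.
have [c [s [c0 sa ss]]] := scaled_sqrt X0.
pose y x k : L := \sum_j f (entry II s k j) (x j).
move=> x; suff e : (c%:C : R[i]) * \sum_i '[\sum_j (map_mx f T) i j (x j), x i] =
    \sum_k '[y x k, y x k].
  rewrite -(pmulr_rge0 _ (_ : 0 < c%:C)); last by rewrite ltcR.
  by rewrite e sumr_ge0// => k _; rewrite dot_xx ler0c sqr_ge0.
have fT i j : (c%:C : R[i]) *: f (T i j) =
    \sum_k adj (f (entry II s k i)) * f (entry II s k j).
  rewrite -unital_repZ -XE.
  have -> : (c%:C : R[i]) *: entry II X i j = entry II (s * s) i j.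
    have := entry_lin II c%:C X 0 i j; rewrite addr0 -ss => ->.
    by rewrite entry0 addr0.
  rewrite entryM// unital_rep_sum; apply: eq_bigr => k _.
  by rewrite unital_repM -unital_rep_adj -entry_adj sa.
rewrite mulr_sumr.
transitivity (\sum_i \sum_j \sum_k '[f (entry II s k j) (x j), f (entry II s k i) (x i)]).
  apply: eq_bigr => i _; rewrite -dotZl scaler_sumr dot_suml; apply: eq_bigr => j _.
  by rewrite mxE -bopZ fT bop_sum dot_suml; apply: eq_bigr => k _; rewrite bopM adjPl.
under eq_bigr => i _ do rewrite exchange_big.
rewrite exchange_big; apply: eq_bigr => k _; rewrite /y dot_sumr.
by apply: eq_bigr => i _; rewrite dot_suml.
Qed.

(** A multiple of [|T|^2 1 - adj T * T] is a square [s s]. Its image under [f] turns the difference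
    of the two squared bounds, up to a positive factor, into [|f s x|^2]. *)
Lemma unital_rep_opnorm T : opnorm (f T) <= opnorm T.
Proof.
have [T0|T0] := eqVneq (opnorm T) 0.
  by rewrite (opnorm_eq0 T0) unital_rep0 !opnorm0.
have N0 : 0 < opnorm T by rewrite lt_neqAle eq_sym T0 opnorm_ge0.
pose X : 'B(H) := (opnorm T ^+ 2)%:C *: (1 : 'B(H)) - adj T * T.
have X0 : bpos X.
  apply: bpos_rdot => [|x].
    by rewrite /X adjB adjZ adj1 conjCR adjM adjK.
  rewrite bopB bopZ bop1 bopM rdotDl rdotNl rdot_ZRl rdot_xx subr_ge0.
  rewrite /rdot adjPl -/(rdot _ _) rdot_xx -exprMn.
  by rewrite ler_pXn2r ?nnegrE ?mulr_ge0 ?opnorm_ge0 ?hnorm_ge0// bop_le.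
have [c [s [c0 sa ss]]] := scaled_sqrt X0.
apply: opnorm_le_blin => [|x]; first exact: opnorm_ge0.
apply: ler_of_sqr; first by rewrite mulr_ge0 ?opnorm_ge0 ?hnorm_ge0.
rewrite exprMn -subr_ge0.
have : c * (opnorm T ^+ 2 * hnorm x ^+ 2 - hnorm (f T x) ^+ 2) = hnorm (f s x) ^+ 2.
  have ga : adj (f s) = f s by rewrite -unital_rep_adj sa.
  rewrite -[RHS]rdot_xx -(rdot_adj (f s x) x ga) -bopM -unital_repM ss unital_repZ.
  rewrite bopZ rdot_ZRl unital_repB unital_repZ unital_rep1 unital_repM unital_rep_adj.
  rewrite bopB bopZ bop1 bopM rdotDl rdotNl rdot_ZRl rdot_xx.
  by rewrite [rdot (adj _ _) _]/rdot adjPl -/(rdot _ _) rdot_xx.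
by move=> e; rewrite -(pmulr_rge0 _ c0) e sqr_ge0.
Qed.

End UnitalReps.

Section PointwiseRep.
Context {R : realType} {H : hilbertType R} {Om : Type} (mu : posfun R Om).
Context (E : Om -> hilbertType R) (r : forall w, 'B(H) -> 'B(E w)).
Hypothesis rr : forall w, unital_rep (r w).
Local Notation P := (l2pre mu E).

Let r_adj T w (x y : E w) : '[r w T x, y] = '[x, adj (r w T) y].
Proof. exact: adjP. Qed.

Let r_le T w (x : E w) : hnorm (r w T x) <= opnorm T * hnorm x.
Proof.
rewrite (le_trans (bop_le _ _))// ler_wpM2r ?hnorm_ge0//.
exact: unital_rep_opnorm.
Qed.

Let radj_le T w (x : E w) : hnorm (adj (r w T) x) <= opnorm T * hnorm x.
Proof.
rewrite (le_trans (bop_le _ _))// ler_wpM2r ?hnorm_ge0//.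
exact: le_trans (opnorm_adj _) (unital_rep_opnorm _ _).
Qed.

Let padj_r T :=
  padj_l2map mu (@r_adj T) (opnorm_ge0 T) (opnorm_ge0 T) (@r_le T) (@radj_le T).

Definition pointwise_rep T : 'B(L2H mu E) := mkbop (blin_cext (padj_r T)).

Definition pointwise_map T (F : P) : P := l2map (opnorm_ge0 T) (@r_le T) F.

Lemma pointwise_rep_emb T (F : P) : pointwise_rep T (emb F) = emb (pointwise_map T F).
Proof. exact: cext_emb (padj_r T) F. Qed.

Lemma bop_dense_ext (T U : 'B(L2H mu E)) : (forall F : P, T (emb F) = U (emb F)) -> T = U.
Proof.
by move=> TU; apply: bop_ext; exact: blin_dense_eq (bop_blin T) (bop_blin U) TU.
Qed.

Lemma unital_pointwise_rep : unital_rep pointwise_rep.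
Proof.
split; last first.
  apply: bop_dense_ext => F; rewrite pointwise_rep_emb bop1; congr emb.
  by apply: l2_ext => w /=; rewrite (unital_rep1 (rr w)).
split.
- move=> a T U _ _; apply: bop_dense_ext => F.
  rewrite bopD bopZ !pointwise_rep_emb -emb_lin; congr emb.
  by apply: l2_ext => w /=; rewrite (unital_repD (rr w)) (unital_repZ (rr w)).
- move=> T U _ _; apply: bop_dense_ext => F.
  rewrite bopM !pointwise_rep_emb; congr emb.
  by apply: l2_ext => w /=; rewrite (unital_repM (rr w)).
- move=> T _; symmetry; apply: bop_dense_ext => F; apply: dot_ext => f.
  rewrite adjPl pointwise_rep_emb [LHS]dotC [RHS]dotC !dot_embr; congr (_^*%R).
  by congr (cval f _); apply: l2_ext => w /=; rewrite (unital_rep_adj (rr w)).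
Qed.

End PointwiseRep.

(** * Arveson extension and Stinespring dilation *)

Section ArvesonStinespring.
Context {R : realType} {H L : hilbertType R}.
Variables (S : set 'B(H)) (Phi : 'B(H) -> 'B(L)).
Hypotheses (S0 : operator_system S) (uPhi : ucp S Phi).

Let lPhi : linear_on S Phi. Proof. by case: uPhi. Qed.

(* A list of triples [(T, x, y)] stands for the sum of the tensors
   [T (x) x (x) y^*]; arbitrary functions [w : L -> H] test its positivity. *)
Local Notation tensors := (seq ('B(H) * L * L)).

Definition tensor_eval (l : tensors) (w : L -> H) : R :=
  \sum_(t <- l) rdot (t.1.1 (w t.1.2)) (w t.2).

Definition tensor_ucp (l : tensors) : R :=
  \sum_(t <- l) rdot (Phi t.1.1 t.1.2) t.2.

Let inS (l : tensors) := forall t, t \in l -> S t.1.1.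

(** Groups the tensors by their vectors, listed without repetition in [es], so that the sum becomes
    the form of a matrix. *)
Let regroup (l : tensors) (es : seq L) (h : 'B(H) * L * L -> R) :
  uniq es -> (forall t, t \in l -> t.1.2 \in es /\ t.2 \in es) ->
  \sum_(t <- l) h t = \sum_(i < size es) \sum_(j < size es)
    \sum_(t <- l | (t.1.2 == nth 0 es j) && (t.2 == nth 0 es i)) h t.
Proof.
move=> ues les; under [RHS]eq_bigr => i _ do under eq_bigr => j _ do rewrite big_mkcond.
under [RHS]eq_bigr => i _ do rewrite exchange_big.
rewrite exchange_big; apply: eq_big_seq => t /les[t1 t2].
have i1 : (index t.1.2 es < size es)%N by rewrite index_mem.
have i2 : (index t.2 es < size es)%N by rewrite index_mem.
rewrite (bigD1 (Ordinal i2)) //= (bigD1 (Ordinal i1)) //= !nth_index// !eqxx /=.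
rewrite big1 ?addr0 => [|j jn]; last first.
  case: ifP => // /andP[/eqP tj _]; case/eqP: jn; apply/val_inj => /=.
  by rewrite tj index_uniq.
rewrite big1 ?addr0// => i iN; apply: big1 => j _.
case: ifP => // /andP[_ /eqP ti]; case/eqP: iN; apply/val_inj => /=.
by rewrite ti index_uniq.
Qed.

(** Here complete positivity enters. The test functions [w] are arbitrary, not linear, so their
    values at the distinct vectors [es] can be prescribed freely, and positivity for all [w] is
    positivity of the matrix [T]. *)
Let tensor_pos l : inS l -> (forall w, 0 <= tensor_eval l w) -> 0 <= tensor_ucp l.
Proof.
move=> lS l0; pose es := undup (map (fun t => t.1.2) l ++ map (fun t => t.2) l).
have ues : uniq es by exact: undup_uniq.
have les t : t \in l -> t.1.2 \in es /\ t.2 \in es.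
  by move=> tl; rewrite !mem_undup !mem_cat; split; apply/orP; [left|right]; exact: map_f.
pose e (i : 'I_(size es)) := nth 0 es i.
pose T : 'M['B(H)]_(size es) := \matrix_(i, j)
  \sum_(t <- l | (t.1.2 == e j) && (t.2 == e i)) t.1.1.
have sumS (P : pred _) (s : tensors) :
    {subset s <= l} -> S (\sum_(t <- s | P t) t.1.1) /\
    Phi (\sum_(t <- s | P t) t.1.1) = \sum_(t <- s | P t) Phi t.1.1.
  elim: s => [|t s IH] sl; first by rewrite !big_nil
    (linear_on0 S0 lPhi); split=> //; exact: opsys0.
  have [|IH1 IH2] := IH; first by move=> t' t's; apply: sl; rewrite inE t's orbT.
  have St : S t.1.1 by apply: lS; apply: sl; rewrite mem_head.
  rewrite !big_cons; case: ifP => // _; split; first exact: (opsysD S0).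
  by rewrite (linear_onD lPhi)// IH2.
have ST i j : S (T i j) by rewrite mxE; apply: (sumS _ _ _).1.
have := @ucp_rdot _ _ _ S Phi _ T e S0 uPhi ST.
have -> : \sum_i \sum_j rdot (Phi (T i j) (e j)) (e i) = tensor_ucp l.
  rewrite /tensor_ucp (regroup _ ues les); apply: eq_bigr => i _; apply: eq_bigr => j _.
  rewrite mxE (sumS _ _ _).2// bop_sum rdot_suml.
  by apply: eq_bigr => t /andP[/eqP -> /eqP ->].
(* The test function with value [h i] at the [i]-th vector of [es] and 0 elsewhere. *)
apply=> h; have := l0 (fun x => if insub (index x es) is Some i then h i else 0).
rewrite /tensor_eval (regroup _ ues les); congr (0 <= _).
apply: eq_bigr => i _; apply: eq_bigr => j _; rewrite mxE bop_sum rdot_suml.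
apply: eq_bigr => t /andP[/eqP -> /eqP ->].
by rewrite !index_uniq// !valK.
Qed.

Let F : set (((L -> H) -> R) * R) :=
  [set p | exists l, inS l /\ p = (tensor_eval l, tensor_ucp l)].

Let scale_tensors (a : R) (l : tensors) : tensors :=
  [seq (a%:C *: t.1.1, t.1.2, t.2) | t <- l].

Let gF : pos_graph F.
Proof.
split.
- exists [::]; split=> //; congr pair; last by rewrite /tensor_ucp big_nil.
  by apply/funext => w; rewrite /tensor_eval big_nil.
- move=> a _ _ _ _ [l [lS [-> ->]]] [l' [l'S [-> ->]]].
  exists (scale_tensors a l ++ l'); split.
    move=> t; rewrite mem_cat => /orP[/mapP[t' /lS t'l -> /=]|/l'S//].
    exact: (opsysZ S0).
  congr pair; last first.
    rewrite /tensor_ucp big_cat big_map /= mulr_sumr; congr (_ + _).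
    apply: eq_big_seq => t /lS St.
    by rewrite (linear_onZ S0 lPhi)// bopZ rdot_ZRl.
  apply/funext => w; rewrite /tensor_eval big_cat big_map /= mulr_sumr.
  by congr (_ + _); apply: eq_bigr => t _; rewrite /= -rdot_ZRl.
- by move=> _ _ [l [lS [-> ->]]]; exact: tensor_pos.
Qed.

Let S1 : S 1. Proof. by case: S0. Qed.

(** As [S] contains 1, the function [|T| |w x|^2 + |T| |w y|^2] comes from [S] and dominates. Hence
    the extension assigns a value to every [T], in [S] or not, which is Arveson's theorem. *)
Let dot_dom (phi : R[i] -> R) (T : 'B(H)) x y : (forall z, `|phi z| <= cabs z) ->
  dominated F (fun w => phi '[T (w x), w y]).
Proof.
move=> phi_le; pose N1 : 'B(H) := (opnorm T)%:C *: (1 : 'B(H)).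
have SN1 : S N1 by exact: (opsysZ S0).
exists (tensor_eval [:: (N1, x, x); (N1, y, y)]).
exists (tensor_ucp [:: (N1, x, x); (N1, y, y)]); split.
  exists [:: (N1, x, x); (N1, y, y)]; split=> // t.
  by rewrite !inE => /orP[] /eqP ->.
move=> w; have -> : tensor_eval [:: (N1, x, x); (N1, y, y)] w =
    opnorm T * hnorm (w x) ^+ 2 + opnorm T * hnorm (w y) ^+ 2.
  by rewrite /tensor_eval !big_cons big_nil addr0 -!rdot_xx -!rdot_ZRl.
apply: le_trans (phi_le _) _; apply: le_trans (cauchy_schwarz _ _) _.
have := bop_le T (w x); have := opnorm_ge0 T; have := hnorm_ge0 (w y).
have := hnorm_ge0 (w x); move: (hnorm (T (w x))) (hnorm (w x)) (hnorm (w y)) (opnorm T).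
move=> a b c d b0 c0 d0 h; have sq := sqr_ge0 (b - c).
apply: le_trans (ler_wpM2r c0 h) _; nra.
Qed.

(* The Gelfand-Naimark-Segal space is the L2-completion of dominated functions
   [(L -> H) -> H], on which operators act pointwise, and a vector [x] of [L]
   becomes the evaluation at [x]. *)
Lemma arveson_stinespring : exists (K : hilbertType R) (rho : 'B(H) -> 'B(K))
    (J : L -> K), [/\ unital_rep rho, forall x y, '[J x, J y] = '[x, y]
  & forall T, S T -> forall x y, '[rho T (J x), J y] = '[Phi T x, y]].
Proof.
have [mu [muD muE]] := riesz_extension gF.
pose E (w : L -> H) := H; pose P := l2pre mu E.
(* Every fibre is [H] with the identity representation; only the functional depends on [Phi]. *)
have rid w : unital_rep (fun T : 'B(H) => T : 'B(E w)) by [].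
pose rho := pointwise_rep mu rid.
have ev_dom x : pdom mu (fun w => hnorm (w x : E w) ^+ 2).
  rewrite muD; have := dot_dom 1 x x (@Re_le_cabs R).
  by congr (dominated F _); apply/funext => w; rewrite bop1 -rdot_xx.
pose J x : complH P := emb (L2 (ev_dom x) : P).
have JE T x y : S T -> '[rho T (J x), J y] = '[Phi T x, y].
  move=> ST; rewrite pointwise_rep_emb dot_emb.
  have val1 (U : 'B(H)) :
      S U -> pint mu (fun w => rdot (U (w x)) (w y)) = rdot (Phi U x) y.
    move=> SU; apply: muE; exists [:: (U, x, y)]; split.
      by move=> t; rewrite inE => /eqP ->.
    congr pair; last by rewrite /tensor_ucp big_seq1.
    by apply/funext => w; rewrite /tensor_eval big_seq1.
  apply: complex_ext; first exact: val1.
  rewrite [RHS]Im_Re -dotZl -bopZ -(linear_onZ S0 lPhi)//.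
  rewrite -[RHS]/(rdot _ _) -val1; last exact: (opsysZ S0).
  rewrite /= /pint_dot; congr pint; apply/funext => w.
  by rewrite Im_Re -dotZl.
have rho_rep : unital_rep rho := unital_pointwise_rep mu rid.
exists (complH P), rho, J; split=> // [x y|T ST x y]; last exact: JE.
(* [J] is isometric by the case [T = 1], since [Phi 1 = 1]. *)
have := JE 1 x y S1; case: uPhi => _ -> _.
by case: rho_rep => _ ->; rewrite !bop1.
Qed.

End ArvesonStinespring.

(** * Compression to an isometric subspace and inflation from it *)

Section Compression.
Context {R : realType} {H K : hilbertType R} {J : H -> K}.
Hypothesis isoJ : isometric J.

Let compress_ex (X : 'B(K)) : exists B : 'B(H), forall x, B x = hadj J (X (J x)).
Proof.
apply: isblin_mkbop; apply: (@isblin_comp _ _ _ _ (hadj J) (X \o J)).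
  exact/isblin_hadj/isometricP.
by apply: isblin_comp; [exact: isblin_bop|exact: isometricP].
Qed.

Definition compress X : 'B(H) := projT1 (cid (compress_ex X)).

Lemma compressE X x : compress X x = hadj J (X (J x)).
Proof. by rewrite /compress; case: cid. Qed.

Let inflate_ex (D : 'B(H)) : exists B : 'B(K), forall x, B x = J (D (hadj J x)).
Proof.
apply: isblin_mkbop; apply: (@isblin_comp _ _ _ _ J (D \o hadj J)).
  exact: isometricP.
by apply: isblin_comp; [exact: isblin_bop|exact/isblin_hadj/isometricP].
Qed.

Definition inflate D : 'B(K) := projT1 (cid (inflate_ex D)).

Lemma inflateE D x : inflate D x = J (D (hadj J x)).
Proof. by rewrite /inflate; case: cid. Qed.

Lemma compress_dot X x y : '[compress X x, y] = '[X (J x), J y].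
Proof. by rewrite compressE (hadjC (isometric_blin isoJ)). Qed.

Lemma compress_lin (a : R[i]) X Y : compress (a *: X + Y) = a *: compress X + compress Y.
Proof.
apply: bop_ext => x; rewrite bopD bopZ !compressE bopD bopZ.
exact: (hadjJ_blin isoJ).1.
Qed.

Lemma compressD X Y : compress (X + Y) = compress X + compress Y.
Proof. by have := compress_lin 1 X Y; rewrite !scale1r. Qed.

Lemma compressB X Y : compress (X - Y) = compress X - compress Y.
Proof. by rewrite addrC -scaleN1r compress_lin scaleN1r addrC. Qed.

Lemma compress1 : compress 1 = 1.
Proof. by apply: bop_ext => x; rewrite compressE hadjJ. Qed.

Lemma compress_adj X : compress (adj X) = adj (compress X).
Proof.
apply: bop_ext => x; apply: dot_ext => y.
by rewrite compress_dot !adjPl [LHS]dotC -compress_dot -dotC.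
Qed.

Lemma compress_opnorm X : opnorm (compress X) <= opnorm X.
Proof.
apply: opnorm_le_blin => [|x]; first exact: opnorm_ge0.
rewrite compressE (le_trans (hadjJ_le isoJ _))// (le_trans (bop_le _ _))//.
by rewrite isometric_hnorm.
Qed.

Lemma compress_inflate D : compress (inflate D) = D.
Proof. by apply: bop_ext => x; rewrite compressE inflateE !hadjJ. Qed.

Lemma inflate_opnorm D : opnorm (inflate D) <= opnorm D.
Proof.
apply: opnorm_le_blin => [|x]; first exact: opnorm_ge0.
rewrite inflateE isometric_hnorm// (le_trans (bop_le _ _))//.
by rewrite ler_wpM2l ?opnorm_ge0// hadjJ_le.
Qed.

Lemma compress_mx_positive n (T : 'M['B(K)]_n) :
  mx_positive T -> mx_positive (map_mx compress T).
Proof.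
move=> T0 x; have := T0 (fun i => J (x i)); congr (0 <= _).
apply: eq_bigr => i _; rewrite !dot_suml; apply: eq_bigr => j _.
by rewrite mxE compress_dot.
Qed.

End Compression.

(** * Generated C*-algebras and operator systems *)

Section Cstar.
Context {R : realType} {H : hilbertType R} {d : nat}.
Implicit Type A : 'I_d -> 'B(H).

Lemma cstar_gen A i : cstar A (A i).
Proof. by move=> M [_ AM]; apply: AM; exists i. Qed.

Lemma cstar_min A M : unital_cstar_subalgebra M -> (forall i, M (A i)) -> cstar A `<=` M.
Proof. by move=> uM AM T; apply; split=> // _ [i _ <-]. Qed.

Lemma cstar_subalgebra A : unital_cstar_subalgebra (cstar A).
Proof.
split.
- by move=> M [[]].
- by move=> a S T hS hT M hM; have [[_ + _ _ _] _] := hM; apply; [exact: hS|exact: hT].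
- by move=> S T hS hT M hM; have [[_ _ + _ _] _] := hM; apply; [exact: hS|exact: hT].
- by move=> T hT M hM; have [[_ _ _ + _] _] := hM; apply; exact: hT.
- apply/closed_seqP => X hX M hM; have [[_ _ _ _ /closed_seqP cM] _] := hM.
  by apply: cM => e /hX[T hT TX]; exists T => //; exact: hT.
Qed.

Lemma opsys_gen A i : opsys A (A i).
Proof.
exists 0, (fun j => (j == i)%:R), (fun=> 0).
rewrite scale0r add0r (bigD1 i)//= eqxx scale1r !big1 ?addr0// => j.
  by move=> _; rewrite scale0r.
by move=> /negPf ->; rewrite scale0r.
Qed.

Lemma opsys_operator_system A : operator_system (opsys A).
Proof.
split.
- exists 1, (fun=> 0), (fun=> 0).
  by rewrite scale1r !big1 ?addr0// => j _; rewrite scale0r.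
- move=> a T U [a1 [b1 [c1 ->]]] [a2 [b2 [c2 ->]]].
  exists (a * a1 + a2), (fun i => a * b1 i + b2 i), (fun i => a * c1 i + c2 i).
  have e (b c : 'I_d -> R[i]) (F : 'I_d -> 'B(H)) :
      \sum_i (a * b i + c i) *: F i = a *: (\sum_i b i *: F i) + \sum_i c i *: F i.
    rewrite scaler_sumr -big_split; apply: eq_bigr => i _ /=.
    by rewrite scalerA -scalerDl.
  rewrite !e; set X1 := \sum_i _; set X2 := \sum_i _; set Y1 := \sum_i _; set Y2 := \sum_i _.
  have -> : (a * a1 + a2) *: (1 : 'B(H)) =
      a *: (a1 *: (1 : 'B(H))) + a2 *: (1 : 'B(H)).
    by rewrite scalerA -scalerDl.
  by rewrite !scalerDr addrACA [X in X + _ = _]addrACA.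
- move=> T [a [b [c ->]]]; exists a^*%R, (fun i => (c i)^*%R), (fun i => (b i)^*%R).
  rewrite !adjD adjZ adj1 !adj_sum addrAC; congr (_ + _); last first.
    by apply: eq_bigr => i _; rewrite adjZ.
  by congr (_ + _); apply: eq_bigr => i _; rewrite adjZ adjK.
Qed.

End Cstar.

Lemma unital_rep_comp {R : realType} {H K L : hilbertType R}
    (f : 'B(K) -> 'B(L)) (g : 'B(H) -> 'B(K)) :
  unital_rep f -> unital_rep g -> unital_rep (f \o g).
Proof.
move=> rf rg; split; last by rewrite /= (unital_rep1 rg) (unital_rep1 rf).
split=> [a S T _ _|S T _ _|T _] /=.
- by rewrite (unital_repD rg) (unital_repZ rg) (unital_repD rf) (unital_repZ rf).
- by rewrite (unital_repM rg) (unital_repM rf).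
- by rewrite (unital_rep_adj rg) (unital_rep_adj rf).
Qed.

Section Dilation.
Context {R : realType} {H K L2 L : hilbertType R} {d : nat}.
Variables (u : 'I_d -> 'B(H)) (v : 'I_d -> 'B(K)).
Variables (pi : 'B(K) -> 'B(L2)) (Psi : 'B(H) -> 'B(L2)) (sigma : 'B(K) -> 'B(L)).
Hypotheses (fpi : faithful_unital_rep (cstar v) pi) (uPsi : ucp (opsys u) Psi).
Hypothesis rsigma : unital_rep sigma.

(** Two dilations are stacked: [rho1] dilates [Psi], and [rho2] dilates the ucp map [E], which is
    [sigma] after the inverse of [pi] after compression. Composing them puts a representation of
    ['B(H)] above the prescribed [sigma]. *)
Lemma dilation : exists (L' : hilbertType R) (rho : 'B(H) -> 'B(L')) (J : L -> L'),
  [/\ unital_rep rho, isometric J & forall i x,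
    hnorm (hadj J (rho (u i) (J x)) - sigma (v i) x) <=
    opnorm (pi (v i) - Psi (u i)) * hnorm x].
Proof.
have uV := cstar_subalgebra v; have sysV := cstar_opsys uV.
have [V1 Vl VM Va cV] := uV; have [[lin mult star] pi1 inj] := fpi.
have [K1 [rho1 [J1 [rrho1 isoJ1 rho1E]]]] :=
  arveson_stinespring (opsys_operator_system u) uPsi.
pose pinv b := xget 0 [set a | cstar v a /\ pi a = b].
have pinvK a : cstar v a -> pinv (pi a) = a.
  move=> Va'; rewrite /pinv; case: xgetP => [b -> [Vb pb]|/(_ a)]; last by case.
  by apply: inj; rewrite ?inE.
(* The operators on [K1] whose compression lies in the range of [pi] on C*(v), so that [pi] can be
   inverted there. *)
pose S : set 'B(K1) := [set X | exists2 a, cstar v a & compress isoJ1 X = pi a].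
pose E (X : 'B(K1)) := sigma (pinv (compress isoJ1 X)).
have EE X a : cstar v a -> compress isoJ1 X = pi a -> E X = sigma a.
  by move=> Va' Xa; rewrite /E Xa pinvK.
have sysS : operator_system S.
  split; first by exists 1; rewrite ?compress1 ?pi1.
    move=> a T U [b Vb Tb] [c Vc Uc]; exists (a *: b + c); first exact: Vl.
    by rewrite compress_lin Tb Uc lin.
  move=> T [a Va' Ta]; exists (adj a); first exact: Va.
  by rewrite compress_adj Ta star.
have uE : ucp S E.
  split.
  - move=> a T U [b Vb Tb] [c Vc Uc].
    rewrite (EE T b)// (EE U c)// (EE _ (a *: b + c)).
    + by rewrite (unital_repD rsigma) (unital_repZ rsigma).
    + exact: Vl.
    + by rewrite compress_lin Tb Uc lin.
  - by rewrite (EE 1 1) ?compress1 ?pi1// (unital_rep1 rsigma).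
  - move=> n T ST T0.
    (* Positivity of a matrix is preserved by compression, reflected by [pi] and preserved by
       [sigma]. *)
    pose A : 'M['B(K)]_n := \matrix_(i, j) pinv (compress isoJ1 (T i j)).
    have AV i j : cstar v (A i j) /\ compress isoJ1 (T i j) = pi (A i j).
      by have [a Va' Ta] := ST i j; rewrite mxE Ta pinvK.
    have -> : map_mx E T = map_mx sigma A by apply/matrixP => i j; rewrite !mxE.
    apply: (unital_rep_cp rsigma); apply: (faithful_mx_positive uV fpi).
      by move=> i j; case: (AV i j).
    have := compress_mx_positive isoJ1 T0; congr mx_positive.
    by apply/matrixP => i j; rewrite [LHS]mxE [RHS]mxE (AV i j).2.
have [K2 [rho2 [J2 [rrho2 isoJ2 rho2E]]]] := arveson_stinespring sysS uE.
exists K2, (rho2 \o rho1), J2; split=> //; first exact: unital_rep_comp.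
move=> i x; pose D := pi (v i) - Psi (u i).
(* [X] compresses to [Psi (u i)], which may lie outside the range of [pi]. Adding the inflated
   defect [D] moves it into [S], where the compression of [rho2] is known, at the cost
   [opnorm D]. *)
pose X := rho1 (u i); pose X' := X + inflate isoJ1 D.
have cX : compress isoJ1 X = Psi (u i).
  apply: bop_ext => y; apply: dot_ext => z; rewrite compress_dot rho1E//.
  exact: opsys_gen.
have cX' : compress isoJ1 X' = pi (v i).
  by rewrite compressD cX compress_inflate addrC subrK.
have SX' : S X' by exists (v i) => //; exact: cstar_gen.
have -> : sigma (v i) x = hadj J2 (rho2 X' (J2 x)).
  apply: dot_ext => z; rewrite (hadjC (isometric_blin isoJ2)) rho2E//.
  by rewrite (EE X' (v i))//; exact: cstar_gen.
rewrite /= -/X -(blinB (hadjJ_blin isoJ2)) -bopB -(unital_repB rrho2).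
apply: le_trans (hadjJ_le isoJ2 _) _; apply: le_trans (bop_le _ _) _.
rewrite (isometric_hnorm isoJ2) ler_wpM2r ?hnorm_ge0//.
apply: le_trans (unital_rep_opnorm rrho2 _) _.
apply: le_trans (inflate_opnorm isoJ1 D); apply: opnorm_le_blin => [|y].
  exact: opnorm_ge0.
rewrite bopB bopD opprD addrA subrr add0r hnormN; exact: bop_le.
Qed.

End Dilation.

(** * The Eilenberg swindle *)

Section RangeProjection.
Context {R : realType} {U V : hilbertType R}.
Variable J : U -> V.
Hypothesis isoJ : isometric J.
Let bJ := isometric_blin isoJ.
Let bJ' := hadjJ_blin isoJ.

(** The projection onto the orthogonal complement of the range of [J]. *)
Definition qproj (y : V) : V := y - J (hadj J y).

Lemma qproj_blin : isblin qproj.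
Proof.
have [M M0 bM] : isblin (fun y => y + - J (hadj J y)).
  apply: isblinD; first by exists 1 => //; exact: blin_id.
  apply: isblinN; apply: (@isblin_comp _ _ _ _ J (hadj J)); first exact: isometricP.
  exact/isblin_hadj/isometricP.
by exists M.
Qed.

Lemma hadj_qproj y : hadj J (qproj y) = 0.
Proof. by rewrite /qproj (blinB bJ') (hadjJ isoJ) subrr. Qed.

Lemma qprojJ x : qproj (J x) = 0.
Proof. by rewrite /qproj (hadjJ isoJ) subrr. Qed.

Lemma qprojK y : qproj (qproj y) = qproj y.
Proof. by rewrite {1}/qproj hadj_qproj (blin0 bJ) subr0. Qed.

Lemma qprojD y z : qproj (y + z) = qproj y + qproj z.
Proof. by have [M _ b] := qproj_blin; exact: blinD b y z. Qed.

Lemma qproj_dotJ y x : '[qproj y, J x] = 0.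
Proof. by rewrite -(hadjC bJ) hadj_qproj dot0l. Qed.

Lemma qproj_dot y z : '[qproj y, qproj z] = '[y, z] - '[hadj J y, hadj J z].
Proof.
rewrite {2}/qproj dotBr qproj_dotJ subr0 /qproj dotBl; congr (_ - _).
exact: hadjP bJ _ _.
Qed.

Lemma range_decomp y : y = J (hadj J y) + qproj y.
Proof. by rewrite /qproj addrC subrK. Qed.

Lemma hnorm_decomp y : hnorm y ^+ 2 = hnorm (hadj J y) ^+ 2 + hnorm (qproj y) ^+ 2.
Proof.
rewrite -!rdot_xx [rdot (qproj y) _]/rdot qproj_dot ReB.
by rewrite -!/(rdot _ _) addrC subrK.
Qed.

End RangeProjection.
Arguments qproj {R U V} J y.

Section HalfStep.
Context {R : realType} {U V : hilbertType R}.
Variables (J : U -> V) (S0 S1 : U -> U).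

(* [absorb : U (+) V -> V] is a unitary that sends [U] to the copy [J S0 U],
   and moves [J U] inside [V] out of the way to [J S1 U]; its inverse is
   [(emit1, emit2)]. *)
Definition absorb (b : U) (a : V) : V := qproj J a + J (S0 b + S1 (hadj J a)).
Definition emit1 (y : V) : U := hadj S0 (hadj J y).
Definition emit2 (y : V) : V := qproj J y + J (hadj S1 (hadj J y)).

Hypotheses (isoJ : isometric J) (iso0 : isometric S0) (iso1 : isometric S1).
Hypothesis S01 : forall x, x = S0 (hadj S0 x) + S1 (hadj S1 x).

Let bJ := isometric_blin isoJ.
Let bJ' := hadjJ_blin isoJ.
Let b0 := isometric_blin iso0.
Let b1 := isometric_blin iso1.
Let b0' := hadjJ_blin iso0.
Let b1' := hadjJ_blin iso1.

(** Orthogonality of the two ranges is contained in [S01]: at the vector [S0 x] its second summand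
    must vanish. *)
Let S1_0 x : hadj S1 (S0 x) = 0.
Proof.
rewrite -(hadjJ iso1 (hadj S1 (S0 x))).
have := S01 (S0 x); rewrite (hadjJ iso0) -{1}[S0 x]addr0 => /addrI <-.
exact: blin0 b1'.
Qed.

Let S0_1 x : hadj S0 (S1 x) = 0.
Proof.
rewrite -(hadjJ iso0 (hadj S0 (S1 x))).
have := S01 (S1 x); rewrite (hadjJ iso1) addrC -{1}[S1 x]addr0 => /addrI <-.
exact: blin0 b0'.
Qed.

Lemma emitK y : absorb (emit1 y) (emit2 y) = y.
Proof.
rewrite /absorb /emit1 /emit2 qprojD// qprojK// qprojJ// addr0.
rewrite (blinD bJ') hadj_qproj// add0r (hadjJ isoJ) -S01.
by rewrite addrC -range_decomp.
Qed.

Let hadj_absorb b a : hadj J (absorb b a) = S0 b + S1 (hadj J a).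
Proof. by rewrite (blinD bJ') hadj_qproj// add0r (hadjJ isoJ). Qed.

Let qproj_absorb b a : qproj J (absorb b a) = qproj J a.
Proof. by rewrite qprojD// qprojK// qprojJ// addr0. Qed.

Lemma absorbK1 b a : emit1 (absorb b a) = b.
Proof. by rewrite /emit1 hadj_absorb (blinD b0') (hadjJ iso0) S0_1 addr0. Qed.

Lemma absorbK2 b a : emit2 (absorb b a) = a.
Proof.
rewrite /emit2 qproj_absorb hadj_absorb (blinD b1') S1_0 add0r (hadjJ iso1).
by rewrite addrC -range_decomp.
Qed.

Lemma absorb_dot b a b' a' :
  '[absorb b a, absorb b' a'] = '[b, b'] + '[a, a'].
Proof.
have cross (y : V) z : '[J z, qproj J y] = 0.
  by rewrite dotC qproj_dotJ// conjC0.
rewrite /absorb (dotDl (qproj J a)) !(dotDr _ (qproj J a')).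
rewrite qproj_dotJ// cross// addr0 add0r qproj_dot// isoJ.
rewrite dotDl !dotDr -(hadjC b1) S1_0 dot0l iso0 iso1 addr0 -(hadjC b0) S0_1 dot0l add0r.
by rewrite addrCA subrK.
Qed.

Lemma absorb_norm b a : hnorm (absorb b a) ^+ 2 = hnorm b ^+ 2 + hnorm a ^+ 2.
Proof. by rewrite -!rdot_xx /rdot absorb_dot ReD. Qed.

Lemma emit_norm y : hnorm y ^+ 2 = hnorm (emit1 y) ^+ 2 + hnorm (emit2 y) ^+ 2.
Proof. by rewrite -absorb_norm emitK. Qed.

Lemma absorbB b a b' a' : absorb (b - b') (a - a') = absorb b a - absorb b' a'.
Proof.
rewrite /absorb (qprojD isoJ); have -> : qproj J (- a') = - qproj J a'.
  by rewrite /qproj (blinN bJ') (blinN bJ) opprD.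
rewrite (blinB bJ') (blinB b1) (blinB b0).
have -> : S0 b - S0 b' + (S1 (hadj J a) - S1 (hadj J a')) =
    (S0 b + S1 (hadj J a)) - (S0 b' + S1 (hadj J a')) by rewrite opprD addrACA.
by rewrite (blinB bJ) (opprD (qproj J a')) [RHS]addrACA.
Qed.

Variables (A : 'B(U)) (B : 'B(V)) (delta : R).
Hypotheses (A0 : forall x, A (S0 x) = S0 (A x)) (A1 : forall x, A (S1 x) = S1 (A x)).
Hypothesis d0 : 0 <= delta.
Hypothesis AB : forall y,
  hnorm (B y - (J (A (hadj J y)) + qproj J (B (qproj J y)))) <= delta * hnorm y.

Let D y := B y - (J (A (hadj J y)) + qproj J (B (qproj J y))).

(** Since [A] commutes with [S0] and [S1], [absorb] would intertwine exactly if [B] were block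
    diagonal. The defect [D] of [B] enters twice, before and after [absorb]. *)
Lemma absorb_intertwines b a :
  hnorm (absorb (A b) (B a) - B (absorb b a)) <=
  delta * hnorm a + delta * hnorm (absorb b a).
Proof.
have DE y : B y - D y = J (A (hadj J y)) + qproj J (B (qproj J y)).
  by rewrite /D opprB addrCA subrr addr0.
have e : absorb (A b) (B a - D a) = B (absorb b a) - D (absorb b a).
  rewrite !DE hadj_absorb qproj_absorb /absorb qprojD// qprojJ// add0r qprojK//.
  rewrite (blinD bJ') hadj_qproj// addr0 (hadjJ isoJ) (blinD (bop_blin A)) A0 A1.
  by rewrite addrC.
have -> : absorb (A b) (B a) - B (absorb b a) = absorb 0 (D a) - D (absorb b a).
  have := absorbB (A b) (B a) (A b) (B a - D a).
  by rewrite subrr opprB addrCA subrr addr0 => ->; rewrite e opprB addrA addrAC addrK.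
apply: le_trans (hnormB _ _) _; apply: lerD; last exact: AB.
suff -> : hnorm (absorb 0 (D a)) = hnorm (D a) by exact: AB.
apply/eqP; rewrite -(eqrXn2 (ltn0Sn 1)) ?hnorm_ge0// absorb_norm hnorm0 expr0n add0r.
by [].
Qed.

(** [absorb] is unitary with inverse [emit1], [emit2], so the previous estimate is read backwards;
    both of its terms are at most [delta * hnorm y]. *)
Lemma emit_intertwines y :
  hnorm (emit1 (B y) - A (emit1 y)) ^+ 2 + hnorm (emit2 (B y) - B (emit2 y)) ^+ 2
  <= (2 * delta * hnorm y) ^+ 2.
Proof.
rewrite -absorb_norm absorbB emitK ler_pXn2r ?nnegrE ?hnorm_ge0 ?mulr_ge0 ?hnorm_ge0//.
have := absorb_intertwines (emit1 y) (emit2 y); rewrite emitK hnormBC => h0.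
apply: le_trans h0 _; have : hnorm (emit2 y) <= hnorm y.
  apply: ler_of_sqr; first exact: hnorm_ge0.
  by rewrite [leRHS]emit_norm lerDr sqr_ge0.
by move=> h; have := ler_wpM2l d0 h; lra.
Qed.

End HalfStep.

(** * Almost reducing subspaces of unitaries *)

Section AlmostReducing.
Context {R : realType} {U V : hilbertType R}.
Variables (J : U -> V) (r : R).
Hypotheses (isoJ : isometric J) (r0 : 0 <= r) (r1 : r <= 1).
Let bJ := isometric_blin isoJ.
Let bJ' := hadjJ_blin isoJ.

(** [B] preserves the length of [J p], and its component in the range of [J] keeps at least the
    share [1 - r]; Pythagoras leaves [1 - (1 - r)^2 <= 2 r] for the rest. *)
Let corner_small (A : 'B(U)) (B : 'B(V)) p :
  (forall x, hnorm (A x) = hnorm x) -> (forall y, hnorm (B y) = hnorm y) ->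
  opnorm (compress isoJ B - A) <= r ->
  hnorm (qproj J (B (J p))) ^+ 2 <= 2 * r * hnorm p ^+ 2.
Proof.
move=> isoA isoB BA; have := hnorm_decomp isoJ (B (J p)).
rewrite isoB isometric_hnorm// -compressE => e.
have h : (1 - r) * hnorm p <= hnorm (compress isoJ B p).
  have h1 := hnorm_triangle (A p) (compress isoJ B p) 0.
  have h2 := le_trans (bop_le (compress isoJ B - A) p) (ler_wpM2r (hnorm_ge0 p) BA).
  by move: h1 h2; rewrite !subr0 isoA bopB (hnormBC (compress isoJ B p)); lra.
have r1' : 0 <= 1 - r by rewrite subr_ge0.
have h2 : ((1 - r) * hnorm p) ^+ 2 <= hnorm (compress isoJ B p) ^+ 2.
  by rewrite ler_pXn2r ?nnegrE ?mulr_ge0 ?hnorm_ge0.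
by move: h2; rewrite exprMn; have := sqr_ge0 (r * hnorm p); nra.
Qed.

Lemma unitary_isometric (H : hilbertType R) (T : 'B(H)) : unitary T ->
  (forall x, hnorm (T x) = hnorm x) /\ (forall x, hnorm (adj T x) = hnorm x).
Proof.
move=> [h1 h2].
have key (S : 'B(H)) : adj S * S = 1 -> forall x, hnorm (S x) = hnorm x.
  move=> e x; apply/eqP; rewrite -(eqrXn2 (ltn0Sn 1)) ?hnorm_ge0// -!rdot_xx.
  by rewrite /rdot -adjPl -bopM e.
by split; apply: key; rewrite ?adjK.
Qed.

(** The diagonal corner costs [r]. The two off-diagonal corners have orthogonal ranges and act on
    orthogonal parts of [y], so their squares add up and together they cost only [sqrt (2 r)]. *)
Lemma almost_reducing (A : 'B(U)) (B : 'B(V)) y : unitary A -> unitary B ->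
  opnorm (compress isoJ B - A) <= r ->
  hnorm (B y - (J (A (hadj J y)) + qproj J (B (qproj J y)))) <=
  (r + Num.sqrt (2 * r)) * hnorm y.
Proof.
move=> /unitary_isometric[iA iA'] /unitary_isometric[iB iB'] BA.
have BA' : opnorm (compress isoJ (adj B) - adj A) <= r.
  by rewrite compress_adj -adjB (le_trans (opnorm_adj _)).
have s0 : 0 <= Num.sqrt (2 * r) := sqrtr_ge0 _.
have ss : Num.sqrt (2 * r) ^+ 2 = 2 * r by rewrite sqr_sqrtr// mulr_ge0.
set p := hadj J y; set q := qproj J y; pose m := hadj J (B q).
(* This corner starts from the complement, where nothing is known of [B]; passing to [adj B] turns
   it into a corner starting from the range of [J]. *)
have m_le : hnorm m <= Num.sqrt (2 * r) * hnorm q.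
  have h1 : hnorm (qproj J (adj B (J m))) <= Num.sqrt (2 * r) * hnorm m.
    apply: ler_of_sqr; first by rewrite mulr_ge0 ?hnorm_ge0.
    by rewrite exprMn ss; exact: corner_small iA' iB' BA'.
  have h2 : hnorm m ^+ 2 <= hnorm q * (Num.sqrt (2 * r) * hnorm m).
    rewrite -rdot_xx {1}/m /rdot (hadjC bJ) adjP.
    rewrite (range_decomp J (adj B (J m))) dotDr qproj_dotJ// add0r.
    by apply: le_trans (rdot_le _ _) _; rewrite ler_wpM2l ?hnorm_ge0.
  have [->|m0] := eqVneq (hnorm m) 0; first by rewrite mulr_ge0 ?hnorm_ge0.
  have m1 : 0 < hnorm m by rewrite lt_neqAle eq_sym m0 hnorm_ge0.
  by rewrite -(ler_pM2r m1) -expr2 (le_trans h2)// mulrCA mulrA.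
have -> : B y - (J (A p) + qproj J (B q)) =
    J (compress isoJ B p - A p) + (J m + qproj J (B (J p))).
  rewrite {1}(range_decomp J y) -/p -/q (blinD (bop_blin B)).
  rewrite {1}(range_decomp J (B (J p))) {1}(range_decomp J (B q)) -compressE -/m.
  rewrite (blinB bJ); move: (J _) (J _) (J _) (qproj J _) (qproj J _) => a b c e f.
  rewrite [X in X - _ = _]addrA opprD addrACA subrr addr0 -(addrA c) (addrC f).
  by rewrite addrAC.
rewrite mulrDl; apply: le_trans (hnormD _ _) _; apply: lerD.
  rewrite isometric_hnorm// -bopB (le_trans (bop_le _ _))//.
  apply: ler_pM; rewrite ?opnorm_ge0 ?hnorm_ge0//; exact: hadjJ_le.
apply: ler_of_sqr; first by rewrite mulr_ge0 ?hnorm_ge0.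
have := hnorm_decomp isoJ (J m + qproj J (B (J p))).
rewrite (blinD bJ') (hadjJ isoJ) hadj_qproj// addr0 qprojD// qprojJ// add0r qprojK// => ->.
rewrite exprMn ss (hnorm_decomp isoJ y) mulrDr addrC; apply: lerD.
  exact: corner_small.
by rewrite -ss -exprMn ler_pXn2r ?nnegrE ?mulr_ge0 ?hnorm_ge0.
Qed.

End AlmostReducing.

Section Swindle.
Context {R : realType} {U V : hilbertType R}.
Variables (J : U -> V) (J' : V -> U) (S0 S1 : U -> U) (T0 T1 : V -> V).
Hypotheses (isoJ : isometric J) (isoJ' : isometric J').
Hypotheses (isoS0 : isometric S0) (isoS1 : isometric S1).
Hypotheses (isoT0 : isometric T0) (isoT1 : isometric T1).
Hypothesis S01 : forall x, x = S0 (hadj S0 x) + S1 (hadj S1 x).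
Hypothesis T01 : forall x, x = T0 (hadj T0 x) + T1 (hadj T1 x).

(* U = V (+) U via J' and V = U (+) V via J, hence U = V. *)
Definition swindle (z : U) : V := absorb J S0 S1 (emit2 J' T1 z) (emit1 J' T0 z).

Lemma swindle_isometric : isometric swindle.
Proof.
move=> x y; rewrite absorb_dot//.
have := absorb_dot isoJ' isoT0 isoT1 T01 (emit1 J' T0 x) (emit2 J' T1 x)
  (emit1 J' T0 y) (emit2 J' T1 y).
by rewrite !(emitK isoJ' T01) => ->; rewrite addrC.
Qed.

Lemma swindle_surj y : exists z, swindle z = y.
Proof.
exists (absorb J' T0 T1 (emit2 J S1 y) (emit1 J S0 y)).
by rewrite /swindle (absorbK1 isoJ' isoT0 isoT1 T01)
  (absorbK2 isoJ' isoT0 isoT1 T01) emitK.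
Qed.

(** Each half costs [2 delta]: the emission out of [U] by [emit_intertwines], and the absorption
    into [V] by [absorb_intertwines]. *)
Lemma swindle_intertwines (A : 'B(U)) (B : 'B(V)) (delta : R) z :
  0 <= delta ->
  (forall x, A (S0 x) = S0 (A x)) -> (forall x, A (S1 x) = S1 (A x)) ->
  (forall x, B (T0 x) = T0 (B x)) -> (forall x, B (T1 x) = T1 (B x)) ->
  (forall y, hnorm (B y - (J (A (hadj J y)) + qproj J (B (qproj J y))))
    <= delta * hnorm y) ->
  (forall x, hnorm (A x - (J' (B (hadj J' x)) + qproj J' (A (qproj J' x))))
    <= delta * hnorm x) ->
  hnorm (swindle (A z) - B (swindle z)) <= 4 * delta * hnorm z.
Proof.
move=> d0 A0 A1 B0 B1 AB BA.
have h1 := @emit_intertwines _ _ _ J' T0 T1 isoJ' isoT0 isoT1 T01 B A delta B0 B1 d0 BA z.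
pose a := emit1 J' T0 z; pose b := emit2 J' T1 z.
have zn : hnorm z ^+ 2 = hnorm a ^+ 2 + hnorm b ^+ 2.
  exact: (emit_norm isoJ' isoT0 isoT1 T01).
have h2 := @absorb_intertwines _ _ _ J S0 S1 isoJ isoS0 isoS1 S01 A B delta A0 A1 AB b a.
have an : hnorm a <= hnorm z.
  by apply: ler_of_sqr; rewrite ?hnorm_ge0// zn lerDl sqr_ge0.
apply: le_trans (hnorm_triangle _ (absorb J S0 S1 (A b) (B a)) _) _.
have h3 : hnorm (swindle (A z) - absorb J S0 S1 (A b) (B a)) <= 2 * delta * hnorm z.
  apply: ler_of_sqr; first by rewrite !mulr_ge0 ?hnorm_ge0.
  by rewrite -absorbB// absorb_norm// addrC.
have h4 : hnorm (absorb J S0 S1 b a) = hnorm z := isometric_hnorm swindle_isometric z.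
rewrite h4 in h2; have := ler_wpM2l d0 an.
by move: h2 h3; rewrite -/(swindle z); lra.
Qed.

End Swindle.

(** * Representations that contain the identity representation *)

Section TupleEquiv.
Context {R : realType} {H K : hilbertType R}.
Variables (Lam : 'B(H) -> 'B(K)) (I : H -> K).
Hypotheses (rL : unital_rep Lam) (isoI : isometric I).
Hypothesis LamK : forall T, compress isoI (Lam T) = T.

(** Compression is a left inverse of [Lam]. The operators [X] in [Lam] of C*(u) are those of [N];
    these form a C*-algebra containing the new generators, and on it compression is
    multiplicative. *)
Lemma tuple_equiv_rep d (u : 'I_d -> 'B(H)) : tuple_equiv (fun i => Lam (u i)) u.
Proof.
have uC := cstar_subalgebra u; have [C1 Cl CM Ca cC] := uC.
have uC' := cstar_subalgebra (fun i => Lam (u i)); have [C'1 C'l C'M C'a cC'] := uC'.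
pose f := compress isoI.
pose N : set 'B(K) := [set X | cstar u (f X) /\ Lam (f X) = X].
have fLam T : f (Lam T) = T by exact: LamK.
have NLam T : cstar u T -> N (Lam T) by move=> CT; rewrite /N /= fLam.
have uN : unital_cstar_subalgebra N.
  split.
  - by rewrite -(unital_rep1 rL); exact: NLam.
  - move=> a X Y [fX <-] [fY <-]; rewrite -(unital_repZ rL) -(unital_repD rL).
    by apply: NLam; exact: Cl.
  - by move=> X Y [fX <-] [fY <-]; rewrite -(unital_repM rL); apply: NLam; exact: CM.
  - by move=> X [fX <-]; rewrite -(unital_rep_adj rL); apply: NLam; exact: Ca.
  - apply/closed_seqP => X hX; split.
      move/closed_seqP: cC; apply => e /hX[Y [fY _] YX]; exists (f Y) => //.
      by rewrite -compressB (le_trans (compress_opnorm _ _)).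
    apply: op_tends_eq => e e0; have [Y [fY YE] YX] := hX _ (divr_gt0 e0 (ltr0n _ 2)).
    apply: le_trans (opnorm_triangle _ Y _) _; rewrite [leRHS]splitr; apply: lerD => //.
    rewrite -{1}YE -(unital_repB rL) -compressB (le_trans (unital_rep_opnorm rL _))//.
    by rewrite (le_trans (compress_opnorm _ _))// opnormB_C.
have CN : cstar (fun i => Lam (u i)) `<=` N.
  by apply: cstar_min => // i; apply: NLam; exact: cstar_gen.
have CLam T : cstar u T -> cstar (fun i => Lam (u i)) (Lam T).
  apply: (@cstar_min _ _ _ u [set T | cstar (fun i => Lam (u i)) (Lam T)]) => [|i]; last first.
    exact: (@cstar_gen _ _ _ (fun i => Lam (u i))).
  split => /=.
  - by rewrite (unital_rep1 rL).
  - by move=> a X Y hX hY; rewrite (unital_repD rL) (unital_repZ rL); exact: C'l.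
  - by move=> X Y hX hY; rewrite (unital_repM rL); exact: C'M.
  - by move=> X hX; rewrite (unital_rep_adj rL); exact: C'a.
  - apply/closed_seqP => X hX; move/closed_seqP: cC'; apply => e /hX[Y CY YX].
    exists (Lam Y) => //; rewrite -(unital_repB rL).
    by rewrite (le_trans (unital_rep_opnorm rL _)).
exists f; split; last by move=> i; exact: fLam.
  split.
  - by move=> a X Y _ _; exact: compress_lin.
  - move=> X Y /CN[_ <-] /CN[_ <-].
    by rewrite -(unital_repM rL) !fLam.
  - by move=> X /CN[_ <-]; rewrite -(unital_rep_adj rL) !fLam.
split.
- by move=> X /CN[].
- by move=> X Y; rewrite !inE => /CN[_ XE] /CN[_ YE] XY; rewrite -XE -YE XY.
- by move=> T CT; exists (Lam T); [exact: CLam|exact: fLam].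
Qed.

End TupleEquiv.

(** * Direct sums with infinite multiplicity *)

Section PushExists.
Context {R : realType} {Om Om' : choiceType}.
Context {E : Om -> hilbertType R} {E' : Om' -> hilbertType R}.
Local Notation P := (l2pre (@fin_posfun R Om) E).
Local Notation P' := (l2pre (@fin_posfun R Om') E').

(** Both [J] and its adjoint are described on finitely supported families. Isometry reduces to
    [hadj J \o J] being the identity there, which is checked in each fibre. *)
Lemma push_exists (phi : Om -> Om') (A : forall w, E w -> E' (phi w))
    (push : (forall w, E w) -> forall w', E' w') :
  injective phi -> (forall w, isometric (A w)) ->
  (forall F w, push F (phi w) = A w (F w)) ->
  (forall F w', (forall w, phi w != w') -> push F w' = 0) ->
  exists J : complH P -> complH P', [/\ isometric J,
    forall F : P, exists2 G : P', J (emb F) = emb G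
      & forall w', (G : l2 _ _) w' = push F w'
  & forall G : P', exists2 F : P, hadj J (emb G) = emb F &
      forall w, (F : l2 _ _) w = hadj (A w) ((G : l2 _ _) (phi w))].
Proof.
move=> phi_inj isoA push_in push_out.
have AA' w x y : '[A w x, y] = '[x, hadj (A w) y].
  exact: (hadjP (isometric_blin (isoA w))).
have A_le w (x : E w) : hnorm (A w x) <= 1 * hnorm x.
  by rewrite mul1r isometric_hnorm.
pose h1 := padj_pull phi_inj ler01 AA' A_le push_in push_out.
pose h2 := padj_push phi_inj ler01 AA' A_le push_in push_out.
pose J := cext h1.
have J'E : hadj J =1 cext h2.
  by apply: (hadj_uniq (blin_cext h1)) => f g; exact: cext_adj.
have J_emb F : exists2 G : P', J (emb F) = emb G & forall w', (G : l2 _ _) w' = push F w'.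
  by eexists; first exact: cext_emb.
have J'_emb (G : P') : exists2 F : P, hadj J (emb G) = emb F &
      forall w, (F : l2 _ _) w = hadj (A w) ((G : l2 _ _) (phi w)).
  by eexists; first by rewrite J'E; exact: cext_emb.
exists J; split=> // f g.
rewrite (hadjP (blin_cext h1)); congr ('[_, _]).
have bJJ : isblin (hadj J \o J).
  apply: isblin_comp; first apply: isblin_hadj; exists 1 => //; exact: blin_cext.
have [M M0 bM] := bJJ.
apply: (blin_dense_eq bM (blin_id _)) => F /=.
have [G -> GE] := J_emb F; have [F' -> F'E] := J'_emb G.
by congr emb; apply: l2_ext => w; rewrite F'E GE push_in hadjJ.
Qed.

End PushExists.

Section DenseBounds.
Context {R : realType}.

Lemma opnorm_le_dense (P : prehilb R) (T : 'B(complH P)) (r : R) : 0 <= r ->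
  (forall x, hnorm (T (emb x)) <= r * hnorm (emb x)) -> opnorm T <= r.
Proof.
move=> r0 Tr; apply: opnorm_le_blin => // f.
apply: (@le_eps _ _ _ (opnorm T + r)) => [|e e0]; first by rewrite addr_ge0 ?opnorm_ge0.
have [x hx] := emb_dense f e0.
have h1 : hnorm (T f) <= hnorm (T (f - emb x)) + hnorm (T (emb x)).
  by rewrite -{1}(subrK (emb x) f) linearD hnormD.
have h2 : hnorm (emb x) <= hnorm f + e.
  have := hnormD (emb x - f) f; rewrite subrK hnormBC; lra.
have h3 : hnorm (T (f - emb x)) <= opnorm T * e.
  by rewrite (le_trans (bop_le _ _))// ler_wpM2l ?opnorm_ge0.
have h4 := le_trans (Tr x) (ler_wpM2l r0 h2).
apply: le_trans h1 _; rewrite mulrDr in h4; lra.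
Qed.

Lemma l2_pnorm_le (Om : Type) (mu : posfun R Om) (E : Om -> hilbertType R)
    (F G : l2pre mu E) (r : R) :
  0 <= r -> (forall w, hnorm ((G : l2 _ _) w) <= r * hnorm ((F : l2 _ _) w)) ->
  pnorm G <= r * pnorm F.
Proof.
move=> r0 GF; apply: ler_of_sqr; first by rewrite mulr_ge0 ?pnorm_ge0.
rewrite exprMn !l2pre_norm -(pintZ _ (l2P F)).
apply: pint_le => [||w]; first exact: (l2P G).
  exact: pdomZ (l2P F).
by rewrite -exprMn ler_pXn2r ?nnegrE ?mulr_ge0 ?hnorm_ge0.
Qed.

End DenseBounds.

Section SumSpace.
Context {R : realType} {H : hilbertType R}.
Variables (A : nat -> hilbertType R) (rA : forall m, 'B(H) -> 'B(A m)).
Hypothesis rrA : forall m, unital_rep (rA m).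

(** The first index is the stage of the tower; the second, absent from the value, numbers the
    infinitely many copies of that stage. *)
Definition sumE (w : nat * nat) : hilbertType R := A w.1.
Definition sum_pre : prehilb R := l2pre (@fin_posfun R (nat * nat)%type) sumE.
Definition sum_space : hilbertType R := complH sum_pre.
Local Notation ev F w := ((F : l2 (@fin_posfun R (nat * nat)%type) sumE) w).

Let rrE w : unital_rep (rA w.1 : 'B(H) -> 'B(sumE w)). Proof. exact: rrA. Qed.

Definition sum_rep : 'B(H) -> 'B(sum_space) := pointwise_rep _ rrE.

Lemma unital_sum_rep : unital_rep sum_rep.
Proof. exact: unital_pointwise_rep. Qed.

Lemma sum_rep_emb T (F : sum_pre) : exists2 G : sum_pre,
  sum_rep T (emb F) = emb G & forall w, ev G w = rA w.1 T (ev F w).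
Proof. by eexists; first exact: pointwise_rep_emb. Qed.

(** Copy [k] of every stage moves to copy [2 k + b], so the range consists of the copies of parity
    [b]. Copies of a stage carry the same representation, whence the commutation. *)
Lemma sum_shift (b : bool) : exists S : sum_space -> sum_space,
  [/\ isometric S,
    forall T x, sum_rep T (S x) = S (sum_rep T x)
  & forall G : sum_pre, exists2 F : sum_pre, S (hadj S (emb G)) = emb F &
     forall m k, ev F (m, k) = if odd k == b then ev G (m, k) else 0].
Proof.
pose phi (w : nat * nat) := (w.1, (b + w.2.*2)%N).
pose id_ w (x : sumE w) : sumE (phi w) := x.
pose push (F : forall w, sumE w) (w' : nat * nat) : sumE w' :=
  match w' return sumE w' with
  | (m, k) => if odd k == b then F (m, k./2) else 0
  end.
have phi_inj : injective phi.
  move=> [m j] [m' j'] [-> /addnI /double_inj ->] //.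
have iso_id w : isometric (id_ w) by [].
have hadj_id w x : hadj (id_ w) x = x by exact: (hadjJ (iso_id w) x).
have push_in F w : push F (phi w) = id_ w (F w).
  case: w => m j /=; rewrite oddD odd_double addbF oddb eqxx.
  by rewrite half_bit_double.
have push_out F w' : (forall w, phi w != w') -> push F w' = 0.
  case: w' => m k nphi /=; case: ifP => // /eqP kb.
  by have := nphi (m, k./2); rewrite /phi /= -kb odd_double_half eqxx.
have [S [isoS SE S'E]] := push_exists phi_inj iso_id push_in push_out.
exists S; split=> // [T x|G].
  have [M1 _ b1] := isblin_comp (isblin_bop (sum_rep T)) (isometricP isoS).
  have [M2 _ b2] := isblin_comp (isometricP isoS) (isblin_bop (sum_rep T)).
  apply: (blin_dense_eq b1 b2) => F.
  rewrite -[LHS]/(sum_rep T (S (emb F))) -[RHS]/(S (sum_rep T (emb F))).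
  have [G1 -> G1E] := SE F; have [G2 -> G2E] := sum_rep_emb T G1.
  have [G3 -> G3E] := sum_rep_emb T F; have [G4 -> G4E] := SE G3.
  congr emb; apply: l2_ext => -[m k].
  rewrite G2E G1E G4E /= G3E; case: ifP => // _; exact: linear0.
have [F -> FE] := S'E G; have [F' -> F'E] := SE F.
exists F' => // m k; rewrite F'E /=; case: ifP => // /eqP kb.
by rewrite FE hadj_id /phi /= -kb odd_double_half.
Qed.

(** Even and odd copies exhaust the sum: two Cuntz isometries in the commutant, which express that
    the representation is equivalent to its double. *)
Lemma sum_cuntz : exists S0 S1 : sum_space -> sum_space,
  [/\ isometric S0, isometric S1,
    forall x, x = S0 (hadj S0 x) + S1 (hadj S1 x),
    forall T x, sum_rep T (S0 x) = S0 (sum_rep T x)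
  & forall T x, sum_rep T (S1 x) = S1 (sum_rep T x)].
Proof.
have [S0 [iso0 c0 p0]] := sum_shift false; have [S1 [iso1 c1 p1]] := sum_shift true.
exists S0, S1; split=> //.
have [M _ bM] : isblin (fun x => S0 (hadj S0 x) + S1 (hadj S1 x)).
  apply: isblinD; [apply: (@isblin_comp _ _ _ _ S0)|apply: (@isblin_comp _ _ _ _ S1)];
  by [exact: isometricP|exact/isblin_hadj/isometricP].
apply: (blin_dense_eq (@blin_id _ sum_space) bM) => G.
have [F0 -> F0E] := p0 G; have [F1 -> F1E] := p1 G.
have := emb_lin 1 F0 F1; rewrite !scale1r => <-; congr emb; apply: l2_ext => -[m k].
rewrite l2D F0E F1E; by case: (odd k); rewrite /= ?addr0 ?add0r.
Qed.

(** Copy 0 of stage 0 will carry the identity representation, which makes the sum faithful. *)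
Lemma sum_incl : exists (I : A 0%N -> sum_space) (isoI : isometric I),
  forall T, compress isoI (sum_rep T) = rA 0%N T.
Proof.
pose s (x : A 0%N) (w : nat * nat) : sumE w :=
  match w return sumE w with (0, 0)%N => x | _ => 0 end.
have sdom x : pdom (@fin_posfun R (nat * nat)%type) (fun w => hnorm (s x w) ^+ 2).
  apply/fin_domP; exists [:: (0, 0)%N] => // -[[|m] [|k]] //= _;
  by rewrite hnorm0 expr0n.
pose sv x : sum_pre := L2 (sdom x).
have form (F : sum_pre) y : pform F (sv y) = '[ev F (0, 0)%N, y].
  apply: complex_ext; rewrite /= /pint_dot /= (@fin_sumE _ _ [:: (0, 0)%N]) ?big_seq1//.
    by move=> -[[|m] [|k]] //= _; rewrite dot0r.
  by move=> -[[|m] [|k]] //= _; rewrite dot0r.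
have isoI : isometric (fun x => emb (sv x)).
  by move=> x y; rewrite dot_emb form.
exists (fun x => emb (sv x)), isoI => T; apply: bop_ext => x; apply: dot_ext => y.
rewrite compress_dot; have [G -> GE] := sum_rep_emb T (sv x).
by rewrite dot_emb form GE.
Qed.

End SumSpace.

Section SumShift.
Context {R : realType} {H K : hilbertType R} {d : nat}.
Variables (A : nat -> hilbertType R) (rA : forall m, 'B(H) -> 'B(A m)).
Variables (B : nat -> hilbertType R) (rB : forall m, 'B(K) -> 'B(B m)).
Hypotheses (rrA : forall m, unital_rep (rA m)) (rrB : forall m, unital_rep (rB m)).
Variables (u : 'I_d -> 'B(H)) (v : 'I_d -> 'B(K)) (J : forall m, A m -> B m.+1) (r : R).
Hypotheses (isoJ : forall m, isometric (@J m)) (r0 : 0 <= r).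
Hypothesis J_le : forall m i x,
  hnorm (hadj (@J m) (rB m.+1 (v i) (J x)) - rA m (u i) x) <= r * hnorm x.

(** The fibre maps go from stage [m] to stage [m.+1], keeping the copy; stage 0 of [B] is left out
    of the range. The error is fibrewise, hence again at most [r] on the sum. *)
Lemma sum_embedding : exists (JJ : sum_space A -> sum_space B) (isoJJ : isometric JJ),
  forall i, opnorm (compress isoJJ (sum_rep rrB (v i)) - sum_rep rrA (u i)) <= r.
Proof.
pose phi (w : nat * nat) := (w.1.+1, w.2).
pose J_ w : sumE A w -> sumE B (phi w) := @J w.1.
pose push (F : forall w, sumE A w) (w' : nat * nat) : sumE B w' :=
  match w' return sumE B w' with
  | (m.+1, j) => J (F (m, j))
  | (0, j) => 0
  end.
have phi_inj : injective phi by move=> [m j] [m' j'] [-> ->].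
have push_in F w : push F (phi w) = J_ w (F w) by case: w.
have push_out F w' : (forall w, phi w != w') -> push F w' = 0.
  by case: w' => -[|m] j // /(_ (m, j)); rewrite eqxx.
have iso_ w : isometric (J_ w) by exact: isoJ.
have [JJ [isoJJ JE J'E]] := push_exists phi_inj iso_ push_in push_out.
exists JJ, isoJJ => i; apply: opnorm_le_dense => // F.
rewrite bopB compressE; have [G1 -> G1E] := JE F.
have [G2 -> G2E] := sum_rep_emb rrB (v i) G1; have [G3 -> G3E] := J'E G2.
have [G4 -> G4E] := sum_rep_emb rrA (u i) F.
have -> : emb G3 - emb G4 = emb (G3 - G4).
  by have := emb_lin (-1) G4 G3; rewrite !scaleN1r addrC => ->; rewrite addrC.
rewrite !hnorm_emb; apply: l2_pnorm_le => // -[m j].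
have -> : (G3 - G4 : l2 _ _) (m, j) = (G3 : l2 _ _) (m, j) - (G4 : l2 _ _) (m, j) by [].
by rewrite G3E G2E G1E G4E; exact: J_le.
Qed.

End SumShift.

(** * The two towers and the comparison of their sums *)

Record stage {R : realType} (H : hilbertType R) := Stage {
  ssp : hilbertType R;
  srep : 'B(H) -> 'B(ssp);
  srepP : unital_rep srep }.

Section NextStage.
Context {R : realType} {H K L : hilbertType R} {d : nat}.
Variables (u : 'I_d -> 'B(H)) (v : 'I_d -> 'B(K)).
Variables (pi : 'B(H) -> 'B(L)) (Psi : 'B(K) -> 'B(L)) (r : R).
Hypotheses (fpi : faithful_unital_rep (cstar u) pi) (uPsi : ucp (opsys v) Psi).
Hypothesis piPsi : forall i, opnorm (pi (u i) - Psi (v i)) <= r.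

(** The same [pi] and [Psi] serve above every representation, so the error stays [r] at all stages
    instead of accumulating. *)
Lemma next_stage : exists (F : stage H -> stage K) (J : forall s, ssp s -> ssp (F s)),
  forall s, isometric (@J s) /\ forall i x,
    hnorm (hadj (@J s) (srep (F s) (v i) (J s x)) - srep s (u i) x) <= r * hnorm x.
Proof.
have step (s : stage H) : exists (t : stage K) (J : ssp s -> ssp t), isometric J /\
    forall i x, hnorm (hadj J (srep t (v i) (J x)) - srep s (u i) x) <= r * hnorm x.
  have [L' [rho [J [rrho isoJ Jle]]]] := dilation fpi uPsi (srepP s).
  exists (Stage rrho), J; split=> // i x; apply: le_trans (Jle i x) _.
  by rewrite ler_wpM2r ?hnorm_ge0.
exists (fun s => projT1 (cid (step s))), (fun s => projT1 (cid (projT2 (cid (step s))))).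
by move=> s; case: cid => t [J JP] /=; case: cid.
Qed.

End NextStage.

Section CloseTuples.
Context {R : realType} {H K L1 L2 : hilbertType R} {d : nat}.
Variables (u : 'I_d -> 'B(H)) (v : 'I_d -> 'B(K)) (r : R).
Variables (pi1 : 'B(H) -> 'B(L1)) (Psi1 : 'B(K) -> 'B(L1)).
Variables (pi2 : 'B(K) -> 'B(L2)) (Psi2 : 'B(H) -> 'B(L2)).
Hypotheses (uu : forall i, unitary (u i)) (uv : forall i, unitary (v i)).
Hypotheses (fpi1 : faithful_unital_rep (cstar u) pi1) (uPsi1 : ucp (opsys v) Psi1).
Hypotheses (fpi2 : faithful_unital_rep (cstar v) pi2) (uPsi2 : ucp (opsys u) Psi2).
Hypothesis r1 : forall i, opnorm (pi1 (u i) - Psi1 (v i)) <= r.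
Hypothesis r2 : forall i, opnorm (pi2 (v i) - Psi2 (u i)) <= r.
Hypothesis r0 : 0 <= r.

Let unital_rep_unitary (H' K' : hilbertType R) (f : 'B(H') -> 'B(K')) T :
  unital_rep f -> unitary T -> unitary (f T).
Proof.
move=> rf [h1 h2]; rewrite /unitary -(unital_rep_adj rf) -!(unital_repM rf) h1 h2.
by rewrite (unital_rep1 rf).
Qed.

Let unitary_opnorm (H' : hilbertType R) (T : 'B(H')) : unitary T -> opnorm T <= 1.
Proof.
by move=> /unitary_isometric[h _]; apply: opnorm_le_blin => // x; rewrite h mul1r.
Qed.

(** A surjective isometry is unitary, and inflation along it is conjugation. *)
Lemma unital_rep_inflate (U V : hilbertType R) (W : U -> V) (isoW : isometric W) :
  (forall y, exists x, W x = y) -> unital_rep (inflate isoW).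
Proof.
move=> surj; have WK y : W (hadj W y) = y by have [x <-] := surj y; rewrite hadjJ.
split; last by apply: bop_ext => y; rewrite inflateE WK.
split=> [a S T _ _|S T _ _|T _].
- apply: bop_ext => y; rewrite bopD bopZ !inflateE bopD bopZ.
  exact: (isometric_blin isoW).1.
- by apply: bop_ext => y; rewrite bopM !inflateE hadjJ.
- apply: bop_ext => y; apply: dot_ext => z; rewrite adjPl !inflateE.
  by rewrite (hadjP (isometric_blin isoW)) adjPl (hadjC (isometric_blin isoW)).
Qed.

Lemma close_tuples : exists (L : hilbertType R) (u' v' : 'I_d -> 'B(L)),
  [/\ tuple_equiv u' u, tuple_equiv v' v
    & forall i, opnorm (u' i - v' i) <= 10 * Num.sqrt r].
Proof.
have [F [JF JFP]] := next_stage fpi1 uPsi1 r1.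
have [G [JG JGP]] := next_stage fpi2 uPsi2 r2.
have rid (H' : hilbertType R) : unital_rep (fun T : 'B(H') => T) by [].
(* Both towers are built at once, because each new stage lies above the previous stage of the other
   one. *)
pose st := fix st (m : nat) : stage H * stage K :=
  if m is m'.+1 then (G (st m').2, F (st m').1) else (Stage (rid H), Stage (rid K)).
pose A m := ssp (st m).1; pose B m := ssp (st m).2.
pose rA m : 'B(H) -> 'B(A m) := @srep _ _ (st m).1.
pose rB m : 'B(K) -> 'B(B m) := @srep _ _ (st m).2.
have rrA m : unital_rep (rA m) := srepP (st m).1.
have rrB m : unital_rep (rB m) := srepP (st m).2.
pose JA m : A m -> B m.+1 := @JF (st m).1.
pose JB m : B m -> A m.+1 := @JG (st m).2.
have isoA m : isometric (@JA m) := (JFP (st m).1).1.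
have isoB m : isometric (@JB m) := (JGP (st m).2).1.
have [J [isoJ J_le]] := @sum_embedding _ _ _ _ A rA B rB rrA rrB u v JA r isoA r0
  (fun m i x => (JFP (st m).1).2 i x).
have [J' [isoJ' J'_le]] := @sum_embedding _ _ _ _ B rB A rA rrB rrA v u JB r isoB r0
  (fun m i x => (JGP (st m).2).2 i x).
have [S0 [S1 [isoS0 isoS1 S01 cS0 cS1]]] := sum_cuntz rrA.
have [T0 [T1 [isoT0 isoT1 T01 cT0 cT1]]] := sum_cuntz rrB.
pose W := swindle J J' S0 S1 T0 T1.
have isoW : isometric W := swindle_isometric isoJ isoJ' isoS0 isoS1 isoT0 isoT1 S01 T01.
have surjW : forall y, exists x, W x = y.
  exact: (swindle_surj isoJ isoJ' isoT0 isoT1 S01 T01).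
pose RA := sum_rep rrA; pose RB := sum_rep rrB.
have rRA : unital_rep RA := unital_sum_rep rrA.
have rRB : unital_rep RB := unital_sum_rep rrB.
have rLam : unital_rep (inflate isoW \o RA).
  by apply: unital_rep_comp => //; exact: unital_rep_inflate.
have [IA [isoIA IAE]] := sum_incl rrA; have [IB [isoIB IBE]] := sum_incl rrB.
exists (sum_space B), (fun i => (inflate isoW \o RA) (u i)), (fun i => RB (v i)); split.
(* The initial stage inside [U], carried over by [W], recovers every [T] from its image by
   compression. *)
- have isoWI : isometric (W \o IA) by move=> x y /=; rewrite isoW isoIA.
  apply: (tuple_equiv_rep rLam (isoI := isoWI)) => T; apply: bop_ext => x.
  apply: dot_ext => y; rewrite compress_dot /= inflateE isoW hadjJ// -compress_dot.
  by rewrite IAE.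
- apply: (tuple_equiv_rep rRB (isoI := isoIB)) => T; exact: IBE.
move=> i; have uA : unitary (RA (u i)) by exact: unital_rep_unitary.
have uB : unitary (RB (v i)) by exact: unital_rep_unitary.
have s0 : 0 <= Num.sqrt r := sqrtr_ge0 _.
have ss : Num.sqrt r ^+ 2 = r by rewrite sqr_sqrtr.
(* For [r > 1] the trivial bound 2 is below [10 sqrt r]; only [r <= 1] needs the swindle. *)
have [r1'|r1'] := leP r 1; last first.
  have h1 := unitary_opnorm (unital_rep_unitary rLam (uu i)).
  have h2 := unitary_opnorm uB.
  have : opnorm (- RB (v i)) = opnorm (RB (v i)).
    by rewrite -scaleN1r opnormZ cabsN normr1 mul1r.
  have := opnormD ((inflate isoW \o RA) (u i)) (- RB (v i)).
  have : 1 <= Num.sqrt r by apply: ler_of_sqr => //; rewrite ss expr1n ltW.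
  lra.
have s1 : Num.sqrt r <= 1 by apply: ler_of_sqr => //; rewrite ss expr1n.
pose delta := r + Num.sqrt (2 * r).
have d0 : 0 <= delta by rewrite addr_ge0// sqrtr_ge0.
have dle : 4 * delta <= 10 * Num.sqrt r.
  (* 3/2 is a rational upper bound for [sqrt 2]; with [r <= sqrt r] this gives
     [delta <= 5/2 sqrt r]. *)
  have : Num.sqrt (2 * r) <= 3 / 2 * Num.sqrt r.
    apply: ler_of_sqr; first by rewrite mulr_ge0.
    have -> : (3 / 2 * Num.sqrt r) ^+ 2 = 9 / 4 * r by rewrite exprMn ss; field.
    by rewrite sqr_sqrtr ?mulr_ge0//; have := r0; lra.
  by rewrite /delta; nra.
apply: opnorm_le_blin => [|y]; first by rewrite mulr_ge0.
apply: (@le_trans _ _ (4 * delta * hnorm y)); last by rewrite ler_wpM2r ?hnorm_ge0.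
(* At [y = W z] the inner adjoint of [W] cancels, leaving the defect of intertwining estimated
   before. *)
have [z <-] := surjW y; rewrite bopB (isometric_hnorm isoW).
rewrite -[(_ \o _) (u i)]/(inflate isoW (RA (u i))) inflateE hadjJ//.
have hAB x := almost_reducing r0 r1' x uA uB (J_le i).
have hBA x := almost_reducing r0 r1' x uB uA (J'_le i).
exact: (swindle_intertwines isoJ isoJ' isoS0 isoS1 isoT0 isoT1 S01 T01 z d0
  (cS0 (u i)) (cS1 (u i)) (cT0 (v i)) (cT1 (v i)) hAB hBA).
Qed.

End CloseTuples.

(** * Passage to the infima *)

Local Open Scope ereal_scope.

Lemma tdist_ge0 {R : realType} {H : hilbertType R} {d : nat} (A B : 'I_d -> 'B(H)) :
  (0 <= tdist A B)%R.
Proof. exact: bigmax_ge_id. Qed.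

Lemma opnorm_le_tdist {R : realType} {H : hilbertType R} {d : nat}
    (A B : 'I_d -> 'B(H)) i :
  (opnorm (A i - B i) <= tdist A B)%R.
Proof. exact: le_bigmax. Qed.

Lemma tdist_le {R : realType} {H : hilbertType R} {d : nat}
    (A B : 'I_d -> 'B(H)) (M : R) :
  (0 <= M)%R -> (forall i, opnorm (A i - B i) <= M)%R -> (tdist A B <= M)%R.
Proof. by move=> M0 hM; apply: bigmax_le. Qed.

Lemma drD_to_ge0 {R : realType} {d : nat} {H K : hilbertType R}
  (A : 'I_d -> 'B(H)) (B : 'I_d -> 'B(K)) : 0 <= drD_to A B.
Proof.
apply: le_ereal_inf_tmp => _ [L [pi [Psi [_ _ ->]]]].
by rewrite lee_fin tdist_ge0.
Qed.

Theorem theorem2p1 (R : realType) (H K : hilbertType R) (d : nat)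
    (u : 'I_d -> 'B(H)) (v : 'I_d -> 'B(K))
    (sepH : separable H) (sepK : separable K)
    (unitary_u : forall i, unitary (u i)) (unitary_v : forall i, unitary (v i)) :
  dHR u v <= 10%:E * (drD u v) `^ (2^-1).
Proof.
(* The infima need not be attained, so the estimate is made for each [r] strictly above both, which
   supplies actual [pi] and [Psi] in both directions. *)
have bound (r : R) : drD u v < r%:E -> dHR u v <= (10 * Num.sqrt r)%:E.
  rewrite /drD gt_max => /andP[/ereal_inf_lt[_ [L1 [pi1 [Psi1 [f1 p1 ->]]]] d1]].
  move=> /ereal_inf_lt[_ [L2 [pi2 [Psi2 [f2 p2 ->]]]] d2].
  have r0 : (0 <= r)%R by rewrite -lee_fin (le_trans _ (ltW d1))// lee_fin tdist_ge0.
  have [||L [u' [v' [eu ev uv]]]] := close_tuples unitary_u unitary_v f1 p1 f2 p2 _ _ r0.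
  - move=> i; rewrite -lee_fin (le_trans _ (ltW d1))// lee_fin.
    exact: (opnorm_le_tdist (pi1 \o u)).
  - move=> i; rewrite -lee_fin (le_trans _ (ltW d2))// lee_fin.
    exact: (opnorm_le_tdist (pi2 \o v)).
  apply: (@le_trans _ _ (tdist u' v')%:E); last first.
    by rewrite lee_fin tdist_le// mulr_ge0 ?sqrtr_ge0.
  by apply: ereal_inf_lbound; exists L, u', v'.
have D0 : 0 <= drD u v by rewrite le_max drD_to_ge0.
move: D0 bound; case: (drD u v) => [m|_ _|//].
  rewrite lee_fin => m0 bound; apply/lee_addgt0Pr => e e0.
  have s0 := sqrtr_ge0 m; have ss : (Num.sqrt m ^+ 2 = m)%R by rewrite sqr_sqrtr.
  have e1 : (0 < e / 10)%R by rewrite divr_gt0.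
  (* Chosen so that the square root of this value is [sqrt m + e / 10], which after multiplication
     by 10 leaves exactly the slack [e]. *)
  have := bound ((Num.sqrt m + e / 10) ^+ 2)%R.
  rewrite sqrtr_sqr ger0_norm ?addr_ge0 ?(ltW e1)//.
  rewrite poweR_EFin powR12_sqrt// -EFinM -EFinD.
  have -> : (10 * (Num.sqrt m + e / 10) = 10 * Num.sqrt m + e)%R by field.
  apply; rewrite lte_fin -[ltLHS]ss; nra.
(* If the relaxed distance is infinite, so is the right-hand side; [D0] has already discarded
   [-oo]. *)
have -> : +oo `^ (2^-1) = +oo :> \bar R.
  by rewrite poweRyr// invr_eq0 pnatr_eq0.
by rewrite gt0_muley ?leey// lte_fin.
Qed.
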